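(* Let $Q$ be an $n$-dimensional manifold, $[a,b]\subset\mathbb{R}$, $q_a,q_b\in Q$, $0<\alpha\le 1$, $0<\beta\le 1$, and let $t$ be the real parameter entering the action defined in the context. Let $L:TQ\to\mathbb{R}$ be a Lagrangian of class $C^2$ with respect to $q$ and $v$, with globally Lipschitz first derivatives with respect to $q$ and $v$. Let $\gamma_r:Q\to\mathbb{R}$, $r=1,\dots,m$, be deterministic functions of class $C^2$ with globally Lipschitz first derivatives. Let $W^1,\dots,W^m$ be independent real-valued Wiener processes on $[a,b]$ defined on a probability space $(\Omega,\mathcal{F},P)$ with the filtration generated by them. Let $\mathcal{C}(PQ)$ and the stochastic Hamilton–Pontryagin fractional action $\mathcal{A}^{\alpha,\beta}:\Omega\times\mathcal{C}(PQ)\to\mathbb{R}$ be as defined in the context. Then, almost surely, a curve $c=(q,v,p)\in\mathcal{C}(PQ)$ satisfies the stochastic fractional equations (sum over $r=1,\dots,m$) $$dq(s)=v(s)\,ds,$$ $$dp(s)=\Big(\frac{\partial L}{\partial q}(q(s),v(s))+\frac{\partial L}{\partial v}(q(s),v(s))\,\frac{\alpha-1}{t-s}\Big)ds+\frac{\Gamma(\alpha)}{\Gamma(\beta)}\,\frac{\partial\gamma_r(q(s))}{\partial q}\,(t-s)^{\beta-\alpha}\circ dW^r(s),$$ $$p(s)=\frac{\partial L}{\partial v}(q(s),v(s)),\qquad s\in[a,b],$$ if and only if $c$ is a critical point of $\mathcal{A}^{\alpha,\beta}$, i.e. $d\mathcal{A}^{\alpha,\beta}(c)=0$.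
   Context: Notation: $PQ=TQ\oplus T^*Q$, with local coordinates $(q,v,p)$; $(\cdot,\cdot)$ denotes the natural pairing of covectors with vectors; $\Gamma(\cdot)$ is Euler's gamma function; the repeated index $r$ is summed over $1,\dots,m$. The differential equations are written in local coordinates. Path space: $$\mathcal{C}(PQ)=\{(q,v,p)\in C^0([a,b],PQ)\ :\ q\in C^1([a,b],Q),\ q(a)=q_a,\ q(b)=q_b\}.$$ Its tangent space at $c=(q,v,p)$ consists of maps $(q,v,p,\delta q,\delta v,\delta p)\in C^0([a,b],T(PQ))$ such that $\delta q(a)=\delta q(b)=0$ and $q,\delta q$ are of class $C^1$. Stochastic Hamilton–Pontryagin fractional action (depending also on the real parameter $t$): $$\mathcal{A}^{\alpha,\beta}(q,v,p,t)=\frac{1}{\Gamma(\alpha)}\int_a^b\Big(L(q(s),v(s))(t-s)^{\alpha-1}+(p(s),\dot q(s)-v(s))(t-s)^{\alpha-1}\Big)ds+\frac{1}{\Gamma(\beta)}\int_a^b\gamma_r(q(s))(t-s)^{\beta-1}\circ dW^r(s).$$ The first integral is a Riemann integral and the second is an Itô integral (written with the symbol $\circ$; the stochastic differential equations can equally be written in Itô form, since the Itô modification to the drift is zero). Differential of the action: for a one-parameter family $(q,v,p)(\cdot,\varepsilon)\in\mathcal{C}(PQ)$, differentiable in $\varepsilon$, equal to $c$ at $\varepsilon=0$, with $$\delta q(s)=\tfrac{\partial}{\partial\varepsilon}q(s,\varepsilon)|_{\varepsilon=0},\quad \delta v(s)=\tfrac{\partial}{\partial\varepsilon}v(s,\varepsilon)|_{\varepsilon=0},\quad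 \delta p(s)=\tfrac{\partial}{\partial\varepsilon}p(s,\varepsilon)|_{\varepsilon=0},\quad \delta q(a)=\delta q(b)=0,$$ put $$d\mathcal{A}^{\alpha,\beta}(\delta q,\delta v,\delta p)=\frac{\partial}{\partial\varepsilon}\mathcal{A}^{\alpha,\beta}(\omega,q(s,\varepsilon),v(s,\varepsilon),p(s,\varepsilon))\Big|_{\varepsilon=0}.$$ The condition $d\mathcal{A}^{\alpha,\beta}(c)=0$ means that this vanishes for all tangent vectors $(\delta q,\delta v,\delta p)$ at $c$. *)

(* Defs.v *)
(* MathComp-Analysis *)
From HB Require Import structures.
From mathcomp Require Export all_boot all_order all_algebra.
From mathcomp Require Export all_classical all_reals all_analysis.

Export Order.TTheory GRing.Theory Num.Theory.
Export numFieldNormedType.Exports.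

Set Implicit Arguments.
Unset Strict Implicit.
Unset Printing Implicit Defensive.

Local Open Scope classical_set_scope.
Local Open Scope ring_scope.

Section calculus.
Context {R : realType}.

(* Euler's integral; meaningful for x > 0. *)
Definition Gamma (x : R) : R :=
  \int[lebesgue_measure]_(u in `]0, +oo[) (u `^ (x - 1) * expR (- u)).

(* k times continuously differentiable on the open set A. *)
Fixpoint Ck {V W : normedModType R} (k : nat) (A : set V) (f : V -> W) : Prop :=
  match k with
  | 0 => forall x, A x -> {for x, continuous f}
  | k'.+1 => (forall x, A x -> differentiable f x) /\
             forall v, Ck k' A (fun x => 'D_v f x)
  end.

Definition smooth {V W : normedModType R} (A : set V) (f : V -> W) : Prop :=
  forall k, Ck k A f.

Definition pairing {n : nat} (p v : 'rV[R]_n) : R := \sum_k p 0 k * v 0 k.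

Definition grad {n : nat} (f : 'rV[R]_n -> R) (x : 'rV[R]_n) : 'rV[R]_n :=
  \row_k 'D_(delta_mx 0 k) f x.

(* Derivative on the closed interval [a, b]: one-sided at the endpoints, and
   blind to the values of g outside [a, b]. *)
Definition quotient_within {V : normedModType R} (a b : R) (g : R -> V) (s : R) :
    set_system V :=
  (fun h => h^-1 *: (g (s + h) - g s)) @
    within [set h | a <= s + h <= b] (0 : R)^'.

Definition derive_within {V : normedModType R} (a b : R) (g : R -> V) (s : R) : V :=
  lim (quotient_within a b g s).

Definition C1_within {V : normedModType R} (a b : R) (D : set R) (g : R -> V) : Prop :=
  (forall s, D s -> cvg (quotient_within a b g s)) /\
  {within D, continuous (derive_within a b g)}.

End calculus.

(* The integral of f against w over [u, v] as the limit, when the mesh of the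
   partition tends to 0, of the sums whose integrand is evaluated at the left
   endpoint of each subinterval (Ito's choice). It is taken path by path: in
   this development s |-> f s is always C^1 along a given path, so the limit
   exists for every continuous w, and this is the version of the Ito integral
   for which the action is a function of both the sample point and the curve. *)
Section ito.
Context {R : realType}.

Definition left_sum (f w : R -> R) (u : R) (s : seq R) : R :=
  \sum_(k < size s)
    f (nth 0 (u :: s) k) * (w (nth 0 s k) - w (nth 0 (u :: s) k)).

Definition mesh_to_0 (u v : R) : set_system (seq R) :=
  [set S | exists2 d : R, 0 < d &
     forall s, itv_partition u v s ->
       (forall k, (k < size s)%N -> nth 0 s k - nth 0 (u :: s) k < d) -> S s].

Definition ito_integral (f w : R -> R) (u v : R) : R :=
  lim (left_sum f w u @ mesh_to_0 u v).

End ito.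

Section wiener.
Context {R : realType} {d : measure_display} {Omega : measurableType d}
        (P : probability Omega R) (a b : R).

(* The sigma-algebra generated by the random variables X j, j in J. *)
Definition sigma_of {T : Type} (J : set T) (X : T -> {RV P >-> R}) :
    set_system Omega :=
  <<s [set E | exists j, exists B : set R,
         [/\ J j, measurable B & E = X j @^-1` B]] >>.

Definition filtration_of {m : nat} (W : 'I_m -> R -> {RV P >-> R}) (u : R) :
    set_system Omega :=
  sigma_of [set z : 'I_m * R | a <= z.2 <= u] (fun z => W z.1 z.2).

Definition increment (w : R -> {RV P >-> R}) (u s : R) : Omega -> R :=
  fun om => w s om - w u om.

Definition wiener_process (F : R -> set_system Omega)
    (w : R -> {RV P >-> R}) : Prop :=
  [/\ {ae P, forall om, w a om = 0},
      {ae P, forall om, {within `[a, b], continuous (fun s => w s om)}},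
      forall s, a <= s <= b ->
        forall B : set R, measurable B -> F s (w s @^-1` B),
      forall u s, a <= u -> u < s -> s <= b ->
        forall (E : set Omega) (B : set R), F u E -> measurable B ->
          (P (E `&` increment w u s @^-1` B) =
             P E * P (increment w u s @^-1` B))%E &
      forall u s, a <= u -> u < s -> s <= b ->
        forall B : set R, measurable B ->
          P (increment w u s @^-1` B) = normal_prob 0 (Num.sqrt (s - u)) B].

Definition independent_processes {m : nat} (W : 'I_m -> R -> {RV P >-> R}) : Prop :=
  forall E : 'I_m -> set Omega,
    (forall r, sigma_of [set s | a <= s <= b] (W r) (E r)) ->
    (P (\bigcap_r E r) = \prod_(r < m) P (E r))%E.

End wiener.

(* A smooth n-dimensional manifold, given by an arbitrary smooth atlas together
   with a choice of a chart of the atlas around each point. *)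
Record manifold (R : realType) (n : nat) := Manifold {
  point :> topologicalType;
  chart : Type;
  dom : chart -> set point;
  coord : chart -> point -> 'rV[R]_n;
  param : chart -> 'rV[R]_n -> point;
  chart_at : point -> chart;
  manifold_hausdorff : hausdorff_space point;
  manifold_second_countable : @second_countable point;
  dom_open : forall i, open (dom i);
  coord_open : forall i, open (coord i @` dom i);
  coordK : forall i x, dom i x -> param i (coord i x) = x;
  coord_continuous : forall i x, dom i x -> {for x, continuous (coord i)};
  param_continuous :
    forall i y, (coord i @` dom i) y -> {for y, continuous (param i)};
  dom_chart_at : forall x, dom (chart_at x) x;
  transition_smooth : forall i j,
    smooth (coord i @` (dom i `&` dom j)) (coord j \o param i)
}.

(* A tangent vector or covector at x is its coordinate vector in the chart
   chart_at x, so that TQ = Q x R^n and PQ = TQ (+) T*Q = Q x R^n x R^n as sets.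
   The topology of these bundles is not the product one: continuity and
   differentiability are read in the charts, through tan_coord and cot_coord. *)
Section bundles.
Context {R : realType} {n : nat} {Q : manifold R n}.

Definition TQ : Type := (Q * 'rV[R]_n)%type.

Record PQ : Type := MkPQ { pos : Q; vel : 'rV[R]_n; mom : 'rV[R]_n }.

Definition transition (i j : chart Q) : 'rV[R]_n -> 'rV[R]_n := coord j \o param i.

Definition tan_coord (i : chart Q) (x : Q) (v : 'rV[R]_n) : 'rV[R]_n :=
  'd (transition (chart_at x) i) (coord (chart_at x) x) v.

Definition tan_of_coord (i : chart Q) (y u : 'rV[R]_n) : TQ :=
  (param i y, 'd (transition i (chart_at (param i y))) y u).

(* Characterized by pairing (cot_coord i x p) (tan_coord i x v) = pairing p v. *)
Definition cot_coord (i : chart Q) (x : Q) (p : 'rV[R]_n) : 'rV[R]_n :=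
  \row_k pairing p ('d (transition i (chart_at x)) (coord i x) (delta_mx 0 k)).

Definition loc (g : Q -> R) (i : chart Q) (y : 'rV[R]_n) : R := g (param i y).

Definition locT (L : TQ -> R) (i : chart Q) (y u : 'rV[R]_n) : R :=
  L (tan_of_coord i y u).

Definition dLdq (L : TQ -> R) (i : chart Q) (y u : 'rV[R]_n) : 'rV[R]_n :=
  grad (fun y' => locT L i y' u) y.

Definition dLdv (L : TQ -> R) (i : chart Q) (y u : 'rV[R]_n) : 'rV[R]_n :=
  grad (fun u' => locT L i y u') u.

(* There is no canonical distance on Q: Lipschitz continuity of derivatives is
   that of their expressions on the whole domain of each chart of the atlas. *)
Definition C2_lipschitz_lagrangian (L : TQ -> R) : Prop :=
  forall i, let A := (coord i @` dom i) `*` [set: 'rV[R]_n] in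
    [/\ Ck 2 A (fun z : 'rV[R]_n * 'rV[R]_n => locT L i z.1 z.2),
        [lipschitz dLdq L i z.1 z.2 | z in A] &
        [lipschitz dLdv L i z.1 z.2 | z in A]].

Definition C2_lipschitz (g : Q -> R) : Prop :=
  forall i, let A := coord i @` dom i in
    Ck 2 A (loc g i) /\ [lipschitz grad (loc g i) y | y in A].

End bundles.

Arguments TQ {R n} Q.
Arguments PQ {R n} Q.

Section action.
Context {R : realType} {n m : nat} {Q : manifold R n}.
Variables (a b : R) (qa qb : Q).
Variables (L : TQ Q -> R) (gam : 'I_m -> Q -> R) (alpha beta t : R).

Definition qcoord (i : chart Q) (c : R -> PQ Q) (s : R) : 'rV[R]_n :=
  coord i (pos (c s)).
Definition vcoord (i : chart Q) (c : R -> PQ Q) (s : R) : 'rV[R]_n :=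
  tan_coord i (pos (c s)) (vel (c s)).
Definition pcoord (i : chart Q) (c : R -> PQ Q) (s : R) : 'rV[R]_n :=
  cot_coord i (pos (c s)) (mom (c s)).

(* Curves are total functions of which only the restriction to [a, b] matters. *)
Definition path_space (c : R -> PQ Q) : Prop :=
  [/\ {within `[a, b], continuous (fun s => pos (c s))},
      pos (c a) = qa,
      pos (c b) = qb &
      forall i, let D := [set s | a <= s <= b /\ dom i (pos (c s))] in
        [/\ C1_within a b D (qcoord i c),
            {within D, continuous (vcoord i c)} &
            {within D, continuous (pcoord i c)}]].

(* The velocity of the curve q at s, a tangent vector at q(s). *)
Definition qdot (c : R -> PQ Q) (s : R) : 'rV[R]_n :=
  derive_within a b (qcoord (chart_at (pos (c s))) c) s.

(* w r is the path of the r-th Wiener process at the given sample point. *)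
Definition action (w : 'I_m -> R -> R) (c : R -> PQ Q) : R :=
  (Gamma alpha)^-1 *
    (\int[lebesgue_measure]_(s in `[a, b])
       (L (pos (c s), vel (c s)) * (t - s) `^ (alpha - 1) +
        pairing (mom (c s)) (qdot c s - vel (c s)) * (t - s) `^ (alpha - 1))) +
  (Gamma beta)^-1 *
    (\sum_(r < m)
       ito_integral (fun s => gam r (pos (c s)) * (t - s) `^ (beta - 1)) (w r) a b).

(* D is a set of pairs (s, eps). *)
Definition C1_in_eps (D : set (R * R)) (g : R -> R -> 'rV[R]_n) : Prop :=
  (forall z, D z -> derivable (g z.1) z.2 1) /\
  {within D, continuous (fun z => 'D_1 (g z.1) z.2)}.

(* One-parameter families in the path space through c. Differentiability in
   eps is with respect to the topology of the path space (C^1 in q, C^0 in v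
   and p), hence the conditions joint in (s, eps); then delta v and delta p are
   continuous, delta q is C^1, and delta q (a) = delta q (b) = 0. *)
Definition variation_of (c : R -> PQ Q) (F : R -> R -> PQ Q) : Prop :=
  exists2 eta : R, 0 < eta &
    let D := [set z : R * R | a <= z.1 <= b /\ `|z.2| < eta] in
    [/\ forall s, a <= s <= b -> F 0 s = c s,
        forall eps, `|eps| < eta -> path_space (F eps),
        {within D, continuous (fun z => pos (F z.2 z.1))} &
        forall i, let Di := D `&` [set z | dom i (pos (F z.2 z.1))] in
          [/\ C1_in_eps Di (fun s eps => qcoord i (F eps) s),
              C1_in_eps Di (fun s eps => derive_within a b (qcoord i (F eps)) s),
              C1_in_eps Di (fun s eps => vcoord i (F eps) s) &
              C1_in_eps Di (fun s eps => pcoord i (F eps) s)]].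

(* Tangent vectors to the path space at c are the eps-derivatives at 0 of the
   families through c. *)
Definition critical_point (w : 'I_m -> R -> R) (c : R -> PQ Q) : Prop :=
  forall F, variation_of c F ->
    is_derive (0 : R) (1 : R) (fun eps : R => action w (F eps) : R) 0.

(* The differential equations are integral equations, in the local coordinates
   of any chart, on any interval during which the curve stays in its domain. *)
Definition fractional_equations (w : 'I_m -> R -> R) (c : R -> PQ Q) : Prop :=
  forall (i : chart Q),
    let x := qcoord i c in let v := vcoord i c in let p := pcoord i c in
    (forall s1 s2, a <= s1 -> s1 <= s2 -> s2 <= b ->
       (forall s, s1 <= s <= s2 -> dom i (pos (c s))) ->
       forall k : 'I_n,
         x s2 0 k - x s1 0 k = \int[lebesgue_measure]_(s in `[s1, s2]) v s 0 k
         /\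
         p s2 0 k - p s1 0 k =
           \int[lebesgue_measure]_(s in `[s1, s2])
             (dLdq L i (x s) (v s) 0 k +
              dLdv L i (x s) (v s) 0 k * ((alpha - 1) / (t - s))) +
           \sum_(r < m)
             ito_integral
               (fun s => Gamma alpha / Gamma beta *
                  grad (loc (gam r) i) (x s) 0 k * (t - s) `^ (beta - alpha))
               (w r) s1 s2)
    /\
    (forall s, a <= s <= b -> dom i (pos (c s)) -> p s = dLdv L i (x s) (v s)).

End action.

(* Main.v *)
Require Import Defs.
From mathcomp Require Import measurable_realfun ring lra.

(** Once the sample point is fixed the theorem is deterministic. For almost every
    sample point the finitely many paths [w r] are continuous on [a, b], and then
    both sides of the equivalence only speak of the curve [c] and of these paths.

    A left-point integral of a C^1 function against a continuous path can be
    integrated by parts path by path ([ito_integral_by_parts]). In the action this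
    trades the noise integral for a boundary term and an ordinary integral. The
    curves of the path space share their end points, so the boundary term is the
    same for all of them: up to a constant, the action is the integral of a
    continuous [density] in which the paths [w r] enter but not their increments
    ([action_density]). It can then be differentiated under the integral sign along
    a family of curves ([action_derive]), and in a chart the derivative of the
    density is ([first_variation])
      \sum_k (force_k * dq_k + noisy_momentum_k * dq'_k)
        + (t - s)^(alpha - 1) * (<dL/dv - p, dv> + <q' - v, dp>),
    where the noisy momentum is (t - s)^(alpha - 1) p minus a combination of the
    products of w r with the gradient of gamma_r. The Euler-Lagrange system is
    therefore: q' = v, p = dL/dv, and the derivative of the noisy momentum is the
    force ([euler_lagrange]). Dividing the last equation by (t - s)^(alpha - 1),
    integrating it and undoing the integration by parts gives the stochastic
    momentum equation, so that the stochastic fractional equations are equivalent to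
    the Euler-Lagrange system in all charts ([fractional_euler_lagrange]).

    If the Euler-Lagrange system holds, the derivative of the density is the time
    derivative of the contraction of the noisy momentum with dq. That contraction
    does not depend on the chart and vanishes at a and b, so the derivative of the
    action is zero ([action_stationary]). Conversely, near a point of the curve every
    dq, dv, dp with support in one chart is realized by a family of curves
    ([chart_variation_of]). Criticality then gives an integral identity in that
    chart ([critical_weak]); testing it with dv and dp gives p = dL/dv and q' = v, and
    testing it with dq gives the third equation by the lemma of du Bois-Reymond
    ([critical_euler_lagrange]).

    Two points need care. The manifold has no global coordinates, so every object is
    read in charts and shown not to depend on the chart. And differentiating the
    density produces the second derivatives of gamma_r in the directions dq and q',
    in the order opposite to the one of the time derivative of the noisy momentum;
    the two agree because time and parameter derivatives can be exchanged along the
    family ([swap_derive], [hessian_symmetric]). *)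

Set Implicit Arguments.
Unset Strict Implicit.
Unset Printing Implicit Defensive.

Local Open Scope classical_set_scope.
Local Open Scope ring_scope.

(** * Continuity and integration on a segment *)

Lemma is_deriveE (R : realType) (V W : normedModType R) (f : V -> W) (x v : V) (l : W) :
  is_derive x v f l -> 'D_v f x = l.
Proof. by move=> d; exact: derive_val. Qed.

Lemma coord0_continuous (R : realType) n (k : 'I_n) : continuous (fun v : 'rV[R]_n => v 0 k).
Proof. exact: matrix_normedtype.coord_continuous. Qed.
Arguments coord0_continuous {R n} k x.

Section segment_integrals.
Context {R : realType}.
Notation mu := (@lebesgue_measure R).

Lemma within_contP (T U : topologicalType) (A : set T) (f : T -> U) :
  {within A, continuous f} <-> (forall x, A x -> f @ within A (nbhs x) --> f x).
Proof. exact: subspace_continuousP. Qed.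

Lemma itvooW (u x v : R) : u < x < v -> u <= x <= v.
Proof. by move=> /andP[h1 h2]; rewrite !ltW. Qed.

Lemma near_oo (u x v : R) : u < x < v -> \forall y \near x, u < y < v.
Proof.
move=> /andP[ux xv]; near=> y; apply/andP; split; near: y.
  exact: lt_nbhsr.
exact: lt_nbhsl.
Unshelve. all: by end_near. Qed.

Lemma near_norm_lt (e eta : R) : `|e| < eta -> \forall x \near e, `|x| < eta.
Proof.
rewrite ltr_norml => h; have := near_oo h.
by apply: filterS => x; rewrite ltr_norml.
Qed.

Lemma seg_measurable (u v : R) : measurable ([set` `[u, v]] : set (measurableTypeR R)).
Proof. exact: measurable_itv. Qed.

Lemma seg_integrable (f : R -> R) (u v : R) :
  {within `[u, v], continuous f} -> mu.-integrable `[u, v] (EFin \o f).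
Proof. by move=> cf; apply: continuous_compact_integrable => //; exact: segment_compact. Qed.

Lemma seg_sub_cont (V : topologicalType) (f : R -> V) (u v u' v' : R) : u <= u' -> v' <= v ->
  {within `[u, v], continuous f} -> {within `[u', v'], continuous f}.
Proof.
move=> uu fam_v; apply: continuous_subspaceW => x /=; rewrite !in_itv /= => /andP[h1 h2].
by rewrite (le_trans uu h1) (le_trans h2 fam_v).
Qed.

Lemma seg_cont_interior (V : topologicalType) (f : R -> V) (u v x : R) : u < x < v ->
  {within `[u, v], continuous f} -> {for x, continuous f}.
Proof.
move=> uxv cf.
have cf' : {within `]u, v[, continuous f}.
  by apply: continuous_subspaceW cf; exact: subset_itv_oo_cc.
move: cf'; rewrite continuous_open_subspace; last exact: itv_open.
by apply; rewrite inE /= in_itv /=.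
Qed.

Lemma seg_FTC1 (f : R -> R) (u v x : R) : u < x < v ->
  {within `[u, v], continuous f} ->
  is_derive x 1 (fun y => \int[mu]_(s in `[u, y]) f s) (f x).
Proof.
move=> uxv cf; have /andP[ux xv] := uxv.
have [d1 d2] := continuous_FTC1_closed xv (seg_integrable cf) ux (seg_cont_interior uxv cf).
by apply: DeriveDef d1 _; rewrite -derive1E; exact: d2.
Qed.

Lemma seg_FTC2 (f F : R -> R) (u v : R) : u <= v ->
  {within `[u, v], continuous f} -> {within `[u, v], continuous F} ->
  (forall x, u < x < v -> is_derive x 1 F (f x)) ->
  \int[mu]_(s in `[u, v]) f s = F v - F u.
Proof.
rewrite le_eqVlt => /predU1P[->|uv] cf cF dF.
  by rewrite set_itv1 Rintegral_set1 subrr.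
rewrite /Rintegral (@continuous_FTC2 _ f F u v) //.
  have /(continuous_within_itvP _ uv)[_ c1 c2] := cF.
  split => //.
  by move=> x; rewrite in_itv /= => /dF d; exact: ex_derive.
by move=> x; rewrite in_itv /= => /dF d; rewrite derive1E; exact: derive_val.
Qed.

Lemma seg_integral_split (f : R -> R) (u x v : R) : u <= x <= v ->
  {within `[u, v], continuous f} ->
  \int[mu]_(s in `[u, v]) f s =
  \int[mu]_(s in `[u, x]) f s + \int[mu]_(s in `[x, v]) f s.
Proof.
move=> /andP[ux xv] cf; apply/eqP; rewrite addrC -subr_eq; apply/eqP.
rewrite (@Rintegral_itvB _ f (BLeft u) (BRight v) x) ?bnd_simp //; last exact: seg_integrable.
rewrite Rintegral_itv_obnd_cbnd //.
apply: (integrableS _ _ _ (seg_integrable cf)) => //.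
by move=> s /=; rewrite !in_itv /= => /andP[h1 ->]; rewrite (le_trans ux (ltW h1)).
Qed.

Lemma is_derive_seg_continuous (V : normedModType R) (f f' : R -> V) (u v : R) :
  (forall x, u <= x <= v -> is_derive x 1 f (f' x)) -> {within `[u, v], continuous f}.
Proof.
move=> df; apply: derivable_within_continuous => x; rewrite in_itv /= => /df d.
exact: ex_derive.
Qed.

Lemma cont_seg (V : topologicalType) (f : R -> V) (u v : R) : continuous f -> {within `[u, v], continuous f}.
Proof. exact: continuous_subspaceT. Qed.

Lemma seg_cont_of (a b : R) (V : topologicalType) (f : R -> V) (s1 s2 : R) : a <= s1 -> s2 <= b ->
  (forall s, s1 <= s <= s2 -> f @ within `[a, b] (nbhs s) --> f s) ->
  {within `[s1, s2], continuous f}.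
Proof.
move=> as1 s2b h; apply/within_contP => s /= ; rewrite in_itv /= => ss.
apply: cvg_trans (h s ss); apply: cvg_app; apply: within_subset.
by move=> y; rewrite /= !in_itv /= => /andP[h1 h2]; rewrite (le_trans as1 h1) (le_trans h2 s2b).
Qed.

(** At an interior point the one-sided restriction to [a, b] is void. *)
Lemma within_seg_interior (a b s : R) (P : set R) : a < s < b ->
  within `[a, b] (nbhs s) P -> nbhs s P.
Proof.
move=> sab nP.
have n1 : \forall x \near s, `[a, b]%classic x -> P x by exact: nP.
apply: filterS2 n1 (near_oo sab) => x h /andP[h1 h2]; apply: h.
by rewrite /= in_itv /= !ltW.
Qed.

Lemma seg_integral_ge0 (g : R -> R) (u v : R) : (forall s, u <= s <= v -> 0 <= g s) ->
  0 <= \int[mu]_(s in `[u, v]) g s.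
Proof. by move=> h; apply: Rintegral_ge0 => s; rewrite /= in_itv; exact: h. Qed.

Lemma seg_integral0 (f : R -> R) (u v : R) : (forall x, u <= x <= v -> f x = 0) ->
  \int[mu]_(s in `[u, v]) f s = 0.
Proof.
move=> h; rewrite -[RHS](mul0r (fine (mu [set` `[u, v]]))).
rewrite -(Rintegral_cst _ (seg_measurable u v)).
by apply: eq_Rintegral => x; rewrite inE /= in_itv /= => /h.
Qed.

(** Every point of [a, b], end points included, is a limit of points of the open
    interval, because a < b. *)
Lemma eq_of_interior (a b : R) (hab : a < b) (V : normedModType R) (f g : R -> V) s : a <= s <= b ->
  f @ within `[a, b] (nbhs s) --> f s -> g @ within `[a, b] (nbhs s) --> g s ->
  (\forall x \near within `[a, b] (nbhs s), a < x < b -> f x = g x) -> f s = g s.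
Proof.
move=> /andP[as_ sb] cf cg nE.
(* f and g are compared along the trace of the open interval *)
pose G := within [set x | a < x < b] (nbhs s).
have PG : ProperFilter G.
  apply: Build_ProperFilter_ex => A nA.
  have [r /= r0 hr] := (nbhs_ballP _ _).1 nA.
  have ab := hab; pose h := Num.min 1 (r / (2 * (b - a))).
  have d0 : 0 < 2 * (b - a) by lra.
  have h0 : 0 < h by rewrite lt_min ltr01 divr_gt0.
  have h1 : h <= 1 by rewrite ge_min lexx.
  have hd : h * (2 * (b - a)) <= r by rewrite -ler_pdivlMr // ge_min lexx orbT.
  (* a step from s towards the midpoint of [a, b] *)
  exists (s + h * ((a + b) / 2 - s)); apply: hr => /=.
    by rewrite /ball /= ltr_norml; nra.
  nra.
have sub : G `=>` within `[a, b] (nbhs s).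
  by apply: within_subset => x /= /andP[h1 h2]; rewrite in_itv /= !ltW.
have cf' := cvg_trans (cvg_app f sub) cf.
have cg' := cvg_trans (cvg_app g sub) cg.
have E : \forall x \near G, f x = g x.
  have n1 : \forall x \near s, `[a, b]%classic x -> a < x < b -> f x = g x by exact: nE.
  apply: filterS n1 => x h1 h2; apply: h1 => //.
  by case/andP: h2 => h3 h4; rewrite /= in_itv /= !ltW.
have cfg : f @ G --> g s by apply: cvg_trans cg'; apply: near_eq_cvg; apply: filterS E => x ->.
by have <- := cvg_lim (@norm_hausdorff R V) cf'; apply: cvg_lim.
Qed.

End segment_integrals.

(** * Families of functions depending on a parameter *)

Section joint.
Context {R : realType}.
Notation mu := (@lebesgue_measure R).

Definition strip (a b : R) : set (R * R) := [set z | a <= z.1 <= b].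

(** Continuity relative to the strip [a, b] x R: families are only known for times
    in [a, b], but for parameters in a full neighbourhood. *)
Definition strip_cont {V : topologicalType} (a b : R) (U : R -> R -> V) (z : R * R) :=
  (fun y => U y.1 y.2) @ within (strip a b) (nbhs z) --> U z.1 z.2.

(** The regularity in which families are handled: jointly continuous, with a jointly
    continuous derivative in the second variable, the parameter. Nothing is said of
    differentiability in time. *)
Definition C1at {V : normedModType R} (a b : R) (U dU : R -> R -> V) (z : R * R) :=
  [/\ is_derive z.2 1 (U z.1) (dU z.1 z.2), strip_cont a b U z & strip_cont a b dU z].

Lemma strip_cont_slice (V : topologicalType) (a b : R) (U : R -> R -> V) s e :
  strip_cont a b U (s, e) -> (fun x => U x e) @ within `[a, b] (nbhs s) --> U s e.
Proof.
move=> cU; apply: cvg_trans cU => A /= [[A1 A2] /= [n1 n2] AA].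
rewrite /within /= !near_simpl.
apply: filterS n1 => x A1x; rewrite in_itv => xab.
by apply: (AA (x, e)) => //; split => //=; exact: (nbhs_singleton n2).
Qed.

Lemma strip_cont_sub (V : topologicalType) (a b u v : R) (U : R -> R -> V) z :
  a <= u -> v <= b -> strip_cont a b U z -> strip_cont u v U z.
Proof.
move=> au vb cU; apply: cvg_trans cU; apply: cvg_app.
apply: within_subset => y /= /andP[h1 h2].
by rewrite /strip /= (le_trans au h1) (le_trans h2 vb).
Qed.

Lemma C1at_sub (V : normedModType R) (a b u v : R) (U dU : R -> R -> V) z :
  a <= u -> v <= b -> C1at a b U dU z -> C1at u v U dU z.
Proof. by move=> au vb [d c1 c2]; split => //; [exact: strip_cont_sub c1|exact: strip_cont_sub c2]. Qed.

(** Differentiation under the integral sign. The domination hypothesis comes from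
    compactness: [df], being jointly continuous, is bounded on [a, b] times a
    neighbourhood of 0. *)
Lemma seg_derive_integral (a b eta : R) (f df : R -> R -> R) : 0 < eta ->
  (forall s e, a <= s <= b -> `|e| < eta -> C1at a b f df (s, e)) ->
  is_derive (0 : R) (1 : R) (fun e : R => \int[mu]_(s in `[a, b]) f s e : R)
    (\int[mu]_(s in `[a, b]) df s 0).
Proof.
move=> eta0 H.
(* the bound is a second parameter, sent to infinity, of the covering argument *)
have bnd : \forall i \near filter_prod (nbhs (0:R)) (pinfty_nbhs R),
    `[a, b] `<=` (fun s => `|df s i.1| <= i.2).
  have ncov := (near_covering_withinP _).2
                 ((compact_near_coveringP _).1 (@segment_compact R a b)).
  apply: (ncov _ _ (fun i s => `|df s i.1| <= i.2)) => s /=; rewrite in_itv /= => sab.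
  have [_ _ cd] := H s 0 sab ltac:(by rewrite normr0).
  move/cvgrPdist_lt : cd => /(_ 1 ltr01) [[U1 U2] /= [n1 n2] UU].
  exists (U1, [set i | U2 i.1 /\ `|df s 0| + 1 < i.2]) => /=.
    split => //; exists (U2, [set M | `|df s 0| + 1 < M]) => //=.
    split => //; exists (`|df s 0| + 1); split => //; exact: num_real.
  move=> [x' [e M]] /= [U1x [U2e hM]]; rewrite in_itv /= => xab.
  have /= := UU (x', e) (conj U1x U2e) xab.
  move=> h; apply: le_trans (ltW hM).
  rewrite -lerBlDl (le_trans (lerB_dist _ _))// distrC; exact: ltW.
have [[V1 V2] /= [nV1 [M0 [_ hV2]]] VV] := bnd.
pose M := `|M0| + 1.
have V2M : V2 M by apply: hV2; rewrite /M (le_lt_trans (ler_norm _))// ltrDl.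
have M0' : 0 <= M by rewrite /M addr_ge0.
have [r /= r0 hr] : exists2 r : R, 0 < r & forall e, `|e| < r -> V1 e.
  have [r /= r0 hr] := (nbhs_ballP _ _).1 nV1.
  by exists r => // e er; apply: hr; rewrite /ball /= sub0r normrN.
pose rho := Num.min r eta.
have rho0 : 0 < rho by rewrite lt_min r0 eta0.
pose I := [set` `]-rho, rho[] : set R.
have Irho e : I e -> `|e| < r /\ `|e| < eta.
  by rewrite /I /= in_itv /= -ltr_norml /rho lt_min => /andP[].
have slice s e : a <= s <= b -> `|e| < eta -> derivable (f s) e 1 /\ 'D_1 (f s) e = df s e.
  move=> sab eeta; have [d _ _] := H s e sab eeta; split; [exact: ex_derive|exact: derive_val].
have h0 : I 0 by rewrite /I /= in_itv /= oppr_lt0 rho0.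
have intf : forall e, I e -> mu.-integrable `[a, b] (EFin \o (fun s => f s e)).
  move=> e /Irho[_ eeta]; apply: seg_integrable; apply/within_contP => s /=.
  rewrite in_itv /= => sab; have [_ c _] := H s e sab eeta; exact: strip_cont_slice c.
have intG : mu.-integrable `[a, b] (EFin \o (cst M : R -> R)).
  by apply: seg_integrable; apply: continuous_subspaceT => x; exact: cvg_cst.
have derf : forall e s, I e -> `[a, b]%classic s -> derivable (f s) e 1.
  by move=> e s /Irho[_ eeta]; rewrite /= in_itv /= => sab; exact: (slice s e sab eeta).1.
have Gub : forall e s, I e -> `[a, b]%classic s ->
    `|partial1of2 (fun e s => f s e) e s| <= cst M s.
  move=> e s /Irho[er eeta] sab'; have := sab'; rewrite /= in_itv /= => sab.
  rewrite partial1of2E (slice s e sab eeta).2.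
  by apply: (VV (e, M)) => //; split => //=; exact: hr.
have mab : measurable (`[a, b] : set R) by [].
have D := @derivable_under_integral R _ (measurableTypeR R) mu (fun e s => f s e) _ mab _ _ _ h0
            intf derf (cst M) (fun=> M0') intG Gub.
have E := @differentiation_under_integral R _ (measurableTypeR R) mu (fun e s => f s e) _ mab _ _ _ h0
            intf derf (cst M) (fun=> M0') intG Gub.
apply: DeriveDef => //; rewrite -derive1E E.
apply: eq_Rintegral => s; rewrite inE /= in_itv /= => sab.
by rewrite partial1of2E (slice s 0 sab _).2 // normr0.
Qed.

(** Exchange of the time and parameter derivatives, without assuming beforehand that the
    parameter derivative has a time derivative: x(s, e) is x(u, e) plus the integral of its time
    derivative, and this integral may be differentiated in e. *)
Lemma swap_derive (u v eta : R) (x xd dx dxd : R -> R -> R) : u < v -> 0 < eta ->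
  (forall s e, u <= s <= v -> `|e| < eta -> C1at u v x dx (s, e)) ->
  (forall s e, u <= s <= v -> `|e| < eta -> C1at u v xd dxd (s, e)) ->
  (forall s e, u < s < v -> `|e| < eta -> is_derive s 1 (x^~ e) (xd s e)) ->
  forall s, u < s < v -> is_derive s 1 (dx^~ 0) (dxd s 0).
Proof.
move=> uv eta0 Hx Hxd Hs s suv.
have n0 : `|0 : R| < eta by rewrite normr0.
have cxd e : `|e| < eta -> {within `[u, v], continuous (xd^~ e)}.
  move=> ee; apply/within_contP => y; rewrite /= in_itv /= => yuv.
  by have [_ c _] := Hxd y e yuv ee; exact: strip_cont_slice c.
have cx e : `|e| < eta -> {within `[u, v], continuous (x^~ e)}.
  move=> ee; apply/within_contP => y; rewrite /= in_itv /= => yuv.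
  by have [_ c _] := Hx y e yuv ee; exact: strip_cont_slice c.
have cdxd : {within `[u, v], continuous (dxd^~ 0)}.
  apply/within_contP => y; rewrite /= in_itv /= => yuv.
  by have [_ _ c] := Hxd y 0 yuv n0; exact: strip_cont_slice c.
(* the parameter derivative of x(y, e) = x(u, e) + (integral of xd(r, e) over [u, y]) *)
have key y : u <= y <= v -> dx y 0 = dx u 0 + \int[mu]_(r in `[u, y]) dxd r 0.
  move=> yuv; have /andP[uy yv] := yuv.
  have uuv : u <= u <= v by rewrite lexx ltW.
  have [d1 _ _] := Hx y 0 yuv n0; have [d2 _ _] := Hx u 0 uuv n0.
  have d3 : is_derive (0 : R) (1 : R) (fun e : R => \int[mu]_(r in `[u, y]) xd r e : R)
      (\int[mu]_(r in `[u, y]) dxd r 0).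
    apply: seg_derive_integral eta0 _ => r e /andP[r1 r2] ee.
    apply: C1at_sub (Hxd r e _ ee) => //.
    by rewrite r1 (le_trans r2 yv).
  have d4 := is_deriveD d2 d3.
  have : is_derive (0:R) (1:R) (x y) (dx u 0 + \int[mu]_(r in `[u, y]) dxd r 0).
    apply: near_eq_is_derive d4.
    near=> e.
    have ee : `|e| < eta.
      by near: e; exact: near_norm_lt.
    have -> : x y e = x u e + \int[mu]_(r in `[u, y]) xd r e.
      have -> : \int[mu]_(r in `[u, y]) xd r e = x y e - x u e; last by rewrite [RHS]addrC subrK.
      apply: (@seg_FTC2 _ (xd^~ e) (x^~ e) u y uy).
      - exact: (seg_sub_cont (lexx u) yv (cxd e ee)).
      - exact: (seg_sub_cont (lexx u) yv (cx e ee)).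
      - by move=> r /andP[r1 r2]; apply: Hs => //; rewrite r1 (lt_le_trans r2 yv).
    by [].
  by move=> /(is_deriveE) <-; rewrite (is_deriveE d1).
have /andP[us sv] := suv.
apply: (@near_eq_is_derive _ _ _ (fun y => dx u 0 + \int[mu]_(r in `[u, y]) dxd r 0)).
  have := near_oo suv; apply: filterS => y /andP[uy yv].
  by rewrite (key y) // (ltW uy) (ltW yv).
have := is_deriveD (is_derive_cst (dx u 0) s 1) (seg_FTC1 suv cdxd).
by rewrite add0r.
Unshelve. all: by end_near. Qed.

End joint.

(** * Integration by parts against a continuous path *)

Section pathwise_ito.
Context {R : realType}.
Notation mu := (@lebesgue_measure R).

Lemma seg_integral_bound (g : R -> R) (u v M : R) : u <= v ->
  {within `[u, v], continuous g} ->
  (forall s, u <= s <= v -> `|g s| <= M) ->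
  `|\int[mu]_(s in `[u, v]) g s| <= M * (v - u).
Proof.
move=> uv cg hM.
have mI := seg_measurable u v.
have := le_normr_Rintegral mI (seg_integrable cg).
move/le_trans; apply.
have cn : {within `[u, v], continuous (fun s => `|g s|)}.
  by move=> x; apply: continuous_comp; [exact: cg|exact: norm_continuous].
have cM : {within `[u, v], continuous (cst M : R -> R)}.
  by apply: continuous_subspaceT => x; exact: cvg_cst.
apply: (@le_trans _ _ (\int[mu]_(s in `[u, v]) cst M s)).
  apply: (le_Rintegral mI (seg_integrable cn) (seg_integrable cM)).
  by move=> s /=; rewrite in_itv /=; exact: hM.
rewrite Rintegral_cst //= lebesgue_measure_itv /= lte_fin.
case: ltP => [//|vu]; rewrite (_ : v = u) ?subrr //.
by apply/le_anti; rewrite uv vu.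
Qed.

Lemma seg_uniformly_continuous (w : R -> R) (u v e : R) : 0 < e ->
  {within `[u, v], continuous w} ->
  exists2 d : R, 0 < d & forall x y, u <= x <= v -> u <= y <= v ->
     `|x - y| < d -> `|w x - w y| <= e.
Proof.
move=> e0 cw.
have ncov := (near_covering_withinP _).2
               ((compact_near_coveringP _).1 (@segment_compact R u v)).
have h : \forall d \near (0:R)^'+, `[u, v] `<=` (fun x =>
    forall y, u <= y <= v -> `|x - y| < d -> `|w x - w y| <= e).
  apply: (ncov _ _ (fun d x => forall y, u <= y <= v -> `|x - y| < d -> `|w x - w y| <= e)).
  move=> x /= xuv.
  have e20 : 0 < e / 2 by rewrite divr_gt0.
  have /within_contP/(_ x xuv)/cvgrPdist_lt/(_ _ e20) := cw.
  move=> /nbhs_ballP[r /= r0 hr].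
  have hw y : u <= y <= v -> `|x - y| < r -> `|w x - w y| < e / 2.
    by move=> yuv xy; apply: hr => //=; rewrite in_itv.
  exists (ball x (r / 2), [set d | d < r / 2]) => /=.
    split; first by apply: nbhsx_ballx; rewrite divr_gt0.
    by apply: nbhs_right_lt; rewrite divr_gt0.
  move=> [x' d] /= [xx' dr] x'uv y yuv x'y.
  rewrite in_itv /= in x'uv.
  rewrite /ball /= in xx'.
  rewrite (splitr e) (le_trans (ler_distD (w x) _ _)) // lerD // ltW //.
    rewrite distrC; apply: hw => //; apply: lt_trans xx' _.
    by rewrite ltr_pdivrMr // ltr_pMr // ltr1n.
  apply: hw => //; apply: le_lt_trans (ler_distD x' _ _) _.
  by rewrite (splitr r) ltrD // (lt_trans x'y).
have [d [hd d0]] : exists d : R, (`[u, v] `<=` (fun x =>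
    forall y, u <= y <= v -> `|x - y| < d -> `|w x - w y| <= e)) /\ 0 < d.
  near (0:R)^'+ => d; exists d; split; near: d; first exact: h.
  exact: nbhs_right_gt.
by exists d => // x y xuv; apply: hd; rewrite /= in_itv.
Unshelve. all: by end_near. Qed.

(** This makes the filter of small meshes proper, so that limits along it are unique. *)
Lemma fine_partition (u v d : R) : u <= v -> 0 < d ->
  exists2 s, itv_partition u v s &
    forall k, (k < size s)%N -> nth 0 s k - nth 0 (u :: s) k < d.
Proof.
move=> uv d0.
have d20 : 0 < d / 2 by rewrite divr_gt0.
have [N hN] : exists N : nat, v - u <= N%:R * (d / 2).
  exists (Num.trunc ((v - u) / (d / 2))).+1.
  rewrite -ler_pdivrMr //; apply: ltW; exact: truncnS_gt.
elim: N u uv hN => [|N IH] u uv hN.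
  have -> : v = u by apply/le_anti; rewrite uv -subr_le0; rewrite mul0r in hN; rewrite hN.
  by exists [::] => //; split.
have [vd|vd] := ltP (v - u) d.
  move: uv; rewrite le_eqVlt => /predU1P[->|uv]; first by exists [::] => //; split.
  by exists [:: v]; [exact: itv_partition1|case].
have uv' : u + d / 2 <= v.
  by rewrite -lerBrDl (le_trans _ vd) // ler_pdivrMr // ler_pMr // ler1n.
have [|s [sp sl] sd] := IH _ uv'.
  rewrite opprD addrA lerBlDr; apply: le_trans hN _.
  by rewrite -natr1 mulrDl mul1r.
exists (u + d / 2 :: s) => /=.
  by split => //=; rewrite ltrDl d20.
case=> [_|k kl] /=; last exact: sd.
by rewrite addrAC subrr add0r ltr_pdivrMr // ltr_pMr // ltr1n.
Qed.

Lemma left_sum_cons (f w : R -> R) u x s :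
  left_sum f w u (x :: s) = f u * (w x - w u) + left_sum f w x s.
Proof. by rewrite /left_sum /= big_ord_recl. Qed.

(** On each cell [u, x] the term f(u) (w(x) - w(u)) differs from
    f(x) w(x) - f(u) w(u) - (integral of w f') by the integral of (w - w(x)) f', and w
    varies by at most e there. The starting point u moves with the induction on the
    partition, while the hypotheses are kept on the fixed interval [a, v]. *)
Lemma left_sum_estimate (f f' w : R -> R) (a v K e d : R) :
  {within `[a, v], continuous f} -> {within `[a, v], continuous f'} ->
  {within `[a, v], continuous w} ->
  (forall x, a < x < v -> is_derive x 1 f (f' x)) ->
  (forall x, a <= x <= v -> `|f' x| <= K) ->
  (forall x y, a <= x <= v -> a <= y <= v -> `|x - y| < d -> `|w x - w y| <= e) ->
  forall s u, a <= u -> itv_partition u v s ->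
    (forall k, (k < size s)%N -> nth 0 s k - nth 0 (u :: s) k < d) ->
    `|left_sum f w u s
      - (f v * w v - f u * w u - \int[mu]_(x in `[u, v]) (w x * f' x))| <= e * K * (v - u).
Proof.
move=> cf cf' cw df hK he; elim => [|x s IH] u au [].
  move=> _ /= /eqP -> _.
  by rewrite /left_sum big_ord0 set_itv1 Rintegral_set1 !subrr normr0 mulr0.
move=> /= /andP[ux xs] xsv hd.
have px : itv_partition x v s by split.
have xv : x <= v := itv_partition_le px.
have ax : a <= x := le_trans au (ltW ux).
have {}IH := IH x ax px (fun k ks => hd k.+1 ks).
rewrite left_sum_cons.
have cwf : {within `[a, v], continuous (fun x => w x * f' x)}.
  by move=> y; apply: continuousM; [exact: cw|exact: cf'].
have cwf1 : {within `[u, x], continuous (fun x => w x * f' x)}.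
  exact: seg_sub_cont cwf.
have cf1 : {within `[u, x], continuous f'} by exact: seg_sub_cont cf'.
have mI := seg_measurable u x.
rewrite (@seg_integral_split _ _ u x v); last 2 first.
- by rewrite (ltW ux) xv.
- exact: seg_sub_cont cwf.
have I1 : \int[mu]_(y in `[u, x]) (w x * f' y) = w x * (f x - f u).
  rewrite RintegralZl //; last exact: seg_integrable.
  congr (_ * _); apply: seg_FTC2 (ltW ux) cf1 _ _; first exact: seg_sub_cont cf.
  by move=> y /andP[uy yx]; apply: df; rewrite (le_lt_trans au uy) (lt_le_trans yx xv).
have I2 : \int[mu]_(y in `[u, x]) (w y * f' y - w x * f' y) =
   \int[mu]_(y in `[u, x]) (w y * f' y) - w x * (f x - f u).
  rewrite -I1 RintegralB //; first exact: seg_integrable.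
  apply: seg_integrable => y; apply: continuousM; [exact: cvg_cst|exact: cf1].
have I3 : `|\int[mu]_(y in `[u, x]) (w y * f' y - w x * f' y)| <= e * K * (x - u).
  apply: seg_integral_bound (ltW ux) _ _.
    move=> y; apply: cvgB; first exact: cwf1.
    apply: continuousM; [exact: cvg_cst|exact: cf1].
  move=> y /andP[uy yx]; rewrite -mulrBl normrM.
  have ayv : a <= y <= v by rewrite (le_trans au uy) (le_trans yx xv).
  apply: ler_pM => //; last exact: hK.
  apply: he => //; first by rewrite ax xv.
  rewrite distrC ger0_norm ?subr_ge0 //.
  by have := hd 0%N isT; apply: le_lt_trans; rewrite lerD2l lerN2.
set S := left_sum _ _ _ _ in IH *.
set J := \int[mu]_(y in `[x, v]) _ in IH *.
set J1 := \int[mu]_(y in `[u, x]) (w y * f' y) in I2 *.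
have -> : f u * (w x - w u) + S - (f v * w v - f u * w u - (J1 + J)) =
   (J1 - w x * (f x - f u)) + (S - (f v * w v - f x * w x - J)) by ring.
rewrite -I2 (le_trans (ler_normD _ _)) //.
have -> : e * K * (v - u) = e * K * (x - u) + e * K * (v - x) by ring.
exact: lerD.
Qed.

Lemma mesh_to_0_proper (u v : R) : u <= v -> ProperFilter (mesh_to_0 u v).
Proof.
move=> uv; apply: Build_ProperFilter_ex.
  move=> S [d d0 hS]; have [s ps ds] := fine_partition uv d0.
  by exists s; exact: hS.
split.
- by exists 1.
- move=> S T [d1 d10 h1] [d2 d20 h2]; exists (Num.min d1 d2).
    by rewrite lt_min d10.
  move=> s ps hs; split; [apply: h1|apply: h2] => // k ks;
    by have := hs k ks; rewrite lt_min => /andP[].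
- move=> S T ST [d d0 h]; exists d => // s ps hs; apply: ST; exact: h.
Qed.

(** Since f has a continuous derivative, the sums converge for every continuous w, however
    rough: this is what makes a pathwise treatment of the noise possible. *)
Lemma ito_integral_by_parts (f f' w : R -> R) (u v : R) : u <= v ->
  {within `[u, v], continuous f} -> {within `[u, v], continuous f'} ->
  {within `[u, v], continuous w} ->
  (forall x, u < x < v -> is_derive x 1 f (f' x)) ->
  ito_integral f w u v =
    f v * w v - f u * w u - \int[mu]_(x in `[u, v]) (w x * f' x).
Proof.
move=> uv cf cf' cw df.
have PF := mesh_to_0_proper uv.
apply/cvg_lim => //; apply/cvgrPdist_le => e e0.
have [K K0 hK] : exists2 K : R, 0 < K & forall x, u <= x <= v -> `|f' x| <= K.
  have : bounded_set (f' @` `[u, v]).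
    by apply: compact_bounded; apply: continuous_compact => //; exact: segment_compact.
  move=> [M [_ hM]]; exists (`|M| + 1); first by rewrite ltr_wpDl.
  move=> x xuv; apply: (hM (`|M| + 1)); first by rewrite (le_lt_trans (ler_norm _)) // ltrDl.
  by exists x => //=; rewrite in_itv.
have C0 : 0 < K * (v - u + 1) by rewrite mulr_gt0 // ltr_wpDl // subr_ge0.
have [d d0 hd] := seg_uniformly_continuous (divr_gt0 e0 C0) cw.
exists d => // s ps hs /=; rewrite distrC.
apply: le_trans (left_sum_estimate cf cf' cw df hK hd (lexx u) ps hs) _.
(* v - u + 1 instead of v - u: the segment may be a point *)
rewrite (_ : e / _ * K * (v - u) = e * (K * (v - u) / (K * (v - u + 1)))); last by ring.
rewrite ler_piMr ?(ltW e0) // ler_pdivrMr // mul1r.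
by apply: ler_wpM2l; [exact: ltW|rewrite lerDl].
Qed.

End pathwise_ito.

(** * The gamma function and the power weights *)

Section gamma.
Context {R : realType}.
Notation mu := (@lebesgue_measure R).

Lemma is_derive_expN (u : R) : is_derive u 1 (fun u : R => expR (- u)) (- expR (- u)).
Proof.
have h := is_derive1_comp (is_derive_expR (- u)) (is_deriveNid u 1).
by apply: is_derive_eq h _; rewrite mulrN1.
Qed.

(** The value is a finite part, so positivity includes the finiteness of Euler's
    integral. The bound comes from the explicit function K(u) = (u^x - 2 - u) e^(-u) / x:
    since u^x <= 1 + u for 0 < x <= 1, its derivative is at least u^(x - 1) e^(-u), while
    K itself stays between - 2 / x and 0. Thus all integrals over compact subintervals
    are at most 2 / x. *)
Lemma Gamma_gt0 (x : R) : 0 < x <= 1 -> 0 < Gamma x.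
Proof.
move=> /andP[x0 x1].
pose f u : R := u `^ (x - 1) * expR (- u).
pose K u : R := (u `^ x - 2 - u) * expR (- u) / x.
pose K' u : R := ((x * u `^ (x - 1) - 1) * expR (- u) - (u `^ x - 2 - u) * expR (- u)) / x.
have dK (u : R) : 0 < u -> is_derive u 1 K (K' u).
  move=> u0.
  have d1 := is_derive1_powR x u0.
  have d2 := is_deriveB (is_deriveB d1 (is_derive_cst (2:R) u 1)) (is_derive_id u 1).
  have d3 := is_deriveM d2 (is_derive_expN u).
  have d4 := is_deriveM d3 (is_derive_cst (x^-1) u 1).
  apply: is_derive_eq d4 _.
  by rewrite /K' /= !fctE /cst /GRing.scale /=; ring.
have df (u : R) : 0 < u -> derivable f u 1.
  move=> u0; have e := is_deriveM (is_derive1_powR (x - 1) u0) (is_derive_expN u).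
  exact: (@ex_derive _ _ _ _ _ _ _ e).
have dK' (u : R) : 0 < u -> derivable K' u 1.
  move=> u0.
  have e1 := is_derive1_powR x u0.
  have e2 := is_derive1_powR (x - 1) u0.
  have e3 := is_derive_expN u.
  have e4 := is_deriveM (is_deriveB (is_deriveZ x e2) (is_derive_cst (1:R) u 1)) e3.
  have e5 := is_deriveM (is_deriveB (is_deriveB e1 (is_derive_cst (2:R) u 1)) (is_derive_id u 1)) e3.
  have e6 := is_deriveM (is_deriveB e4 e5) (is_derive_cst (x^-1) u 1).
  exact: (@ex_derive _ _ _ _ _ _ _ e6).
have f_ge0 (u : R) : 0 <= f u by rewrite mulr_ge0 ?powR_ge0 ?expR_ge0.
have cf (u v : R) : 0 < u -> {within `[u, v], continuous f}.
  move=> u0; apply: derivable_within_continuous => y; rewrite in_itv /= => /andP[uy _].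
  by apply: df; exact: lt_le_trans uy.
have cK' (u v : R) : 0 < u -> {within `[u, v], continuous K'}.
  move=> u0; apply: derivable_within_continuous => y; rewrite in_itv /= => /andP[uy _].
  by apply: dK'; exact: lt_le_trans uy.
have cK (u v : R) : 0 < u -> {within `[u, v], continuous K}.
  move=> u0; apply: (is_derive_seg_continuous (f' := K')) => y /andP[uy _].
  by apply: dK; exact: lt_le_trans uy.
have pow_le (u : R) : 0 < u -> u `^ x <= 1 + u.
  move=> u0; have [u1|u1] := leP 1 u.
    by apply: le_trans (ler1_powR u1 x1) _; rewrite lerDr.
  have := @ger_powR _ u _ 0 x (ltW x0); rewrite u0 (ltW u1) powRr0 => /(_ isT) h.
  by apply: le_trans h _; rewrite lerDl ltW.
have fK' (u : R) : 0 < u -> f u <= K' u.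
  move=> u0; rewrite -subr_ge0.
  have -> : K' u - f u = (1 + u - u `^ x) * expR (- u) / x.
    by rewrite /K' /f; field; rewrite gt_eqF.
  by rewrite !mulr_ge0 ?expR_ge0 ?invr_ge0 ?(ltW x0) // subr_ge0 pow_le.
have Kle (u : R) : 0 < u -> K u <= 0.
  move=> u0; rewrite /K pmulr_lle0 ?invr_gt0 // pmulr_lle0 ?expR_gt0 //.
  by have := pow_le u u0; lra.
have Kge (u : R) : 0 < u -> - (2 / x) <= K u.
  move=> u0; rewrite /K -mulNr ler_pM2r ?invr_gt0 //.
  have e0 := expR_gt0 (- u).
  have e1 : (1 + u) * expR (- u) <= 1.
    by rewrite expRN ler_pdivrMr ?expR_gt0 // mul1r expR_ge1Dx.
  have e2 : 0 <= u `^ x * expR (- u) by rewrite mulr_ge0 ?powR_ge0 ?(ltW e0).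
  have e3 : 0 < u * expR (- u) by rewrite mulr_gt0.
  by nra.
have If (u v : R) : 0 < u -> u <= v -> \int[mu]_(s in `[u, v]) f s <= 2 / x.
  move=> u0 uv.
  apply: (@le_trans _ _ (\int[mu]_(s in `[u, v]) K' s)).
    apply: (le_Rintegral (seg_measurable u v) (seg_integrable (cf u v u0)) (seg_integrable (cK' u v u0))).
    by move=> y /=; rewrite in_itv /= => /andP[uy _]; apply: fK'; exact: lt_le_trans uy.
  have -> : \int[mu]_(s in `[u, v]) K' s = K v - K u.
    apply: (seg_FTC2 uv (cK' _ _ u0) (cK _ _ u0)) => y /andP[uy _].
    by apply: dK; exact: lt_trans uy.
  have := Kle v (lt_le_trans u0 uv); have := Kge u u0; lra.
have mf : measurable_fun ([set` `]0, +oo[] : set (measurableTypeR R)) (EFin \o f : measurableTypeR R -> \bar R).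
  have c0 : {within `]0, +oo[, continuous f}.
    by apply: derivable_within_continuous => y; rewrite in_itv /= andbT; exact: df.
  apply/measurable_EFinP.
  exact: (subspace_continuous_measurable_fun (measurable_itv _) c0).
(* the half-line is exhausted by compact segments, on which the bound is uniform *)
pose F (n : nat) : set (measurableTypeR R) := [set` `[n.+1%:R^-1, n.+1%:R]].
have F0 n : F n `<=` `]0, +oo[.
  by move=> y; rewrite /F /= !in_itv /= andbT => /andP[h _]; apply: lt_le_trans h; rewrite invr_gt0.
have n1 n : (n.+1%:R^-1 : R) <= n.+1%:R.
  by rewrite (@le_trans _ _ 1) ?invf_le1 ?ler1n.
have U0 : \bigcup_n F n = [set` `]0, +oo[].
  rewrite eqEsubset; split; first by move=> y [n _]; exact: F0.
  move=> y; rewrite /= in_itv /= andbT => y0.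
  pose N := Num.trunc (y + y^-1).
  have yi0 : 0 < y^-1 by rewrite invr_gt0.
  have hN : y + y^-1 < N.+1%:R by exact: truncnS_gt.
  exists N => //; rewrite /F /= in_itv /=; apply/andP; split.
    rewrite -[leRHS]invrK lef_pV2 ?posrE //; apply: ltW; apply: le_lt_trans hN.
    by rewrite lerDr ltW.
  by apply: ltW; apply: le_lt_trans hN; rewrite lerDl ltW.
have IE n : (\int[mu]_(y in F n) (EFin \o f) y)%E = (\int[mu]_(y in F n) f y)%:E.
  rewrite /Rintegral fineK //; apply: integrable_fin_num.
    exact: seg_measurable.
  by apply: seg_integrable; apply: cf; rewrite invr_gt0.
have fin : (\int[mu]_(y in `]0%R, +oo[) (EFin \o f) y <= (2 / x)%:E)%E.
  have h : ((\int[mu]_(y in F n) (EFin \o f) y)%E @[n --> \oo] -->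
            (\int[mu]_(y in \bigcup_n F n) (EFin \o f) y)%E).
    apply: ge0_nondecreasing_set_cvg_integral.
    - apply/nondecreasing_seqP => n; rewrite subsetEset => y; rewrite /F /= !in_itv /=.
      move=> /andP[h1 h2]; apply/andP; split.
        by apply: le_trans h1; rewrite lef_pV2 ?posrE ?ler_nat.
      by apply: le_trans h2 _; rewrite ler_nat.
    - by move=> n; exact: seg_measurable.
    - move=> n; apply: measurable_funS mf => //; exact: measurable_itv.
    - by move=> n y _; rewrite /= lee_fin.
  rewrite -U0; have := cvg_lim (@ereal_hausdorff R) h => <-.
  apply: lime_le; first by apply/cvg_ex; eexists; exact: h.
  by apply: nearW => n; rewrite IE lee_fin; apply: If; rewrite ?invr_gt0.
(* on [1, 2] the integrand is at least e^(-2) / 2 *)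
have low : ((expR (- 2) / 2)%:E <= \int[mu]_(y in `]0%R, +oo[) (EFin \o f) y)%E.
  apply: (@le_trans _ _ (\int[mu]_(y in `[1%R, 2%R]) (EFin \o f) y)%E); last first.
    apply: ge0_subset_integral => //; try exact: measurable_itv.
    - by move=> y _; rewrite /= lee_fin.
    - by move=> y /=; rewrite !in_itv /= andbT => /andP[h _]; apply: lt_le_trans h.
  have i12 := seg_integrable (cf 1 2 ltr01).
  rewrite -[leRHS]fineK; last by apply: integrable_fin_num => //; exact: seg_measurable.
  rewrite lee_fin.
  have cc : {within `[1, 2], continuous (cst (expR (- 2) / 2) : R -> R)}.
    by apply: continuous_subspaceT => y; exact: cvg_cst.
  apply: (@le_trans _ _ (\int[mu]_(s in `[1, 2]) cst (expR (- 2) / 2 : R) s)).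
    rewrite Rintegral_cst; last exact: seg_measurable.
    rewrite /= lebesgue_measure_itv /= lte_fin ltr1n /=; lra.
  apply: (le_Rintegral (seg_measurable 1 2) (seg_integrable cc) i12).
  move=> y /=; rewrite in_itv /= => /andP[y1 y2]; rewrite /f mulrC.
  have y0 : 0 < y := lt_le_trans ltr01 y1.
  apply: ler_pM; rewrite ?expR_ge0 ?invr_ge0 //; last by rewrite ler_expR lerN2.
  apply: (@le_trans _ _ (y `^ (-1))).
    by rewrite powR_inv1 ?(ltW y0) // lef_pV2 ?posrE.
  by apply: ler_powR => //; lra.
have e20 : 0 < expR (- 2) / 2 :> R by rewrite divr_gt0 ?expR_gt0.
rewrite /Gamma /Rintegral; apply: fine_gt0; apply/andP; split.
  by apply: lt_le_trans low; rewrite lte_fin.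
by apply: le_lt_trans fin _; rewrite ltry.
Qed.

(** The alternative e = 0 is the classical case alpha = beta = 1, where the weights are
    constant and t may lie anywhere; the derivative is then 0 whatever the meaning of
    the power with exponent -1. *)
Lemma is_derive_powB (t e s : R) : s < t \/ e = 0 ->
  is_derive s 1 (fun s => (t - s) `^ e) (- e * (t - s) `^ (e - 1)).
Proof.
case=> [st|->].
  have ts : 0 < t - s by rewrite subr_gt0.
  have d : is_derive s 1 (fun s : R => t - s) (0 - 1).
    exact: (is_deriveB (is_derive_cst t s 1) (is_derive_id s 1)).
  have h := @is_derive1_comp _ (fun y : R => y `^ e) _ s _ _ (is_derive1_powR e ts) d.
  by apply: is_derive_eq h _; rewrite sub0r mulrN1 mulNr.
rewrite oppr0 mul0r (_ : (fun _ => _) = cst 1); first exact: is_derive_cst.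
by apply/funext => y; rewrite powRr0.
Qed.

End gamma.

(** * Differential calculus along a family *)

Section chain_rules.
Context {R : realType}.

Lemma is_derive_chain (V W : normedModType R) (f : V -> W) (g : R -> V) (x : R) (dg : V) :
  differentiable f (g x) -> is_derive x 1 g dg ->
  is_derive x 1 (f \o g) ('d f (g x) dg).
Proof.
move=> df [dg1 dg2].
have dg' : differentiable g x by apply/derivable1_diffP.
have dfg : differentiable (f \o g) x by exact: differentiable_comp.
apply: DeriveDef; first by apply/derivable1_diffP.
by rewrite deriveE // diff_comp // -dg2 deriveE.
Qed.

Lemma is_derive_scale (V : normedModType R) (f : R -> R) (g : R -> V) (x : R) (df : R) (dg : V) :
  is_derive x 1 f df -> is_derive x 1 g dg ->
  is_derive x 1 (fun x => f x *: g x) (df *: g x + f x *: dg).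
Proof.
move=> [f1 <-] [g1 <-].
have cf : {for x, continuous f} by apply: differentiable_continuous; apply/derivable1_diffP.
have key : (fun h : R => h^-1 *: ((fun x => f x *: g x) (h *: 1 + x) - f x *: g x)) @ 0^' -->
   'D_1 f x *: g x + f x *: 'D_1 g x.
  have -> : (fun h : R => h^-1 *: (f (h *: 1 + x) *: g (h *: 1 + x) - f x *: g x)) =
    (fun h : R => (h^-1 *: (f (h *: 1 + x) - f x)) *: g x +
                  f (h *: 1 + x) *: (h^-1 *: (g (h *: 1 + x) - g x))).
    apply/funext => h; set f' := f _; set g' := g _.
    have -> : (h^-1 *: (f' - f x)) *: g x = h^-1 *: ((f' - f x) *: g x) by rewrite scalerA.
    have -> : f' *: (h^-1 *: (g' - g x)) = h^-1 *: (f' *: (g' - g x)).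
      by rewrite !scalerA mulrC.
    have -> : f' *: g' - f x *: g x = (f' - f x) *: g x + f' *: (g' - g x).
      by rewrite scalerBl scalerBr [RHS]addrC subrKA.
    by rewrite scalerDr.
  apply: cvgD; first by apply: cvgZr_tmp; exact: f1.
  apply: cvgZ; last exact: g1.
  have c0 : (fun h : R => h *: 1 + x) @ 0^' --> x.
    rewrite -[X in _ --> X](add0r x); apply: cvgD; last exact: cvg_cst.
    rewrite -[X in _ --> X](scale0r (1:R)).
    by apply: cvgZr_tmp; apply: cvg_within.
  exact: (cvg_comp _ _ c0 cf).
apply: DeriveDef; first by apply/cvg_ex; eexists; exact: key.
exact: (cvg_lim _ key).
Qed.

End chain_rules.

Section coordinates.
Context {R : realType}.

(** A basis together with its coordinate functions; rows and pairs of rows are the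
    instances needed, and differentials are expanded along them. *)
Definition coordinate_system (V : normedModType R) (N : nat) (e : 'I_N -> V)
    (xi : 'I_N -> V -> R) :=
  (forall k, continuous (xi k)) /\ forall v, v = \sum_k xi k v *: e k.

Lemma cvg_bigsum (V : normedModType R) (T : Type) (F : set_system T) (FF : Filter F)
    (N : nat) (f : 'I_N -> T -> V) (l : 'I_N -> V) :
  (forall k, f k @ F --> l k) -> (fun x => \sum_k f k x) @ F --> \sum_k l k.
Proof.
move=> h; elim: N f l h => [|N IH] f l h.
  by rewrite big_ord0; under eq_fun do rewrite big_ord0; exact: cvg_cst.
rewrite big_ord_recr /=; under eq_fun do rewrite big_ord_recr /=.
by apply: cvgD; [exact: IH (fun k => h _)|exact: h].
Qed.

Lemma is_derive_bigsum (V : normedModType R) (N : nat) (f : 'I_N -> R -> V) (df : 'I_N -> V) (x : R) :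
  (forall k, is_derive x 1 (f k) (df k)) ->
  is_derive x 1 (fun y => \sum_k f k y) (\sum_k df k).
Proof.
move=> h; have := is_derive_sum h.
by rewrite (_ : \sum_i f i = fun y => \sum_k f k y) //; apply/funext => y; rewrite fct_sumE.
Qed.

Definition row_coord n (k : 'I_n) (v : 'rV[R]_n) : R := v 0 k.

Lemma row_coordinate_system n :
  coordinate_system (fun k : 'I_n => delta_mx 0 k : 'rV[R]_n) (@row_coord n).
Proof.
split; first by move=> k v; exact: matrix_normedtype.coord_continuous.
by move=> v; exact: row_sum_delta.
Qed.

Lemma diff_coordinates (V W : normedModType R) N (e : 'I_N -> V) xi (f : V -> W) x v :
  coordinate_system e xi -> differentiable f x ->
  'd f x v = \sum_k xi k v *: 'D_(e k) f x.
Proof.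
move=> [_ bs] df; rewrite {1}(bs v) linear_sum; apply: eq_bigr => k _.
by rewrite linearZ deriveE.
Qed.

Lemma cvg_row n (T : Type) (f : T -> 'rV[R]_n) (l : 'rV[R]_n)
    (Fl : set_system T) {FF : Filter Fl} :
  (forall k, (fun s => f s 0 k) @ Fl --> l 0 k) -> f @ Fl --> l.
Proof.
move=> h.
have E : f = (fun s => \sum_k f s 0 k *: delta_mx 0 k).
  by apply/funext => s; exact: row_sum_delta.
rewrite E (row_sum_delta l); apply: cvg_bigsum => k.
by apply: cvgZr_tmp; exact: h.
Qed.

End coordinates.

Section C1at_rules.
Context {R : realType}.
Variables (a b : R).

Lemma strip_cont_comp (V W : topologicalType) (f : V -> W) (X : R -> R -> V) z :
  {for X z.1 z.2, continuous f} -> strip_cont a b X z -> strip_cont a b (fun s e => f (X s e)) z.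
Proof. by move=> cf cX; apply: (cvg_comp _ _ cX cf). Qed.

Lemma strip_cont_cst (V : topologicalType) (v : V) z : strip_cont a b (fun _ _ => v) z.
Proof. exact: cvg_cst. Qed.

Lemma strip_cont_D (V : normedModType R) (X Y : R -> R -> V) z :
  strip_cont a b X z -> strip_cont a b Y z -> strip_cont a b (fun s e => X s e + Y s e) z.
Proof. exact: cvgD. Qed.

Lemma strip_cont_Z (V : normedModType R) (u : R -> R -> R) (X : R -> R -> V) z :
  strip_cont a b u z -> strip_cont a b X z -> strip_cont a b (fun s e => u s e *: X s e) z.
Proof. exact: cvgZ. Qed.

Lemma strip_cont_sum (V : normedModType R) N (X : 'I_N -> R -> R -> V) z :
  (forall k, strip_cont a b (X k) z) -> strip_cont a b (fun s e => \sum_k X k s e) z.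
Proof. by move=> h; apply: (@cvg_bigsum _ V _ _ _ N (fun k y => X k y.1 y.2) (fun k => X k z.1 z.2)). Qed.

Lemma strip_cont_time (V : topologicalType) (w : R -> V) z :
  w @ within `[a, b] (nbhs z.1) --> w z.1 -> strip_cont a b (fun s _ => w s) z.
Proof.
case: z => s e /= cw; apply: cvg_trans cw => A /= nA.
exists ([set x | `[a, b]%classic x -> A (w x)], setT) => /=; first by split => //; exact: filterT.
by move=> [x y] /= [h _]; rewrite /strip /= => xab; apply: h; rewrite in_itv.
Qed.

Lemma strip_cont_near (V : topologicalType) (X Y : R -> R -> V) z :
  (\forall y \near within (strip a b) (nbhs z), X y.1 y.2 = Y y.1 y.2) ->
  X z.1 z.2 = Y z.1 z.2 -> strip_cont a b X z -> strip_cont a b Y z.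
Proof.
move=> XY e cX; rewrite /strip_cont -e; apply: cvg_trans cX.
by apply: near_eq_cvg; apply: filterS XY => y ->.
Qed.

Lemma C1at_time (V : normedModType R) (w : R -> V) z :
  w @ within `[a, b] (nbhs z.1) --> w z.1 -> C1at a b (fun s _ => w s) (fun _ _ => 0) z.
Proof. by move=> cw; split; [exact: is_derive_cst|exact: strip_cont_time|exact: strip_cont_cst]. Qed.

Lemma C1at_D (V : normedModType R) (X dX Y dY : R -> R -> V) z :
  C1at a b X dX z -> C1at a b Y dY z -> C1at a b (fun s e => X s e + Y s e) (fun s e => dX s e + dY s e) z.
Proof.
move=> [d1 c1 e1] [d2 c2 e2]; split; last 2 first.
- exact: strip_cont_D.
- exact: strip_cont_D.
exact: is_deriveD.
Qed.

Lemma C1at_Z (V : normedModType R) (u du : R -> R -> R) (X dX : R -> R -> V) z :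
  C1at a b u du z -> C1at a b X dX z ->
  C1at a b (fun s e => u s e *: X s e) (fun s e => du s e *: X s e + u s e *: dX s e) z.
Proof.
move=> [d1 c1 e1] [d2 c2 e2]; split.
- exact: is_derive_scale.
- exact: strip_cont_Z.
- by apply: strip_cont_D; exact: strip_cont_Z.
Qed.

Lemma C1at_sum (V : normedModType R) N (X dX : 'I_N -> R -> R -> V) z :
  (forall k, C1at a b (X k) (dX k) z) ->
  C1at a b (fun s e => \sum_k X k s e) (fun s e => \sum_k dX k s e) z.
Proof.
move=> h; split; last 2 first.
- by apply: strip_cont_sum => k; case: (h k).
- by apply: strip_cont_sum => k; case: (h k).
by apply: is_derive_bigsum => k; case: (h k).
Qed.

(** Chain rule in partial derivatives: this form exhibits the derivative in the
    parameter as a continuous expression, which the differential does not. *)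
Lemma C1at_comp (V W : normedModType R) N (e : 'I_N -> V) xi (f : V -> W) (X dX : R -> R -> V) z :
  coordinate_system e xi ->
  differentiable f (X z.1 z.2) ->
  (forall k, {for X z.1 z.2, continuous (fun x => 'D_(e k) f x)}) ->
  C1at a b X dX z ->
  C1at a b (fun s e => f (X s e))
       (fun s ep => \sum_k xi k (dX s ep) *: 'D_(e k) f (X s ep)) z.
Proof.
move=> bs df cf [d1 c1 e1]; split.
- rewrite -(diff_coordinates _ bs df).
  exact: (is_derive_chain df d1).
- by apply: strip_cont_comp => //; exact: differentiable_continuous.
- apply: strip_cont_sum => k; apply: strip_cont_Z.
    by apply: strip_cont_comp e1; exact: bs.1.
  exact: strip_cont_comp (cf k) c1.
Qed.

Lemma C1at_near (V : normedModType R) (X Y dX : R -> R -> V) z : a <= z.1 <= b ->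
  (\forall y \near within (strip a b) (nbhs z), X y.1 y.2 = Y y.1 y.2) ->
  C1at a b X dX z -> C1at a b Y dX z.
Proof.
case: z => s e /= sab XY [d c dc].
have [[U1 U2] /= [n1 n2] UU] := XY.
have eqs : \forall e' \near e, X s e' = Y s e'.
  apply: filterS n2 => e' U2e; apply: (UU (s, e')) => //; split => //=.
  exact: (nbhs_singleton n1).
split => //; first exact: near_eq_is_derive d.
apply: strip_cont_near XY _ c; exact: (nbhs_singleton eqs).
Qed.

Lemma C1at_eq_derive (V : normedModType R) (X dX dX' : R -> R -> V) z : a <= z.1 <= b ->
  (\forall y \near within (strip a b) (nbhs z), dX y.1 y.2 = dX' y.1 y.2) ->
  C1at a b X dX z -> C1at a b X dX' z.
Proof.
case: z => s e /= sab XY [d c dc].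
have [[U1 U2] /= [n1 n2] UU] := XY.
have E : dX s e = dX' s e.
  by apply: (UU (s, e)) => //; split => /=; exact: nbhs_singleton.
split => //; first by rewrite /= -E.
exact: strip_cont_near XY _ dc.
Qed.

Lemma lipschitz_of_derive (f df : R -> R) (c r M : R) :
  (forall x, `|x - c| < r -> is_derive x 1 f (df x) /\ `|df x| <= M) ->
  forall x y, `|x - c| < r -> `|y - c| < r -> `|f x - f y| <= M * `|x - y|.
Proof.
move=> h x y.
wlog xy : x y / y <= x.
  move=> W xc yc; have [yx|xy] := leP y x; first exact: W.
  by rewrite distrC (distrC x y); apply: W => //; exact: ltW.
move=> xc yc.
have hb z : y <= z <= x -> `|z - c| < r.
  move=> /andP[yz zx]; move: xc yc; rewrite !ltr_norml => /andP[x1 x2] /andP[y1 y2].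
  by apply/andP; split; lra.
have [||z zin E] := @MVT_segment R f df y x xy.
- move=> z; rewrite in_itv /= => /andP[yz zx].
  by have [] := h z (hb z _) => //; rewrite !ltW.
- apply: derivable_within_continuous => z; rewrite in_itv /= => zz.
  by have [d _] := h z (hb z zz); exact: ex_derive.
rewrite E normrM; apply: ler_wpM2r => //.
by move: zin; rewrite in_itv /= => /hb /h[].
Qed.

(** Continuity in time at one parameter and a bounded parameter derivative suffice: the
    mean value theorem controls the variation in e uniformly in s. A variation is only
    required to have continuous derivatives in the parameter, so this is what makes the
    family itself jointly continuous. *)
Lemma joint_continuity (U dU : R -> R -> R) (s0 e0 : R) :
  a <= s0 <= b ->
  within (strip a b) (nbhs (s0, e0))
    (fun y : R * R => is_derive y.2 1 (U y.1) (dU y.1 y.2)) ->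
  strip_cont a b dU (s0, e0) ->
  U^~ e0 @ within `[a, b] (nbhs s0) --> U s0 e0 -> strip_cont a b U (s0, e0).
Proof.
move=> s0ab hd cd cs.
pose M := `|dU s0 e0| + 1.
have M0 : 0 < M by rewrite ltr_wpDl.
have hb : \forall y \near within (strip a b) (nbhs (s0, e0)), `|dU y.1 y.2| <= M.
  move/cvgrPdist_lt : cd => /(_ 1 ltr01); apply: filterS => y /=.
  rewrite distrC => h; rewrite /M -lerBlDl; apply: ltW; apply: le_lt_trans h.
  exact: lerB_dist.
have := filterI hd hb => -[[U1 U2] /= [n1 n2] UU].
have [r /= r0 hr] := (nbhs_ballP _ _).1 n2.
apply/cvgrPdist_lt => ep ep0.
have ep2 : 0 < ep / 2 by rewrite divr_gt0.
move/cvgrPdist_lt : cs => /(_ _ ep2) n3.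
exists (U1 `&` [set x | `[a, b]%classic x -> `|U s0 e0 - U x e0| < ep / 2],
        [set e | `|e0 - e| < Num.min r (ep / 2 / M)]) => /=.
  split; first exact: filterI.
  by apply: nbhsx_ballx; rewrite lt_min r0 !divr_gt0.
move=> [s e] /= [[U1s h1]]; rewrite lt_min => /andP[er eM] sab.
have {}h1 : `|U s0 e0 - U s e0| < ep / 2 by apply: h1; rewrite /= in_itv.
rewrite (splitr ep); apply: le_lt_trans (ler_distD (U s e0) _ _) _.
apply: ltrD => //.
have L := @lipschitz_of_derive (U s) (dU s) e0 r M.
have h2 : forall x, `|x - e0| < r -> is_derive x 1 (U s) (dU s x) /\ `|dU s x| <= M.
  move=> x xr; apply: (UU (s, x)) => //; split => //=; apply: hr.
  by rewrite /ball /= distrC.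
have er' : `|e - e0| < r by rewrite distrC.
have r00 : `|e0 - e0| < r by rewrite subrr normr0.
apply: le_lt_trans (L h2 e0 e r00 er') _.
by rewrite mulrC -ltr_pdivlMr.
Qed.

Lemma strip_cont_row n (X : R -> R -> 'rV[R]_n) z :
  (forall k, strip_cont a b (fun s e => X s e 0 k) z) -> strip_cont a b X z.
Proof. by move=> h; exact: (cvg_row (f := fun y => X y.1 y.2) h). Qed.

End C1at_rules.

Section pairing.
Context {R : realType} {n : nat}.
Implicit Types (p u v : 'rV[R]_n).

Lemma pairingC (p v : 'rV[R]_n) : pairing p v = pairing v p.
Proof. by apply: eq_bigr => k _; rewrite mulrC. Qed.

Lemma pairingB p u v : pairing p (u - v) = pairing p u - pairing p v.
Proof. by rewrite /pairing -sumrB; apply: eq_bigr => k _; rewrite !mxE mulrBr. Qed.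

Lemma pairingZr (x : R) (p v : 'rV[R]_n) : pairing p (x *: v) = x * pairing p v.
Proof. by rewrite /pairing mulr_sumr; apply: eq_bigr => k _; rewrite mxE mulrCA. Qed.

Lemma pairing0 (p : 'rV[R]_n) : pairing p 0 = 0.
Proof. by rewrite /pairing big1 // => k _; rewrite mxE mulr0. Qed.

Lemma pairing_sum p m (c : 'I_m -> R) (w : 'I_m -> 'rV[R]_n) :
  pairing p (\sum_l c l *: w l) = \sum_l c l * pairing p (w l).
Proof.
rewrite /pairing; under [RHS]eq_bigr do rewrite mulr_sumr.
rewrite exchange_big /=; apply: eq_bigr => k _.
rewrite summxE mulr_sumr; apply: eq_bigr => l _.
by rewrite mxE mulrCA.
Qed.

Lemma pairing_ext p p' : (forall u, pairing p u = pairing p' u) -> p = p'.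
Proof.
move=> h; apply/rowP => k; have := h (delta_mx 0 k).
have E q : pairing q (delta_mx 0 k) = q 0 k.
  rewrite /pairing (bigD1 k) //= big1 ?mxE ?eqxx ?mulr1 ?addr0 // => l lk.
  by rewrite mxE (negPf lk) andbF mulr0.
by rewrite !E.
Qed.

Lemma pairing_self_eq0 (u : 'rV[R]_n) : pairing u u = 0 -> u = 0.
Proof.
move=> h; apply/rowP => k; rewrite mxE.
have h2 : \sum_k u 0 k * u 0 k == 0 by apply/eqP.
rewrite psumr_eq0 in h2; last by move=> j _; rewrite -expr2 sqr_ge0.
have /allP/(_ k) := h2; rewrite mem_index_enum => /(_ isT).
by rewrite /= mulf_eq0 orbb => /eqP.
Qed.

Lemma pairing_row (f : {linear 'rV[R]_n -> 'rV[R]_n}) p u :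
  pairing (\row_k pairing p (f (delta_mx 0 k))) u = pairing p (f u).
Proof.
rewrite {2}(row_sum_delta u) linear_sum.
under eq_bigr do rewrite linearZ.
rewrite pairing_sum /pairing; apply: eq_bigr => k _.
by rewrite mxE mulrC.
Qed.

End pairing.

Section rows_and_pairs.
Context {R : realType}.

Lemma is_derive_row n (f : R -> 'rV[R]_n) (df : 'rV[R]_n) (x : R) (k : 'I_n) :
  is_derive x 1 f df -> is_derive x 1 (fun x => f x 0 k) (df 0 k).
Proof.
move=> [d <-]; apply: DeriveDef; first by move/derivable_mxP : d; apply.
by rewrite derive_mx // mxE.
Qed.

Lemma is_derive_rows n (f : R -> 'rV[R]_n) (df : 'rV[R]_n) (x : R) :
  (forall k, is_derive x 1 (fun x => f x 0 k) (df 0 k)) -> is_derive x 1 f df.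
Proof.
move=> h.
have d : derivable f x 1.
  by apply/derivable_mxP => i k; rewrite (ord1 i); case: (h k).
apply: DeriveDef => //; rewrite derive_mx //; apply/rowP => k; rewrite mxE.
by case: (h k).
Qed.

Lemma is_derive_pair (V W : normedModType R) (f : R -> V) (g : R -> W) (df : V) (dg : W) (x : R) :
  is_derive x 1 f df -> is_derive x 1 g dg ->
  is_derive x 1 (fun x => (f x, g x)) (df, dg).
Proof.
move=> [f1 <-] [g1 <-].
have f2 : differentiable f x by apply/derivable1_diffP.
have g2 : differentiable g x by apply/derivable1_diffP.
have d : differentiable (fun x => (f x, g x)) x by exact: differentiable_pair.
apply: DeriveDef; first by apply/derivable1_diffP.
by rewrite !deriveE // diff_pair.
Qed.

Definition pair_basis n (k : 'I_(n + n)) : 'rV[R]_n * 'rV[R]_n :=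
  match fintype.split k with inl k => (delta_mx 0 k, 0) | inr k => (0, delta_mx 0 k) end.

Definition pair_coord n (k : 'I_(n + n)) (z : 'rV[R]_n * 'rV[R]_n) : R :=
  match fintype.split k with inl k => z.1 0 k | inr k => z.2 0 k end.

Lemma pair_basis_sum n (W : normedModType R) (z : 'rV[R]_n * 'rV[R]_n)
    (F : 'rV[R]_n * 'rV[R]_n -> W) :
  \sum_k pair_coord k z *: F (pair_basis k) =
  \sum_k z.1 0 k *: F (delta_mx 0 k, 0) + \sum_k z.2 0 k *: F (0, delta_mx 0 k).
Proof.
rewrite big_split_ord /=; congr (_ + _); apply: eq_bigr => k _.
  rewrite /pair_coord /pair_basis; case: splitP => j /= e.
    by have -> : k = j by apply: ord_inj.
  by have := ltn_ord k; rewrite e -ltn_subRL subnn ltn0.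
rewrite /pair_coord /pair_basis; case: splitP => j /= e.
  by have := ltn_ord j; rewrite -e -ltn_subRL subnn ltn0.
by have -> : k = j by apply: ord_inj; move/eqP: e; rewrite eqn_add2l => /eqP.
Qed.

Lemma pair_coordinate_system n : coordinate_system (@pair_basis n) (@pair_coord n).
Proof.
split.
  move=> k z; rewrite /pair_coord; case: (fintype.split k) => j.
    apply: (@cvg_comp _ _ _ (fun z : 'rV[R]_n * 'rV[R]_n => z.1) (fun v => v 0 j)); first exact: cvg_fst.
    exact: matrix_normedtype.coord_continuous.
  apply: (@cvg_comp _ _ _ (fun z : 'rV[R]_n * 'rV[R]_n => z.2) (fun v => v 0 j)); first exact: cvg_snd.
  exact: matrix_normedtype.coord_continuous.
move=> z; rewrite (pair_basis_sum z id) /=.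
have E : z = (z.1, 0) + (0, z.2).
  by case: z => u v /=; congr (_, _); rewrite ?addr0 ?add0r.
rewrite {1}E; congr (_ + _).
  rewrite {1}(row_sum_delta z.1); elim/big_rec2 : _ => // k u v _ <-.
  by congr (_, _); rewrite /= scaler0 addr0.
rewrite {1}(row_sum_delta z.2); elim/big_rec2 : _ => // k u v _ <-.
by congr (_, _); rewrite /= scaler0 addr0.
Qed.

Variables (a b : R).

Lemma C1at_M (u du v dv : R -> R -> R) z : C1at a b u du z -> C1at a b v dv z ->
  C1at a b (fun s e => u s e * v s e) (fun s e => du s e * v s e + u s e * dv s e) z.
Proof. exact: C1at_Z. Qed.

Lemma C1at_B (V : normedModType R) (X dX Y dY : R -> R -> V) z :
  C1at a b X dX z -> C1at a b Y dY z -> C1at a b (fun s e => X s e - Y s e) (fun s e => dX s e - dY s e) z.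
Proof.
move=> [d1 c1 e1] [d2 c2 e2]; split; first exact: is_deriveB.
- exact: cvgB.
- exact: cvgB.
Qed.

Lemma C1at_row n (X dX : R -> R -> 'rV[R]_n) z k : C1at a b X dX z ->
  C1at a b (fun s e => X s e 0 k) (fun s e => dX s e 0 k) z.
Proof.
move=> [d c e]; split; first exact: is_derive_row.
- exact: (strip_cont_comp (f := fun v : 'rV[R]_n => v 0 k)
           (coord0_continuous k _) c).
- exact: (strip_cont_comp (f := fun v : 'rV[R]_n => v 0 k)
           (coord0_continuous k _) e).
Qed.

Lemma C1at_rows n (X dX : R -> R -> 'rV[R]_n) z :
  (forall k, C1at a b (fun s e => X s e 0 k) (fun s e => dX s e 0 k) z) -> C1at a b X dX z.
Proof.
move=> h; split.
- by apply: is_derive_rows => k; case: (h k).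
- by apply: strip_cont_row => k; case: (h k).
- by apply: strip_cont_row => k; case: (h k).
Qed.

Lemma C1at_pair (V W : normedModType R) (X dX : R -> R -> V) (Y dY : R -> R -> W) z :
  C1at a b X dX z -> C1at a b Y dY z ->
  C1at a b (fun s e => (X s e, Y s e)) (fun s e => (dX s e, dY s e)) z.
Proof.
move=> [d1 c1 e1] [d2 c2 e2]; split; first exact: is_derive_pair.
- exact: cvg_pair.
- exact: cvg_pair.
Qed.

Lemma C1at_pairing n (P dP X dX : R -> R -> 'rV[R]_n) z : C1at a b P dP z -> C1at a b X dX z ->
  C1at a b (fun s e => pairing (P s e) (X s e))
       (fun s e => pairing (dP s e) (X s e) + pairing (P s e) (dX s e)) z.
Proof.
move=> hP hX.
have E : (fun s e => pairing (dP s e) (X s e) + pairing (P s e) (dX s e)) =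
  (fun s e => \sum_k (dP s e 0 k * X s e 0 k + P s e 0 k * dX s e 0 k)).
  by apply/funext => s; apply/funext => e; rewrite /pairing big_split.
rewrite E /pairing.
apply: (@C1at_sum R a b R n (fun k s e => P s e 0 k * X s e 0 k)
   (fun k s e => dP s e 0 k * X s e 0 k + P s e 0 k * dX s e 0 k)) => k.
by apply: C1at_M; exact: C1at_row.
Qed.

Lemma C1at_comp_row n (W : normedModType R) (f : 'rV[R]_n -> W) (X dX : R -> R -> 'rV[R]_n) z :
  differentiable f (X z.1 z.2) ->
  (forall k, {for X z.1 z.2, continuous (fun x => 'D_(delta_mx 0 k) f x)}) ->
  C1at a b X dX z ->
  C1at a b (fun s e => f (X s e))
       (fun s e => \sum_k dX s e 0 k *: 'D_(delta_mx 0 k) f (X s e)) z.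
Proof. exact: (C1at_comp (row_coordinate_system n)). Qed.

Lemma C1at_Ck n (W : normedModType R) (A : set 'rV[R]_n) (f : 'rV[R]_n -> W)
    (X dX : R -> R -> 'rV[R]_n) z :
  Ck 1 A f -> A (X z.1 z.2) -> C1at a b X dX z ->
  C1at a b (fun s e => f (X s e))
       (fun s e => \sum_k dX s e 0 k *: 'D_(delta_mx 0 k) f (X s e)) z.
Proof.
move=> [df cf] AX; apply: C1at_comp_row; first exact: df.
by move=> k; exact: cf.
Qed.

End rows_and_pairs.

Section gluing.
Context {R : realType}.
Variables (a b : R).

Lemma near_near_strip (z : R * R) (P : set (R * R)) :
  within (strip a b) (nbhs z) P ->
  within (strip a b) (nbhs z) (fun y => within (strip a b) (nbhs y) P).
Proof.
move=> nP; have n1 : nbhs z (fun y => strip a b y -> P y) by exact: nP.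
have n2 := nbhs_interior n1.
by apply: filterS n2 => y h _; exact: h.
Qed.

Lemma strip_nbhs_self (z : R * R) (P : set (R * R)) : strip a b z ->
  within (strip a b) (nbhs z) P -> P z.
Proof. by move=> hz nP; exact: (nbhs_singleton nP hz). Qed.

(** Regularity is local, and the derivative need not be given by the same formula
    everywhere: this passes from a formula valid near z, such as one in a chart, to the
    intrinsic derivative of the function. *)
Lemma C1at_glue (V : normedModType R) (U U' dU : R -> R -> V) z : strip a b z ->
  within (strip a b) (nbhs z) (fun y => C1at a b U dU y /\ U y.1 y.2 = U' y.1 y.2) ->
  C1at a b U' (fun s e => 'D_1 (U' s) e) z.
Proof.
move=> hz h.
have key : within (strip a b) (nbhs z) (fun y => strip a b y -> C1at a b U' dU y).
  apply: filterS (near_near_strip h) => y hy sy.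
  have [c _] := strip_nbhs_self sy hy.
  apply: C1at_near sy _ c.
  by apply: filterS hy => x [].
have kz := strip_nbhs_self hz key hz.
apply: C1at_eq_derive hz _ kz.
have sz : within (strip a b) (nbhs z) (strip a b) by exact: withinT.
apply: filterS2 sz key => y sy /(_ sy)[d _ _].
by rewrite (is_deriveE d).
Qed.

Lemma seg_integral_sum N (f : 'I_N -> R -> R) (u v : R) :
  (forall k, {within `[u, v], continuous (f k)}) ->
  \int[@lebesgue_measure R]_(s in `[u, v]) (\sum_k f k s) =
  \sum_k \int[@lebesgue_measure R]_(s in `[u, v]) f k s.
Proof.
move=> cf; have mI := seg_measurable u v.
elim: N f cf => [|N IH] f cf.
  rewrite big_ord0 -[RHS](mul0r (fine (@lebesgue_measure R [set` `[u, v]]))).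
  rewrite -(Rintegral_cst _ mI); apply: eq_Rintegral => s _; exact: big_ord0.
rewrite big_ord_recr /=.
have cS : {within `[u, v], continuous (fun s => \sum_(k < N) f (widen_ord (leqnSn N) k) s)}.
  move=> s; apply: cvg_bigsum => k.
  exact: (cf (widen_ord (leqnSn N) k)).
have {}IH := IH _ (fun k => cf (widen_ord (leqnSn N) k)).
rewrite -IH.
have := RintegralD mI (seg_integrable cS) (seg_integrable (cf ord_max)).
move=> <-; apply: eq_Rintegral => s _; exact: big_ord_recr.
Qed.

End gluing.

(** * Derivatives on a closed interval *)

Section within_derivative.
Context {R : realType}.
Variables (a b : R) (hab : a < b).

Definition increments (s : R) : set_system R := within [set h | a <= s + h <= b] (0 : R)^'.

Lemma increments_proper s : a <= s <= b -> ProperFilter (increments s).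
Proof.
move=> /andP[as_ sb]; apply: Build_ProperFilter_ex => A nA.
have [r /= r0 hr] := (nbhs_ballP _ _).1 nA.
have [sb'|bs] := ltP s b.
- pose h := Num.min (r / 2) (b - s).
  have h0 : 0 < h by rewrite lt_min divr_gt0 //= subr_gt0.
  have h1 : h <= r / 2 by rewrite ge_min lexx.
  have h2 : h <= b - s by rewrite ge_min lexx orbT.
  exists h; apply: hr; first by rewrite /ball /= sub0r normrN gtr0_norm //; lra.
    by rewrite gt_eqF.
  by apply/andP; split; lra.
- pose h := Num.min (r / 2) (s - a).
  have h0 : 0 < h by rewrite lt_min divr_gt0 //= subr_gt0 (lt_le_trans hab).
  have h1 : h <= r / 2 by rewrite ge_min lexx.
  have h2 : h <= s - a by rewrite ge_min lexx orbT.
  exists (- h); apply: hr; first by rewrite /ball /= sub0r opprK gtr0_norm //; lra.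
    by rewrite oppr_eq0 gt_eqF.
  by apply/andP; split; lra.
Qed.

Definition is_derive_within {V : normedModType R} (g : R -> V) (s : R) (l : V) :=
  quotient_within a b g s --> l.

Lemma is_derive_within_val (V : normedModType R) (g : R -> V) s l : a <= s <= b ->
  is_derive_within g s l -> derive_within a b g s = l.
Proof. by move=> sab h; have PF := increments_proper sab; apply: cvg_lim h. Qed.

Lemma is_derive_within_interior (V : normedModType R) (g : R -> V) s l : a < s < b ->
  is_derive_within g s l <-> is_derive s 1 g l.
Proof.
move=> sab.
have E : increments s = (0:R)^'.
  rewrite eqEsubset; split => A; last by apply: filterS => x + _.
  rewrite /increments /within /= => nA.
  have n2 : \forall h \near (0:R)^', a <= s + h <= b.
    have c : (fun h => s + h) @ (0:R) --> s + 0 by apply: cvgD; [exact: cvg_cst|exact: cvg_id].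
    rewrite addr0 in c.
    have n1 : \forall h \near (0:R), a < s + h < b by exact: (c _ (near_oo sab)).
    by apply: filterS n1 => h /andP[h1 h2] _; rewrite !ltW.
  by apply: filterS2 nA n2 => h; apply.
have F : (fun h : R => h^-1 *: (g (s + h) - g s)) =
    (fun h : R => h^-1 *: ((g \o shift s) (h *: 1) - g s)).
  by apply/funext => h /=; rewrite [_%:A]mulr1 (addrC h s).
rewrite /is_derive_within /quotient_within -/(increments s) E F; split.
  move=> h; apply: DeriveDef; first by apply/cvg_ex; exists l.
  exact: (cvg_lim _ h).
by move=> [h1 <-]; exact: h1.
Qed.

Lemma near_increments s (P : set R) :
  within `[a, b] (nbhs s) P -> increments s (fun h => P (s + h)).
Proof.
move=> nP; rewrite /increments /within /=.
have c : (fun h => s + h) @ (0:R) --> s + 0 by apply: cvgD; [exact: cvg_cst|exact: cvg_id].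
rewrite addr0 in c.
have n1 : \forall h \near (0:R), `[a, b]%classic (s + h) -> P (s + h) by exact: (c _ nP).
by apply: filterS n1 => h /= hP _ hab'; apply: hP; rewrite in_itv.
Qed.

Lemma is_derive_within_near (V : normedModType R) (g g' : R -> V) s l : g s = g' s ->
  (\forall x \near within `[a, b] (nbhs s), g x = g' x) ->
  is_derive_within g s l -> is_derive_within g' s l.
Proof.
move=> e nE h; apply: cvg_trans h; apply: near_eq_cvg.
have := near_increments nE; apply: filterS => x ->.
by rewrite e.
Qed.

Lemma is_derive_within_cvg (V : normedModType R) (g : R -> V) s l : a <= s <= b ->
  is_derive_within g s l -> (fun h => g (s + h)) @ increments s --> g s.
Proof.
move=> sab h; have PF := increments_proper sab.
have c0 : (fun h : R => h) @ increments s --> (0:R).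
  exact: cvg_trans (cvg_within _) (cvg_within _).
have D : (fun x : R => g s + x *: (x^-1 *: (g (s + x) - g s))) @ increments s --> g s + 0 *: l.
  by apply: cvgD; [exact: cvg_cst|exact: (cvgZ c0 h)].
rewrite scale0r addr0 in D; apply: cvg_trans D; apply: near_eq_cvg.
have n0 : \forall x \near (0:R)^', x != 0 by exact: near_withinT.
have n1 : increments s (fun x => x != 0) by apply: filterS n0 => x xn0 _.
apply: filterS n1 => x x0.
by rewrite scalerA divff // scale1r addrC subrK.
Qed.

(** The difference quotients are those of g restricted to [a, b], so the remainder of the
    differential of f is estimated along them directly. *)
Lemma is_derive_within_chain (V W : normedModType R) (f : V -> W) (g : R -> V) s l : a <= s <= b ->
  differentiable f (g s) -> is_derive_within g s l -> is_derive_within (f \o g) s ('d f (g s) l).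
Proof.
move=> sab df h; have PF := increments_proper sab.
have [cdf lo] := (diff_locallyP _ _).1 df.
have {}lo := (eqaddoP _ _ _ _).1 lo.
pose k x := g (s + x) - g s.
have ck : k @ increments s --> (0 : V).
  by rewrite -(subrr (g s)); apply: cvgB; [exact: is_derive_within_cvg h|exact: cvg_cst].
(* the remainder of the differential is negligible along the increments of g *)
pose rho (y : V) := f (y + g s) - (f (g s) + 'd f (g s) y).
have E : (fun x : R => x^-1 *: ((f \o g) (s + x) - (f \o g) s)) =
   (fun x => 'd f (g s) (x^-1 *: k x) + x^-1 *: rho (k x)).
  apply/funext => x; rewrite linearZ -scalerDr /rho /k subrK /=; congr (_ *: _).
  by rewrite opprD [in RHS](addrA (f _)) [RHS]addrC subrK.
rewrite /is_derive_within /quotient_within E -[X in _ --> X]addr0.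
apply: cvgD; first exact: (cvg_comp _ _ h (cdf l)).
apply/cvgrPdist_le => e e0.
have C0 : 0 < `|l| + 1 by rewrite ltr_wpDl.
have h1 : \forall x \near increments s, `|x^-1 *: k x| <= `|l| + 1.
  have /cvgrPdist_le/(_ 1 ltr01) := h; apply: filterS => x.
  rewrite distrC => hx; rewrite -lerBlDl; apply: le_trans hx; exact: lerB_dist.
have h2 : \forall x \near increments s, `|rho (k x)| <= e / (`|l| + 1) * `|k x|.
  exact: (ck _ (lo _ (divr_gt0 e0 C0))).
apply: filterS2 h1 h2 => x h1 h2.
rewrite sub0r normrN normrZ.
apply: le_trans (ler_wpM2l (normr_ge0 _) h2) _.
rewrite mulrCA -normrZ -[leRHS](divfK (lt0r_neq0 C0)).
by rewrite ler_pM2l // divr_gt0.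
Qed.

Lemma is_derive_within_addZ (V : normedModType R) (g h : R -> V) (e s : R) l m : a <= s <= b ->
  is_derive_within g s l -> is_derive s 1 h m -> is_derive_within (fun x => g x + e *: h x) s (l + e *: m).
Proof.
move=> sab hg [hh <-]; have PF := increments_proper sab.
have hh' : is_derive_within h s ('D_1 h s).
  have F : (fun x : R => x^-1 *: (h (s + x) - h s)) =
    (fun x : R => x^-1 *: ((h \o shift s) (x *: 1) - h s)).
    by apply/funext => x /=; rewrite [_%:A]mulr1 (addrC x s).
  rewrite /is_derive_within /quotient_within F.
  exact: cvg_trans (cvg_app _ (cvg_within _)) hh.
have E : (fun x : R => x^-1 *: ((g (s + x) + e *: h (s + x)) - (g s + e *: h s))) =
   (fun x => x^-1 *: (g (s + x) - g s) + e *: (x^-1 *: (h (s + x) - h s))).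
  apply/funext => x; rewrite scalerA mulrC -scalerA -scalerDr; congr (_ *: _).
  by rewrite scalerBr opprD addrACA.
rewrite /is_derive_within /quotient_within E; apply: cvgD; first exact: hg.
by apply: cvgZ; [exact: cvg_cst|exact: hh'].
Qed.

End within_derivative.

(** * Charts and curves *)

Section charts.
Context {R : realType} {n : nat} {Q : manifold R n}.
Implicit Types (i j k : chart Q) (x : Q) (y u v p : 'rV[R]_n).

Lemma diff_near (V W : normedModType R) (f g : V -> W) (x v : V) :
  differentiable f x -> differentiable g x -> (\near x, f x = g x) ->
  'd f x v = 'd g x v.
Proof. by move=> df dg fg; rewrite -!deriveE //; exact: near_eq_derive. Qed.

Lemma coord_image i x : dom i x -> (coord i @` dom i) (coord i x).
Proof. by move=> ix; exists x. Qed.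

Lemma dom_param i y : (coord i @` dom i) y -> dom i (param i y).
Proof. by move=> [x ix <-]; rewrite coordK. Qed.

Lemma paramK i y : (coord i @` dom i) y -> coord i (param i y) = y.
Proof. by move=> [x ix <-]; rewrite coordK. Qed.

Lemma near_image i y : (coord i @` dom i) y -> \forall y' \near y, (coord i @` dom i) y'.
Proof. by move=> iy; apply: open_nbhs_nbhs; split => //; exact: coord_open. Qed.

Lemma near_dom i x : dom i x -> \forall x' \near x, dom i x'.
Proof. by move=> ix; apply: open_nbhs_nbhs; split => //; exact: dom_open. Qed.

Lemma near_param_dom i j y : (coord i @` dom i) y -> dom j (param i y) ->
  \forall y' \near y, dom j (param i y').
Proof. by move=> iy jy; have := param_continuous iy; apply; exact: near_dom. Qed.

Lemma overlap i j x : dom i x -> dom j x -> (coord i @` (dom i `&` dom j)) (coord i x).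
Proof. by move=> ix jx; exists x. Qed.

Lemma transition_differentiable i j x : dom i x -> dom j x ->
  differentiable (transition i j) (coord i x).
Proof.
move=> ix jx; have [h _] := transition_smooth i j 1%N.
by apply: h; exact: overlap.
Qed.

Lemma transition_coord i j x : dom i x -> transition i j (coord i x) = coord j x.
Proof. by move=> ix; rewrite /transition /= coordK. Qed.

(** The cocycle relation, from which all changes of coordinates of vectors and
    covectors follow. *)
Lemma dtransition_comp i j k x v : dom i x -> dom j x -> dom k x ->
  'd (transition j k) (coord j x) ('d (transition i j) (coord i x) v) =
  'd (transition i k) (coord i x) v.
Proof.
move=> ix jx kx.
have dij := transition_differentiable ix jx.
have djk := transition_differentiable jx kx.
have dik := transition_differentiable ix kx.
have djk' : differentiable (transition j k) (transition i j (coord i x)).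
  by rewrite transition_coord.
have dc := differentiable_comp dij djk'.
have E : 'd (transition i k) (coord i x) v = 'd (transition j k \o transition i j) (coord i x) v.
  apply: (diff_near v dik dc).
  have jx' : dom j (param i (coord i x)) by rewrite coordK.
  have := near_param_dom (coord_image ix) jx'; apply: filterS => y jy.
  by rewrite /transition /= coordK.
apply: etrans (esym E).
by have := congr1 (fun h => h v) (diff_comp dij djk'); rewrite /= transition_coord.
Qed.

Lemma dtransition_id i x v : dom i x -> 'd (transition i i) (coord i x) v = v.
Proof.
move=> ix; have dii := transition_differentiable ix ix.
have did : differentiable (id : 'rV[R]_n -> 'rV[R]_n) (coord i x) by exact: ex_diff.
have E : 'd (transition i i) (coord i x) v = 'd (id : 'rV[R]_n -> 'rV[R]_n) (coord i x) v.
  apply: (diff_near v dii did).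
  have := near_image (coord_image ix); apply: filterS => y iy.
  by rewrite /transition /= paramK.
by apply: etrans E _; rewrite diff_val.
Qed.

Lemma tan_coord_at x v : tan_coord (chart_at x) x v = v.
Proof. by rewrite /tan_coord dtransition_id //; exact: dom_chart_at. Qed.

Lemma dtransition_tan_coord i j x v : dom i x -> dom j x ->
  'd (transition i j) (coord i x) (tan_coord i x v) = tan_coord j x v.
Proof. by move=> ix jx; rewrite dtransition_comp //; exact: dom_chart_at. Qed.

Lemma dtransition_tan_coord_at i x v : dom i x ->
  'd (transition i (chart_at x)) (coord i x) (tan_coord i x v) = v.
Proof. by move=> ix; rewrite dtransition_tan_coord ?tan_coord_at //; exact: dom_chart_at. Qed.

Lemma pairing_cot_coord i x p u :
  pairing (cot_coord i x p) u = pairing p ('d (transition i (chart_at x)) (coord i x) u).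
Proof. exact: pairing_row. Qed.

Lemma pairing_cot_tan i x p v : dom i x ->
  pairing (cot_coord i x p) (tan_coord i x v) = pairing p v.
Proof. by move=> ix; rewrite pairing_cot_coord dtransition_tan_coord_at. Qed.

Lemma locT_tan_coord (L : TQ Q -> R) i x v : dom i x ->
  locT L i (coord i x) (tan_coord i x v) = L (x, v).
Proof.
by move=> ix; rewrite /locT /tan_of_coord coordK // dtransition_tan_coord_at.
Qed.

Lemma loc_coord (g : Q -> R) i x : dom i x -> loc g i (coord i x) = g x.
Proof. by move=> ix; rewrite /loc coordK. Qed.

Lemma diff_loc (g : Q -> R) i j x v : dom i x -> dom j x ->
  differentiable (loc g i) (coord i x) -> differentiable (loc g j) (coord j x) ->
  'd (loc g j) (coord j x) ('d (transition i j) (coord i x) v) = 'd (loc g i) (coord i x) v.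
Proof.
move=> ix jx di dj.
have dij := transition_differentiable ix jx.
have dj' : differentiable (loc g j) (transition i j (coord i x)) by rewrite transition_coord.
have dc := differentiable_comp dij dj'.
have E : 'd (loc g i) (coord i x) v = 'd (loc g j \o transition i j) (coord i x) v.
  apply: (diff_near v di dc).
  have jx' : dom j (param i (coord i x)) by rewrite coordK.
  have := near_param_dom (coord_image ix) jx'; apply: filterS => y jy.
  by rewrite /loc /transition /= coordK.
apply: etrans (esym E).
by have := congr1 (fun h => h v) (diff_comp dij dj'); rewrite /= transition_coord.
Qed.

End charts.

Section curves.
Context {R : realType} {n : nat} {Q : manifold R n}.
Variables (a b : R) (hab : a < b).
Variables (qa qb : Q) (c : R -> PQ Q) (hc : path_space a b qa qb c).
Implicit Types (i j : chart Q) (s : R).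

Definition xdot i (c : R -> PQ Q) s := derive_within a b (qcoord i c) s.

Lemma pos_cvg s : a <= s <= b -> (fun s => pos (c s)) @ within `[a, b] (nbhs s) --> pos (c s).
Proof. by move=> sab; case: hc => /within_contP + _ _ _; apply; rewrite /= in_itv. Qed.

Lemma pos_near_dom i s : a <= s <= b -> dom i (pos (c s)) ->
  \forall x \near within `[a, b] (nbhs s), dom i (pos (c x)).
Proof. by move=> sab ids; exact: (pos_cvg sab (near_dom ids)). Qed.

(** The hypotheses on a path are relative to a set of times that depends on the chart; near
    its points this set may be replaced with [a, b]. *)
Lemma domain_filter i s : a <= s <= b -> dom i (pos (c s)) ->
  within [set s | a <= s <= b /\ dom i (pos (c s))] (nbhs s) = within `[a, b] (nbhs s).
Proof.
move=> sab ids; rewrite eqEsubset; split => A nA.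
  have n1 : \forall x \near s, (a <= x <= b /\ dom i (pos (c x))) -> A x by exact: nA.
  have n2 : \forall x \near s, `[a, b]%classic x -> dom i (pos (c x)).
    exact: pos_near_dom.
  apply: filterS2 n1 n2 => x h1 h2; rewrite /= in_itv /= => xab.
  by apply: h1; split => //; apply: h2; rewrite /= in_itv.
have n1 : \forall x \near s, `[a, b]%classic x -> A x by exact: nA.
by apply: filterS n1 => x h [xab _]; apply: h; rewrite /= in_itv.
Qed.

Lemma vcoord_cvg i s : a <= s <= b -> dom i (pos (c s)) ->
  vcoord i c @ within `[a, b] (nbhs s) --> vcoord i c s.
Proof.
move=> sab ids; rewrite -(domain_filter sab ids).
by case: hc => _ _ _ /(_ i)[_ /within_contP + _]; apply.
Qed.

Lemma pcoord_cvg i s : a <= s <= b -> dom i (pos (c s)) ->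
  pcoord i c @ within `[a, b] (nbhs s) --> pcoord i c s.
Proof.
move=> sab ids; rewrite -(domain_filter sab ids).
by case: hc => _ _ _ /(_ i)[_ _ /within_contP]; apply.
Qed.

Lemma xdot_cvg i s : a <= s <= b -> dom i (pos (c s)) ->
  xdot i c @ within `[a, b] (nbhs s) --> xdot i c s.
Proof.
move=> sab ids; rewrite -(domain_filter sab ids).
by case: hc => _ _ _ /(_ i)[[_ /within_contP + _] _]; apply.
Qed.

Lemma qcoord_cvg i s : a <= s <= b -> dom i (pos (c s)) ->
  qcoord i c @ within `[a, b] (nbhs s) --> qcoord i c s.
Proof.
by move=> sab ids; apply: (cvg_comp _ _ (pos_cvg sab) (coord_continuous ids)).
Qed.

Lemma qcoord_is_derive_within i s : a <= s <= b -> dom i (pos (c s)) ->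
  is_derive_within a b (qcoord i c) s (xdot i c s).
Proof.
by move=> sab ids; case: hc => _ _ _ /(_ i)[[+ _] _ _]; apply.
Qed.

Lemma qcoord_is_derive i s : a < s < b -> dom i (pos (c s)) ->
  is_derive s 1 (qcoord i c) (xdot i c s).
Proof.
move=> sab ids; apply/(is_derive_within_interior _ _ sab); apply: qcoord_is_derive_within => //.
by case/andP: sab => h1 h2; rewrite !ltW.
Qed.

Lemma qcoord_transition i j s : dom i (pos (c s)) ->
  qcoord j c s = transition i j (qcoord i c s).
Proof. by move=> ids; rewrite /qcoord transition_coord. Qed.

Lemma xdot_transition i j s : a <= s <= b -> dom i (pos (c s)) -> dom j (pos (c s)) ->
  xdot j c s = 'd (transition i j) (qcoord i c s) (xdot i c s).
Proof.
move=> sab ids jds; apply: is_derive_within_val => //.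
have h := is_derive_within_chain hab sab (transition_differentiable ids jds) (qcoord_is_derive_within sab ids).
apply: is_derive_within_near h; first by rewrite /= -qcoord_transition.
have := pos_near_dom sab ids; apply: filterS => x idx.
by rewrite /= -qcoord_transition.
Qed.

(** The momentum term of the action does not depend on the chart. *)
Lemma pairing_qdot i s : a <= s <= b -> dom i (pos (c s)) ->
  pairing (mom (c s)) (qdot a b c s - vel (c s)) =
  pairing (pcoord i c s) (xdot i c s - vcoord i c s).
Proof.
move=> sab ids.
have at_s := dom_chart_at (pos (c s)).
have E1 := pairing_cot_tan (mom (c s)) (vel (c s)) ids.
have E2 : pairing (mom (c s)) (qdot a b c s) = pairing (pcoord i c s) (xdot i c s).
  apply: etrans (esym (pairing_cot_coord _ _ _ _)); congr (pairing _ _).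
  exact: xdot_transition sab ids at_s.
apply: etrans (pairingB _ _ _) _.
apply: etrans _ (esym (pairingB _ _ _)).
exact: (f_equal2 (fun x y => x - y) E2 (esym E1)).
Qed.

End curves.

(** * The density of the action, and the Euler-Lagrange system *)

Section density.
Context {R : realType} {n m : nat} {Q : manifold R n}.
Notation lebesgue := (@lebesgue_measure R).
Variables (a b : R) (hab : a < b) (qa qb : Q) (alpha beta t : R).
Hypothesis halpha : 0 < alpha <= 1.
Hypothesis ht : b < t \/ (alpha = 1 /\ beta = 1).
Variables (L : TQ Q -> R) (hL : C2_lipschitz_lagrangian L).
Variables (gam : 'I_m -> Q -> R) (hgam : forall r, C2_lipschitz (gam r)).
Variables (w : 'I_m -> R -> R) (hw : forall r, {within `[a, b], continuous (w r)}).
Implicit Types (i j : chart Q) (s : R) (c : R -> PQ Q).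

Definition drift_weight s := (t - s) `^ (alpha - 1).
Definition noise_weight s := (t - s) `^ (beta - 1).
Definition dnoise_weight s := - (beta - 1) * (t - s) `^ (beta - 1 - 1).
Definition Gamma_ratio := Gamma alpha / Gamma beta.

Lemma alpha_exponent s : s <= b -> s < t \/ alpha - 1 = 0.
Proof. by move=> sb; case: ht => [bt|[-> _]]; [left; exact: le_lt_trans bt|right; rewrite subrr]. Qed.

Lemma beta_exponent s : s <= b -> s < t \/ beta - 1 = 0.
Proof. by move=> sb; case: ht => [bt|[_ ->]]; [left; exact: le_lt_trans bt|right; rewrite subrr]. Qed.

Lemma pow_continuous (e : R) s : s < t \/ e = 0 -> {for s, continuous (fun s : R => (t - s) `^ e)}.
Proof.
move=> h; have [d _] := is_derive_powB h.
by apply: differentiable_continuous; apply/derivable1_diffP.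
Qed.

Lemma drift_weight_continuous s : s <= b -> {for s, continuous drift_weight}.
Proof. by move=> sb; exact: pow_continuous (alpha_exponent sb). Qed.

Lemma noise_weight_derive s : s <= b -> is_derive s 1 noise_weight (dnoise_weight s).
Proof. by move=> sb; exact: is_derive_powB (beta_exponent sb). Qed.

Lemma noise_weight_continuous s : s <= b -> {for s, continuous noise_weight}.
Proof. by move=> sb; exact: pow_continuous (beta_exponent sb). Qed.

Lemma dnoise_weight_continuous s : s <= b -> {for s, continuous dnoise_weight}.
Proof.
move=> sb; rewrite /dnoise_weight; case: ht => [bt|[_ ->]].
  apply: cvgM; first exact: cvg_cst.
  by apply: pow_continuous; left; exact: le_lt_trans bt.
rewrite subrr oppr0.
have -> : (fun s : R => 0 * (t - s) `^ (0 - 1)) = cst 0 by apply/funext => x; rewrite mul0r.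
exact: cvg_cst.
Qed.

Lemma within_of_continuous (V : topologicalType) (f : R -> V) s : {for s, continuous f} ->
  f @ within `[a, b] (nbhs s) --> f s.
Proof. by move=> cf; exact: (cvg_trans (cvg_app f (cvg_within _)) cf). Qed.

(** The time derivative of gamma_r along the curve, written without reference to a
    chart other than the preferred one so that it is a globally defined function of s. *)
Definition noise_dot r c s : R :=
  'd (loc (gam r) (chart_at (pos (c s)))) (coord (chart_at (pos (c s))) (pos (c s))) (qdot a b c s).

(** Gamma(alpha) times the action has this integrand, up to boundary terms: the noise
    integral is replaced by minus the integral of w times the derivative of
    gamma_r(q(s)) (t - s)^(beta - 1), and [Gamma_ratio] = Gamma(alpha) / Gamma(beta)
    accounts for the different normalizations. *)
Definition density c s : R :=
  drift_weight s * (L (pos (c s), vel (c s)) + pairing (mom (c s)) (qdot a b c s - vel (c s)))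
  - \sum_r Gamma_ratio * w r s * (dnoise_weight s * gam r (pos (c s)) + noise_weight s * noise_dot r c s).

(** The expression of [density] in a chart, as a function of the coordinates x of the
    point, xd of the velocity of the curve, v and p of the fibre variables. *)
Definition density_at i s (x xd v p : 'rV[R]_n) : R :=
  drift_weight s * (locT L i x v + pairing p (xd - v))
  - \sum_r Gamma_ratio * w r s *
      (dnoise_weight s * loc (gam r) i x + noise_weight s * pairing xd (grad (loc (gam r) i) x)).

Lemma loc_gam_Ck2 r i : Ck 2 (coord i @` dom i) (loc (gam r) i).
Proof. by have [] := hgam r i. Qed.

Lemma loc_gam_differentiable r i y : (coord i @` dom i) y -> differentiable (loc (gam r) i) y.
Proof. by move=> iy; have [h _] := loc_gam_Ck2 r i; exact: h. Qed.

Lemma diff_loc_gam r i y u : (coord i @` dom i) y ->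
  'd (loc (gam r) i) y u = pairing u (grad (loc (gam r) i) y).
Proof.
move=> iy.
have := diff_coordinates u (row_coordinate_system n) (loc_gam_differentiable r iy).
move=> ->; rewrite /pairing; apply: eq_bigr => k _.
by rewrite /grad mxE.
Qed.

Lemma Lagrangian_C2 i : Ck 2 ((coord i @` dom i) `*` [set: 'rV[R]_n])
  (fun z : 'rV[R]_n * 'rV[R]_n => locT L i z.1 z.2).
Proof. by have [] := hL i. Qed.

Lemma dLdqE i x v k : dLdq L i x v 0 k =
  'D_(delta_mx 0 k, 0) (fun z : 'rV[R]_n * 'rV[R]_n => locT L i z.1 z.2) (x, v).
Proof.
rewrite /dLdq /grad mxE /derive; set A := (X in lim (X @ _) = _).
by set B := (X in _ = lim (X @ _)); have -> : B = A
  by apply/funext => h; rewrite /A /B /= scaler0 add0r.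
Qed.

Lemma dLdvE i x v k : dLdv L i x v 0 k =
  'D_(0, delta_mx 0 k) (fun z : 'rV[R]_n * 'rV[R]_n => locT L i z.1 z.2) (x, v).
Proof.
rewrite /dLdv /grad mxE /derive; set A := (X in lim (X @ _) = _).
by set B := (X in _ = lim (X @ _)); have -> : B = A
  by apply/funext => h; rewrite /A /B /= scaler0 add0r.
Qed.

(** The k-th entry is the derivative, in the direction dx, of the k-th partial derivative. *)
Definition hessian_row r i (x dx : 'rV[R]_n) : 'rV[R]_n :=
  \row_k \sum_l dx 0 l *: 'D_(delta_mx 0 l) (fun y => 'D_(delta_mx 0 k) (loc (gam r) i) y) x.

Definition ddensity_at i s (x xd v p dx dxd dv dp : 'rV[R]_n) : R :=
  drift_weight s * ((pairing dx (dLdq L i x v) + pairing dv (dLdv L i x v))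
           + (pairing dp (xd - v) + pairing p (dxd - dv)))
  - \sum_r Gamma_ratio * w r s *
      (dnoise_weight s * pairing dx (grad (loc (gam r) i) x)
       + noise_weight s * (pairing dxd (grad (loc (gam r) i) x) + pairing xd (hessian_row r i x dx))).

Lemma C1at_timeM (u : R -> R) (v dv : R -> R -> R) z :
  u @ within `[a, b] (nbhs z.1) --> u z.1 -> C1at a b v dv z ->
  C1at a b (fun s e => u s * v s e) (fun s e => u s * dv s e) z.
Proof.
move=> cu hv; have := C1at_M (C1at_time cu) hv.
by congr (C1at _ _ _ _ _); apply/funext => s; apply/funext => e; rewrite mul0r add0r.
Qed.

Section families.
Variables (i : chart Q) (z : R * R) (hz : a <= z.1 <= b).
Variables (X dX Xd dXd V dV P dP : R -> R -> 'rV[R]_n).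
Hypothesis Xi : (coord i @` dom i) (X z.1 z.2).
Hypotheses (hX : C1at a b X dX z) (hXd : C1at a b Xd dXd z) (hV : C1at a b V dV z) (hP : C1at a b P dP z).

Lemma C1at_lagrangian : C1at a b (fun s e => locT L i (X s e) (V s e))
  (fun s e => pairing (dX s e) (dLdq L i (X s e) (V s e))
              + pairing (dV s e) (dLdv L i (X s e) (V s e))) z.
Proof.
have [dL cL] := Lagrangian_C2 i.
have Az : ((coord i @` dom i) `*` [set: 'rV[R]_n]) (X z.1 z.2, V z.1 z.2) by split.
have h := C1at_comp (pair_coordinate_system n) (dL _ Az) _ (C1at_pair hX hV).
have {}h := h (fun k => differentiable_continuous ((cL _).1 _ Az)).
move: h; congr (C1at _ _ _ _ _); apply/funext => s; apply/funext => e.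
rewrite (pair_basis_sum (dX s e, dV s e)
  (fun u => 'D_u (fun y : 'rV[R]_n * 'rV[R]_n => locT L i y.1 y.2) (X s e, V s e))) /=.
apply: f_equal2; apply: eq_bigr => k _.
  by rewrite dLdqE.
by rewrite dLdvE.
Qed.

Lemma C1at_grad_gam r : C1at a b (fun s e => grad (loc (gam r) i) (X s e))
  (fun s e => hessian_row r i (X s e) (dX s e)) z.
Proof.
have [_ cg] := loc_gam_Ck2 r i.
apply: C1at_rows => k; have := C1at_Ck (cg (delta_mx 0 k)) Xi hX.
congr (C1at _ _ _ _ _); apply/funext => s; apply/funext => e.
  by rewrite /grad mxE.
by rewrite /hessian_row mxE.
Qed.

Lemma C1at_loc_gam r : C1at a b (fun s e => loc (gam r) i (X s e))
  (fun s e => pairing (dX s e) (grad (loc (gam r) i) (X s e))) z.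
Proof.
have [dg cg] := loc_gam_Ck2 r i.
have := C1at_comp_row (dg _ Xi) (fun k => differentiable_continuous ((cg _).1 _ Xi)) hX.
congr (C1at _ _ _ _ _); apply/funext => s; apply/funext => e.
by rewrite /pairing; apply: eq_bigr => k _; rewrite /grad mxE.
Qed.

Lemma C1at_density_at :
  C1at a b (fun s e => density_at i s (X s e) (Xd s e) (V s e) (P s e))
       (fun s e => ddensity_at i s (X s e) (Xd s e) (V s e) (P s e)
                                   (dX s e) (dXd s e) (dV s e) (dP s e)) z.
Proof.
have zb : z.1 <= b by case/andP: hz.
have zab : [set` `[a, b]] z.1 by rewrite /= in_itv.
have c1 := within_of_continuous (drift_weight_continuous zb).
have c2 := within_of_continuous (noise_weight_continuous zb).
have c3 := within_of_continuous (dnoise_weight_continuous zb).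
apply: C1at_B.
  apply: C1at_timeM => //.
  exact: (C1at_D C1at_lagrangian (C1at_pairing hP (C1at_B hXd hV))).
apply: (@C1at_sum R a b R m (fun r s e => Gamma_ratio * w r s * (dnoise_weight s * loc (gam r) i (X s e) +
     noise_weight s * pairing (Xd s e) (grad (loc (gam r) i) (X s e))))
   (fun r s e => Gamma_ratio * w r s *
      (dnoise_weight s * pairing (dX s e) (grad (loc (gam r) i) (X s e))
       + noise_weight s * (pairing (dXd s e) (grad (loc (gam r) i) (X s e)) +
                  pairing (Xd s e) (hessian_row r i (X s e) (dX s e)))))) => r.
apply: (@C1at_timeM (fun s => Gamma_ratio * w r s)).
  apply: cvgM; first exact: cvg_cst.
  by have /within_contP := @hw r; apply.
apply: C1at_D; apply: C1at_timeM => //; first exact: C1at_loc_gam.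
exact: (C1at_pairing hXd (C1at_grad_gam r)).
Qed.

End families.

Lemma cvg_near_eq (f g : R -> R) s : a <= s <= b ->
  (\forall x \near within `[a, b] (nbhs s), g x = f x) ->
  g @ within `[a, b] (nbhs s) --> g s -> f @ within `[a, b] (nbhs s) --> f s.
Proof.
move=> sab nE cg.
have <- : g s = f s.
  have n1 : \forall x \near s, `[a, b]%classic x -> g x = f x by exact: nE.
  by apply: (nbhs_singleton n1); rewrite /= in_itv.
by apply: cvg_trans cg; apply: near_eq_cvg.
Qed.

Lemma within_seg_strip (P : set R) (s e : R) : within `[a, b] (nbhs s) P ->
  within (strip a b) (nbhs (s, e)) (fun y => P y.1).
Proof.
move=> nP.
exists ([set x | `[a, b]%classic x -> P x], setT) => /=; first by split => //; exact: filterT.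
by move=> [x y] /= [h _]; rewrite /strip /= => xab; apply: h; rewrite in_itv.
Qed.

Definition drift_coef s := (alpha - 1) / (t - s).
Definition ratio_weight s := (t - s) `^ (beta - alpha).
Definition dratio_weight s := - (beta - alpha) * (t - s) `^ (beta - alpha - 1).

Lemma ratio_exponent s : s <= b -> s < t \/ beta - alpha = 0.
Proof. by move=> sb; case: ht => [bt|[-> ->]]; [left; exact: le_lt_trans bt|right; rewrite subrr]. Qed.

Lemma pow_derivE e s : s < t \/ e = 0 ->
  - e * (t - s) `^ (e - 1) = - (t - s) `^ e * (e / (t - s)).
Proof.
case=> [st|->]; last by rewrite oppr0 !mul0r mulr0.
have ts : 0 < t - s by rewrite subr_gt0.
rewrite powRB; last by rewrite (gt_eqF ts) implybT.
by rewrite powRr1 ?ltW //; field; rewrite gt_eqF.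
Qed.

Lemma noise_weightE s : s <= b -> drift_weight s * ratio_weight s = noise_weight s.
Proof.
move=> sb; rewrite /drift_weight /ratio_weight /noise_weight; case: ht => [bt|[-> ->]].
  have ts : 0 < t - s by rewrite subr_gt0 (le_lt_trans sb bt).
  rewrite -powRD; first by congr (_ `^ _); ring.
  by rewrite (gt_eqF ts) implybT.
by rewrite !subrr !powRr0 mulr1.
Qed.

(** The inverse of the weight is a power of the same form, hence is differentiated by
    [is_derive_powB] too. *)
Lemma drift_weightV s : s <= b -> (t - s) `^ (1 - alpha) * drift_weight s = 1.
Proof.
move=> sb; rewrite /drift_weight; case: ht => [bt|[-> _]].
  have ts : 0 < t - s by rewrite subr_gt0 (le_lt_trans sb bt).
  rewrite -powRD; last by rewrite (gt_eqF ts) implybT.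
  by rewrite (_ : 1 - alpha + (alpha - 1) = 0) ?powRr0 //; ring.
by rewrite !subrr !powRr0 mulr1.
Qed.

Lemma drift_weightV_exponent s : s <= b -> s < t \/ 1 - alpha = 0.
Proof. by move=> sb; case: ht => [bt|[-> _]]; [left; exact: le_lt_trans bt|right; rewrite subrr]. Qed.

Lemma drift_weight_derive s : s <= b -> is_derive s 1 drift_weight (- drift_weight s * drift_coef s).
Proof.
move=> sb; have e := alpha_exponent sb.
by apply: is_derive_eq (is_derive_powB e) _; rewrite pow_derivE.
Qed.

Lemma drift_weightV_derive s : s <= b -> is_derive s 1 (fun s => (t - s) `^ (1 - alpha))
  ((t - s) `^ (1 - alpha) * drift_coef s).
Proof.
move=> sb; have e := drift_weightV_exponent sb.
apply: is_derive_eq (is_derive_powB e) _; rewrite (pow_derivE e) /drift_coef.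
by ring.
Qed.

Lemma ratio_weight_derive s : s <= b -> is_derive s 1 ratio_weight (dratio_weight s).
Proof. by move=> sb; exact: is_derive_powB (ratio_exponent sb). Qed.

(** The logarithmic derivatives add up, since the noise weight is the product of the
    drift weight and the ratio weight. *)
Lemma dnoise_weightE s : s <= b ->
  dnoise_weight s = - drift_weight s * drift_coef s * ratio_weight s + drift_weight s * dratio_weight s.
Proof.
move=> sb; have d1 := is_deriveM (drift_weight_derive sb) (ratio_weight_derive sb).
have d2 := noise_weight_derive sb.
have E : dnoise_weight s = - (beta - 1) * (t - s) `^ (beta - 1 - 1) by [].
rewrite E (pow_derivE (beta_exponent sb)) /dratio_weight (pow_derivE (ratio_exponent sb)).
by rewrite -/(noise_weight s) -/(ratio_weight s) -(noise_weightE sb) /drift_coef; ring.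
Qed.

Lemma dratio_weight_continuous s : s <= b -> {for s, continuous dratio_weight}.
Proof.
move=> sb; rewrite /dratio_weight; case: ht => [bt|[-> ->]].
  apply: cvgM; first exact: cvg_cst.
  by apply: pow_continuous; left; exact: le_lt_trans bt.
rewrite subrr oppr0.
have -> : (fun s : R => 0 * (t - s) `^ (0 - 1)) = cst 0 by apply/funext => x; rewrite mul0r.
exact: cvg_cst.
Qed.

Lemma drift_coef_continuous s : s <= b -> {for s, continuous drift_coef}.
Proof.
move=> sb; rewrite /drift_coef; case: ht => [bt|[-> _]].
  have ts : t - s != 0 by rewrite subr_eq0 gt_eqF // (le_lt_trans sb bt).
  apply: cvgM; first exact: cvg_cst.
  apply: cvgV => //; apply: cvgB; [exact: cvg_cst|exact: cvg_id].
have -> : (fun s : R => (1 - 1) / (t - s)) = cst 0 by apply/funext => x; rewrite subrr mul0r.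
exact: cvg_cst.
Qed.

Section on_a_curve.
Variables (c : R -> PQ Q) (hc : path_space a b qa qb c).
Implicit Types (k : 'I_n) (r : 'I_m).

Lemma noise_dot_chart r i s : a <= s <= b -> dom i (pos (c s)) ->
  noise_dot r c s = pairing (xdot a b i c s) (grad (loc (gam r) i) (qcoord i c s)).
Proof.
move=> sab ids; have at_s := dom_chart_at (pos (c s)).
have E := diff_loc (xdot a b i c s) ids at_s
  (loc_gam_differentiable r (coord_image ids)) (loc_gam_differentiable r (coord_image at_s)).
apply: etrans _ (diff_loc_gam r _ (coord_image ids)); apply: etrans _ E.
rewrite /noise_dot; congr ('d _ _ _).
exact: (xdot_transition hab hc sab ids at_s).
Qed.

Lemma density_chart i s : a <= s <= b -> dom i (pos (c s)) ->
  density c s = density_at i s (qcoord i c s) (xdot a b i c s) (vcoord i c s) (pcoord i c s).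
Proof.
move=> sab ids; rewrite /density /density_at; congr (_ * (_ + _) - _).
- exact: (esym (locT_tan_coord L (vel (c s)) ids)).
- exact: (pairing_qdot hab hc sab ids).
apply: eq_bigr => r _; congr (_ * (_ * _ + _ * _)).
- exact: (esym (loc_coord (gam r) ids)).
- exact: noise_dot_chart.
Qed.

Lemma gam_pos_derive r s : a < s < b ->
  is_derive s 1 (fun s => gam r (pos (c s))) (noise_dot r c s).
Proof.
move=> sab; have at_s := dom_chart_at (pos (c s)).
have sab' := itvooW sab.
set i := chart_at (pos (c s)) in at_s.
have d := is_derive_chain (loc_gam_differentiable r (coord_image at_s))
            (qcoord_is_derive hc sab at_s).
apply: near_eq_is_derive d.
have := within_seg_interior sab (pos_near_dom hc sab' at_s).
by apply: filterS => x ix; exact: loc_coord.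
Qed.

Lemma pos_gam_cvg r s : a <= s <= b ->
  (fun s => gam r (pos (c s))) @ within `[a, b] (nbhs s) --> gam r (pos (c s)).
Proof.
move=> sab; have at_s := dom_chart_at (pos (c s)).
set i := chart_at _ in at_s.
apply: (@cvg_near_eq _ (fun s => loc (gam r) i (qcoord i c s))) => //.
  by apply: filterS (pos_near_dom hc sab at_s) => x ix; exact: loc_coord.
have d := loc_gam_differentiable r (coord_image at_s).
exact: (cvg_comp _ _ (qcoord_cvg hc sab at_s) (differentiable_continuous d)).
Qed.

Lemma noise_cvg r s : a <= s <= b ->
  noise_dot r c @ within `[a, b] (nbhs s) --> noise_dot r c s.
Proof.
move=> sab; have at_s := dom_chart_at (pos (c s)).
set i := chart_at _ in at_s.
apply: (@cvg_near_eq _ (fun s => pairing (xdot a b i c s) (grad (loc (gam r) i) (qcoord i c s)))) => //.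
  have n1 : \forall x \near s, `[a, b]%classic x -> dom i (pos (c x)).
    exact: (pos_near_dom hc sab at_s).
  apply: filterS n1 => x ix xab; apply/esym; apply: (noise_dot_chart).
    by move: xab; rewrite /= in_itv.
  exact: ix.
have hX : C1at a b (fun s _ => qcoord i c s) (fun _ _ => 0) (s, 0).
  by apply: C1at_time; exact: (qcoord_cvg hc sab at_s).
have hXd : C1at a b (fun s _ => xdot a b i c s) (fun _ _ => 0) (s, 0).
  by apply: C1at_time; exact: (xdot_cvg hc sab at_s).
have Xi : (coord i @` dom i) ((fun s (_ : R) => qcoord i c s) (s, 0:R).1 (s, 0:R).2).
  exact: coord_image.
have [_ h _] := C1at_pairing hXd (C1at_grad_gam Xi hX r).
exact: (strip_cont_slice h).
Qed.

Lemma density_cvg s : a <= s <= b -> density c @ within `[a, b] (nbhs s) --> density c s.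
Proof.
move=> sab; have at_s := dom_chart_at (pos (c s)).
set i := chart_at _ in at_s.
apply: (@cvg_near_eq _ (fun s => density_at i s
  (qcoord i c s) (xdot a b i c s) (vcoord i c s) (pcoord i c s))) => //.
  have n1 : \forall x \near s, `[a, b]%classic x -> dom i (pos (c x)).
    exact: (pos_near_dom hc sab at_s).
  apply: filterS n1 => x ix xab; apply/esym.
  have xab' : a <= x <= b by move: xab; rewrite /= in_itv.
  exact: (density_chart xab' (ix xab)).
have hX : C1at a b (fun s _ => qcoord i c s) (fun _ _ => 0) (s, 0).
  by apply: C1at_time; exact: (qcoord_cvg hc sab at_s).
have hXd : C1at a b (fun s _ => xdot a b i c s) (fun _ _ => 0) (s, 0).
  by apply: C1at_time; exact: (xdot_cvg hc sab at_s).
have hV : C1at a b (fun s _ => vcoord i c s) (fun _ _ => 0) (s, 0).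
  by apply: C1at_time; exact: (vcoord_cvg hc sab at_s).
have hP : C1at a b (fun s _ => pcoord i c s) (fun _ _ => 0) (s, 0).
  by apply: C1at_time; exact: (pcoord_cvg hc sab at_s).
have Xi : (coord i @` dom i) ((fun s (_ : R) => qcoord i c s) (s, 0:R).1 (s, 0:R).2).
  exact: coord_image.
have zab : a <= (s, 0:R).1 <= b by [].
have [_ h _] := C1at_density_at zab Xi hX hXd hV hP.
exact: (strip_cont_slice h).
Qed.

(** It only involves the prescribed end points, hence is the same for all curves of the
    path space. *)
Definition boundary_noise : R :=
  \sum_r (gam r qb * noise_weight b * w r b - gam r qa * noise_weight a * w r a).

(** The density is the action integrated by parts, so Gamma(alpha) must not vanish. *)
Lemma action_density :
  action a b L gam alpha beta t w c =
  (Gamma alpha)^-1 * (\int[lebesgue]_(s in `[a, b]) density c s)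
  + (Gamma beta)^-1 * boundary_noise.
Proof.
have G0 : Gamma alpha != 0 by rewrite gt_eqF // Gamma_gt0.
have mI := seg_measurable a b.
have inab s : [set` `[a, b]] s -> a <= s <= b by rewrite /= in_itv.
pose f r s := gam r (pos (c s)) * noise_weight s.
pose f' r s := dnoise_weight s * gam r (pos (c s)) + noise_weight s * noise_dot r c s.
have cpw (u : R -> R) : (forall s, s <= b -> {for s, continuous u}) ->
    forall s, a <= s <= b -> u @ within `[a, b] (nbhs s) --> u s.
  by move=> h s /andP[_ sb]; apply: within_of_continuous; exact: h.
have csg := cpw _ noise_weight_continuous.
have cdsg := cpw _ dnoise_weight_continuous.
have cf r : {within `[a, b], continuous (f r)}.
  apply/within_contP => s /inab sab; apply: cvgM; [exact: pos_gam_cvg|exact: csg].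
have cf' r : {within `[a, b], continuous (f' r)}.
  apply/within_contP => s /inab sab; apply: cvgD; apply: cvgM.
  - exact: cdsg.
  - exact: pos_gam_cvg.
  - exact: csg.
  - exact: noise_cvg.
have cwf r : {within `[a, b], continuous (fun s => w r s * f' r s)}.
  move=> s; apply: cvgM; [exact: hw|exact: cf'].
have cd : {within `[a, b], continuous (density c)}.
  by apply/within_contP => s /inab; exact: density_cvg.
have df r s : a < s < b -> is_derive s 1 (f r) (f' r s).
  move=> sab; have sb : s <= b by case/andP: sab => _ /ltW.
  have := is_deriveM (gam_pos_derive r sab) (noise_weight_derive sb).
  move=> h; apply: is_derive_eq h _.
  by rewrite /f' /GRing.scale /=; congr (_ + _); exact: mulrC.
have ito r : ito_integral (fun s => gam r (pos (c s)) * (t - s) `^ (beta - 1)) (w r) a b =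
    (gam r qb * noise_weight b * w r b - gam r qa * noise_weight a * w r a)
    - \int[lebesgue]_(s in `[a, b]) (w r s * f' r s).
  have := ito_integral_by_parts (ltW hab) (cf r) (cf' r) (@hw r) (df r).
  by rewrite /f; case: hc => _ -> -> _.
have main : \int[lebesgue]_(s in `[a, b])
    (L (pos (c s), vel (c s)) * (t - s) `^ (alpha - 1) +
     pairing (mom (c s)) (qdot a b c s - vel (c s)) * (t - s) `^ (alpha - 1)) =
   \int[lebesgue]_(s in `[a, b]) density c s
   + Gamma_ratio * \sum_r \int[lebesgue]_(s in `[a, b]) (w r s * f' r s).
  have cS : {within `[a, b], continuous (fun s => \sum_r w r s * f' r s)}.
    move=> s; apply: cvg_bigsum => r; exact: cwf.
  rewrite -(seg_integral_sum cwf) -(RintegralZl Gamma_ratio mI (seg_integrable cS)).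
  have ckS : {within `[a, b], continuous (fun s => Gamma_ratio * \sum_r w r s * f' r s)}.
    move=> s; apply: cvgM; first exact: cvg_cst.
    exact: cS.
  rewrite -(RintegralD mI (seg_integrable cd) (seg_integrable ckS)).
  apply: eq_Rintegral => s _.
  rewrite /density -mulrDl mulrC -/(drift_weight s).
  have -> : Gamma_ratio * (\sum_r w r s * f' r s) =
     \sum_r Gamma_ratio * w r s *
        (dnoise_weight s * gam r (pos (c s)) + noise_weight s * noise_dot r c s).
    by rewrite mulr_sumr; apply: eq_bigr => r _; rewrite mulrA.
  by rewrite subrK.
have total : \sum_r ito_integral (fun s => gam r (pos (c s)) * (t - s) `^ (beta - 1)) (w r) a b
    = boundary_noise - \sum_r \int[lebesgue]_(s in `[a, b]) (w r s * f' r s).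
  by rewrite (eq_bigr _ (fun r _ => ito r)) sumrB.
(* abstract identity: the terms of the action are kept opaque for ring *)
have alg (ga gb I B S : R) : ga != 0 ->
    ga^-1 * (I + ga / gb * S) + gb^-1 * (B - S) = ga^-1 * I + gb^-1 * B.
  move=> g0; have -> : ga^-1 * (I + ga / gb * S) = ga^-1 * I + (ga^-1 * ga) * gb^-1 * S by ring.
  by rewrite mulVf //; ring.
by rewrite /action main total; exact: alg.
Qed.

Definition grad_noise r i k s := grad (loc (gam r) i) (qcoord i c s) 0 k.
Definition grad_noise_dot r i k s :=
  hessian_row r i (qcoord i c s) (xdot a b i c s) 0 k.

(** The coefficient of the time derivative of dq_k in the first variation. *)
Definition noisy_momentum i k s : R :=
  drift_weight s * pcoord i c s 0 k - \sum_r Gamma_ratio * w r s * (noise_weight s * grad_noise r i k s).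

(** The coefficient of dq_k in the first variation. *)
Definition force i k s : R :=
  drift_weight s * dLdq L i (qcoord i c s) (vcoord i c s) 0 k
  - \sum_r Gamma_ratio * w r s * (dnoise_weight s * grad_noise r i k s + noise_weight s * grad_noise_dot r i k s).

(** The noisy momentum is differentiable although the momentum itself is not: p inherits
    the roughness of the paths w r, which the correction term cancels. *)
Definition euler_lagrange i s :=
  [/\ xdot a b i c s = vcoord i c s,
      pcoord i c s = dLdv L i (qcoord i c s) (vcoord i c s) &
      forall k, is_derive s 1 (noisy_momentum i k) (force i k s)].

Section regularity.
Variables (i : chart Q) (s : R) (sab : a <= s <= b) (ids : dom i (pos (c s))).

Lemma row_cvg (f : R -> 'rV[R]_n) k : f @ within `[a, b] (nbhs s) --> f s ->
  (fun s => f s 0 k) @ within `[a, b] (nbhs s) --> f s 0 k.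
Proof. by move=> cf; exact: (cvg_comp _ _ cf (coord0_continuous k _)). Qed.

Lemma w_cvg r : w r @ within `[a, b] (nbhs s) --> w r s.
Proof. by have /within_contP := @hw r; apply; rewrite /= in_itv. Qed.

Lemma Dgam_differentiable r k : differentiable (fun y => 'D_(delta_mx 0 k) (loc (gam r) i) y) (qcoord i c s).
Proof.
have [_ h] := loc_gam_Ck2 r i; have [d _] := h (delta_mx 0 k).
by apply: d; exact: coord_image.
Qed.

Lemma grad_noise_cvg r k : grad_noise r i k @ within `[a, b] (nbhs s) --> grad_noise r i k s.
Proof.
have E : grad_noise r i k = (fun y => 'D_(delta_mx 0 k) (loc (gam r) i) y) \o qcoord i c.
  by apply/funext => x; rewrite /grad_noise /grad mxE.
rewrite E; have d := Dgam_differentiable r k.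
exact: (cvg_comp _ _ (qcoord_cvg hc sab ids) (differentiable_continuous d)).
Qed.

Lemma grad_noise_dot_cvg r k :
  grad_noise_dot r i k @ within `[a, b] (nbhs s) --> grad_noise_dot r i k s.
Proof.
have E : grad_noise_dot r i k = (fun x => \sum_l xdot a b i c x 0 l *:
   'D_(delta_mx 0 l) (fun y => 'D_(delta_mx 0 k) (loc (gam r) i) y) (qcoord i c x)).
  by apply/funext => x; rewrite /grad_noise_dot /hessian_row mxE.
rewrite E; apply: cvg_bigsum => l; apply: cvgZ; first exact: row_cvg (xdot_cvg hc sab ids).
have [_ h] := loc_gam_Ck2 r i; have [_ h2] := h (delta_mx 0 k).
exact: (cvg_comp _ _ (qcoord_cvg hc sab ids) (h2 (delta_mx 0 l) _ (coord_image ids))).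
Qed.

Lemma state_cvg :
  (fun s => (qcoord i c s, vcoord i c s)) @ within `[a, b] (nbhs s) --> (qcoord i c s, vcoord i c s).
Proof. exact: (cvg_pair (qcoord_cvg hc sab ids) (vcoord_cvg hc sab ids)). Qed.

Lemma DL_cvg u : (fun s => 'D_u (fun z : 'rV[R]_n * 'rV[R]_n => locT L i z.1 z.2)
    (qcoord i c s, vcoord i c s)) @ within `[a, b] (nbhs s) -->
  'D_u (fun z : 'rV[R]_n * 'rV[R]_n => locT L i z.1 z.2) (qcoord i c s, vcoord i c s).
Proof.
have [_ cL] := Lagrangian_C2 i; have [d _] := cL u.
have dz : differentiable ('D_u (fun z : 'rV[R]_n * 'rV[R]_n => locT L i z.1 z.2))
    (qcoord i c s, vcoord i c s) by apply: d; split => //; exact: coord_image.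
exact: (cvg_comp _ _ state_cvg (differentiable_continuous dz)).
Qed.

Lemma dLdq_cvg k : (fun s => dLdq L i (qcoord i c s) (vcoord i c s) 0 k)
  @ within `[a, b] (nbhs s) --> dLdq L i (qcoord i c s) (vcoord i c s) 0 k.
Proof.
rewrite dLdqE; under eq_fun do rewrite dLdqE; exact: DL_cvg.
Qed.

Lemma dLdv_cvg k : (fun s => dLdv L i (qcoord i c s) (vcoord i c s) 0 k)
  @ within `[a, b] (nbhs s) --> dLdv L i (qcoord i c s) (vcoord i c s) 0 k.
Proof.
rewrite dLdvE; under eq_fun do rewrite dLdvE; exact: DL_cvg.
Qed.

Lemma drift_weight_cvg : drift_weight @ within `[a, b] (nbhs s) --> drift_weight s.
Proof. by apply: within_of_continuous; apply: drift_weight_continuous; case/andP: sab. Qed.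

Lemma noise_weight_cvg : noise_weight @ within `[a, b] (nbhs s) --> noise_weight s.
Proof. by apply: within_of_continuous; apply: noise_weight_continuous; case/andP: sab. Qed.

Lemma dnoise_weight_cvg : dnoise_weight @ within `[a, b] (nbhs s) --> dnoise_weight s.
Proof. by apply: within_of_continuous; apply: dnoise_weight_continuous; case/andP: sab. Qed.

Lemma noisy_momentum_cvg k : noisy_momentum i k @ within `[a, b] (nbhs s) --> noisy_momentum i k s.
Proof.
apply: cvgB.
  by apply: cvgM; [exact: drift_weight_cvg|exact: row_cvg (pcoord_cvg hc sab ids)].
apply: cvg_bigsum => r; apply: cvgM.
  by apply: cvgM; [exact: cvg_cst|exact: w_cvg].
by apply: cvgM; [exact: noise_weight_cvg|exact: grad_noise_cvg].
Qed.

Lemma force_cvg k : force i k @ within `[a, b] (nbhs s) --> force i k s.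
Proof.
apply: cvgB.
  by apply: cvgM; [exact: drift_weight_cvg|exact: dLdq_cvg].
apply: cvg_bigsum => r; apply: cvgM.
  by apply: cvgM; [exact: cvg_cst|exact: w_cvg].
apply: cvgD; apply: cvgM.
- exact: dnoise_weight_cvg.
- exact: grad_noise_cvg.
- exact: noise_weight_cvg.
- exact: grad_noise_dot_cvg.
Qed.

End regularity.

Lemma grad_noise_derive i k r s : a < s < b -> dom i (pos (c s)) ->
  is_derive s 1 (grad_noise r i k) (grad_noise_dot r i k s).
Proof.
move=> sab ids.
have E : grad_noise r i k = (fun y => 'D_(delta_mx 0 k) (loc (gam r) i) y) \o qcoord i c.
  by apply/funext => x; rewrite /grad_noise /grad mxE.
rewrite E; have dd := Dgam_differentiable ids r k.
have := is_derive_chain dd (qcoord_is_derive hc sab ids).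
have -> := diff_coordinates (xdot a b i c s) (row_coordinate_system n) dd.
by rewrite /grad_noise_dot /hessian_row mxE.
Qed.

Local Notation g := grad_noise.
Local Notation gd := grad_noise_dot.
Local Notation N := noisy_momentum.
Local Notation A := force.
Let dq i s k := dLdq L i (qcoord i c s) (vcoord i c s) 0 k.
Let dv i s k := dLdv L i (qcoord i c s) (vcoord i c s) 0 k.

Definition noise_coef r i k s := Gamma_ratio * g r i k s * ratio_weight s.
Definition noise_coef_dot r i k s := Gamma_ratio * (gd r i k s * ratio_weight s + g r i k s * dratio_weight s).
(** The noisy momentum divided by (t - s)^(alpha - 1). Its increments are those of p minus
    the noise, integrated by parts, of the stochastic momentum equation. *)
Definition reduced_momentum i k s := pcoord i c s 0 k - \sum_r w r s * noise_coef r i k s.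
Definition reduced_force i k s :=
  dq i s k + dv i s k * drift_coef s - \sum_r w r s * noise_coef_dot r i k s.
Local Notation K := reduced_momentum.
Local Notation B := reduced_force.

Lemma noisy_momentumE i k s : s <= b -> N i k s = drift_weight s * K i k s.
Proof.
move=> sb; rewrite /noisy_momentum /reduced_momentum mulrBr mulr_sumr; congr (_ - _).
apply: eq_bigr => r _; rewrite /noise_coef -(noise_weightE sb); ring.
Qed.

Lemma forceE i k s : s <= b -> pcoord i c s 0 k = dv i s k ->
  A i k s = - drift_weight s * drift_coef s * K i k s + drift_weight s * B i k s.
Proof.
move=> sb pE; rewrite /force /reduced_momentum /reduced_force pE -/(dq i s k).
have -> : \sum_r Gamma_ratio * w r s * (dnoise_weight s * g r i k s + noise_weight s * gd r i k s) =
   - drift_weight s * drift_coef s * (\sum_r w r s * noise_coef r i k s) +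
   drift_weight s * (\sum_r w r s * noise_coef_dot r i k s).
  rewrite !mulr_sumr -big_split; apply: eq_bigr => r _ /=.
  rewrite /noise_coef /noise_coef_dot (dnoise_weightE sb) -(noise_weightE sb); ring.
ring.
Qed.

Lemma noisy_of_reduced i k s : a < s < b -> pcoord i c s 0 k = dv i s k ->
  is_derive s 1 (K i k) (B i k s) -> is_derive s 1 (N i k) (A i k s).
Proof.
move=> sab pE d; have /andP[_ /ltW sb] := sab.
have := is_deriveM (drift_weight_derive sb) d => h.
apply: (@near_eq_is_derive _ _ _ (drift_weight \* K i k)).
  by apply: filterS (near_oo sab) => x /andP[_ /ltW xb]; rewrite noisy_momentumE.
apply: is_derive_eq h _; rewrite (forceE sb pE) /GRing.scale /=; ring.
Qed.

Lemma reduced_of_noisy i k s : a < s < b -> pcoord i c s 0 k = dv i s k ->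
  is_derive s 1 (N i k) (A i k s) -> is_derive s 1 (K i k) (B i k s).
Proof.
move=> sab pE d; have /andP[_ /ltW sb] := sab.
have := is_deriveM (drift_weightV_derive sb) d => h.
apply: (@near_eq_is_derive _ _ _ ((fun s => (t - s) `^ (1 - alpha)) \* N i k)).
  apply: filterS (near_oo sab) => x /andP[_ /ltW xb] /=.
  by rewrite noisy_momentumE // mulrA (drift_weightV xb) mul1r.
apply: is_derive_eq h _; rewrite (forceE sb pE) (noisy_momentumE _ _ sb) /GRing.scale /=.
have E := drift_weightV sb; set nu := _ `^ _ in E *; set u := drift_weight s in E *.
have -> : nu * (- u * drift_coef s * K i k s + u * B i k s) + u * K i k s * (nu * drift_coef s) =
   (nu * u) * B i k s by ring.
by rewrite E mul1r.
Qed.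

Section on_segment.
Variables (i : chart Q) (s1 s2 : R).
Hypotheses (as1 : a <= s1) (s12 : s1 <= s2) (s2b : s2 <= b).
Hypothesis ids : forall s, s1 <= s <= s2 -> dom i (pos (c s)).

Let inab s : s1 <= s <= s2 -> a <= s <= b.
Proof. by move=> /andP[h1 h2]; rewrite (le_trans as1 h1) (le_trans h2 s2b). Qed.

Let ind s : s1 < s < s2 -> a < s < b.
Proof. by move=> /andP[h1 h2]; rewrite (le_lt_trans as1 h1) (lt_le_trans h2 s2b). Qed.

Let cvg_pow (u : R -> R) : (forall s, s <= b -> {for s, continuous u}) ->
  {within `[s1, s2], continuous u}.
Proof.
move=> h; apply: (seg_cont_of as1 s2b) => s /inab /andP[_ sb].
by apply: within_of_continuous; exact: h.
Qed.

Lemma v_seg_cont k : {within `[s1, s2], continuous (fun s => vcoord i c s 0 k)}.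
Proof.
apply: (seg_cont_of as1 s2b) => s ss.
exact: (row_cvg (f := vcoord i c) (k := k) (vcoord_cvg hc (inab ss) (ids ss))).
Qed.

Lemma x_seg_cont k : {within `[s1, s2], continuous (fun s => qcoord i c s 0 k)}.
Proof.
apply: (seg_cont_of as1 s2b) => s ss.
exact: (row_cvg (f := qcoord i c) (k := k) (qcoord_cvg hc (inab ss) (ids ss))).
Qed.

Lemma noise_coef_seg_cont r k : {within `[s1, s2], continuous (noise_coef r i k)}.
Proof.
have ct := cvg_pow (fun s sb => pow_continuous (ratio_exponent sb)).
move=> s; apply: cvgM; last exact: ct.
apply: cvgM; first exact: cvg_cst.
exact: (seg_cont_of as1 s2b (fun s ss => grad_noise_cvg (r:=r) (k:=k) (inab ss) (ids ss))).
Qed.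

Lemma noise_coef_dot_seg_cont r k : {within `[s1, s2], continuous (noise_coef_dot r i k)}.
Proof.
have ct := cvg_pow (fun s sb => pow_continuous (ratio_exponent sb)).
have cdt := cvg_pow dratio_weight_continuous.
have cg := seg_cont_of as1 s2b (fun s ss => grad_noise_cvg (r:=r) (k:=k) (inab ss) (ids ss)).
have cgd := seg_cont_of as1 s2b (fun s ss => grad_noise_dot_cvg (inab ss) (ids ss) (r:=r) (k:=k)).
move=> s; apply: cvgM; first exact: cvg_cst.
apply: cvgD; apply: cvgM.
- exact: cgd.
- exact: ct.
- exact: cg.
- exact: cdt.
Qed.

Lemma noise_coef_derive r k s : s1 < s < s2 ->
  is_derive s 1 (noise_coef r i k) (noise_coef_dot r i k s).
Proof.
move=> ss; have sab := ind ss; have /andP[_ /ltW sb] := sab.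
have d := grad_noise_derive k r sab (ids (itvooW ss)).
have := is_deriveM (is_deriveZ Gamma_ratio d) (ratio_weight_derive sb) => h.
apply: is_derive_eq h _; rewrite /noise_coef_dot /GRing.scale /= /GRing.scale /=; ring.
Qed.

Lemma w_seg_cont r : {within `[s1, s2], continuous (w r)}.
Proof. by apply: seg_sub_cont (@hw r). Qed.

Lemma drift_seg_cont k :
  {within `[s1, s2], continuous (fun s => dq i s k + dv i s k * drift_coef s)}.
Proof.
have cd := cvg_pow drift_coef_continuous.
have cq := seg_cont_of as1 s2b (fun s ss => dLdq_cvg (inab ss) (ids ss) (k:=k)).
have cv := seg_cont_of as1 s2b (fun s ss => dLdv_cvg (inab ss) (ids ss) (k:=k)).
move=> s; apply: cvgD; first exact: cq.
apply: cvgM; first exact: cv.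
exact: cd.
Qed.

Lemma w_noise_seg_cont r k :
  {within `[s1, s2], continuous (fun s => w r s * noise_coef_dot r i k s)}.
Proof.
move=> s; apply: cvgM; [exact: w_seg_cont|exact: noise_coef_dot_seg_cont].
Qed.

Lemma sum_noise_seg_cont k :
  {within `[s1, s2], continuous (fun s => \sum_r w r s * noise_coef_dot r i k s)}.
Proof.
move=> s; apply: cvg_bigsum => r.
exact: w_noise_seg_cont.
Qed.

Lemma reduced_force_seg_cont k : {within `[s1, s2], continuous (B i k)}.
Proof.
move=> s; apply: cvgB; [exact: drift_seg_cont|exact: sum_noise_seg_cont].
Qed.

Lemma reduced_momentum_seg_cont k : {within `[s1, s2], continuous (K i k)}.
Proof.
have cp := seg_cont_of as1 s2b
  (fun s ss => row_cvg (f := pcoord i c) (k := k) (pcoord_cvg hc (inab ss) (ids ss))).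
move=> s; apply: cvgB.
  exact: cp.
apply: cvg_bigsum => r; apply: cvgM.
  exact: w_seg_cont.
exact: noise_coef_seg_cont.
Qed.

(** Integration by parts of the noise, read backwards: the stochastic integral equation
    for p becomes an ordinary one for the reduced momentum. *)
Lemma momentum_equation k :
  (pcoord i c s2 0 k - pcoord i c s1 0 k =
     \int[lebesgue]_(s in `[s1, s2]) (dq i s k + dv i s k * drift_coef s) +
     \sum_r ito_integral (noise_coef r i k) (w r) s1 s2) <->
  (K i k s2 - K i k s1 = \int[lebesgue]_(s in `[s1, s2]) B i k s).
Proof.
have ito r : ito_integral (noise_coef r i k) (w r) s1 s2 =
    (w r s2 * noise_coef r i k s2 - w r s1 * noise_coef r i k s1)
    - \int[lebesgue]_(s in `[s1, s2]) (w r s * noise_coef_dot r i k s).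
  rewrite (mulrC (w r s2)) (mulrC (w r s1)).
  exact: (ito_integral_by_parts s12 (@noise_coef_seg_cont r k) (@noise_coef_dot_seg_cont r k)
            (@w_seg_cont r) (noise_coef_derive r k)).
have IB : \int[lebesgue]_(s in `[s1, s2]) B i k s =
    \int[lebesgue]_(s in `[s1, s2]) (dq i s k + dv i s k * drift_coef s)
    - \sum_r \int[lebesgue]_(s in `[s1, s2]) (w r s * noise_coef_dot r i k s).
  rewrite -(seg_integral_sum (fun r => @w_noise_seg_cont r k)).
  exact: (RintegralB (seg_measurable s1 s2) (seg_integrable (@drift_seg_cont k))
            (seg_integrable (@sum_noise_seg_cont k))).
have total : \sum_r ito_integral (noise_coef r i k) (w r) s1 s2 =
    \sum_r w r s2 * noise_coef r i k s2 - \sum_r w r s1 * noise_coef r i k s1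
    - \sum_r \int[lebesgue]_(s in `[s1, s2]) (w r s * noise_coef_dot r i k s).
  by rewrite (eq_bigr _ (fun r _ => ito r)) !sumrB.
(* both equations are the same linear relation between the boundary values *)
have alg (p2 p1 S2 S1 I1 I2 : R) : (p2 - p1 = I1 + (S2 - S1 - I2)) <->
    (p2 - S2 - (p1 - S1) = I1 - I2) by split => h; lra.
by rewrite total IB; exact: alg.
Qed.

End on_segment.

Lemma chart_segment i s : a < s < b -> dom i (pos (c s)) ->
  exists s1 s2, [/\ a < s1, s1 < s < s2, s2 < b &
    forall x, s1 <= x <= s2 -> dom i (pos (c x))].
Proof.
move=> sab ids.
have sab' := itvooW sab.
have n1 := within_seg_interior sab (pos_near_dom hc sab' ids).
have n2 := near_oo sab.
have [r /= r0 hr] := (nbhs_ballP _ _).1 (filterI n1 n2).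
have hin x : s - r / 2 <= x <= s + r / 2 -> dom i (pos (c x)) /\ a < x < b.
  move=> /andP[x1 x2]; apply: hr; rewrite /ball /= ltr_norml; lra.
exists (s - r / 2), (s + r / 2).
have i1 : s - r / 2 <= s - r / 2 <= s + r / 2 by lra.
have i2 : s - r / 2 <= s + r / 2 <= s + r / 2 by lra.
have [_ /andP[h1 _]] := hin _ i1; have [_ /andP[_ h2]] := hin _ i2.
split; [exact: h1|lra|exact: h2|].
by move=> x /hin[].
Qed.

Lemma integral_equation_derive (f F : R -> R) (s1 s2 s : R) : s1 < s < s2 ->
  {within `[s1, s2], continuous f} ->
  (forall y, s1 <= y <= s2 -> F y - F s1 = \int[lebesgue]_(x in `[s1, y]) f x) ->
  is_derive s 1 F (f s).
Proof.
move=> ss cf h; have := is_deriveD (is_derive_cst (F s1) s 1) (seg_FTC1 ss cf).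
rewrite add0r => d; apply: near_eq_is_derive d.
apply: filterS (near_oo ss) => y /andP[/ltW y1 /ltW y2].
have E : F s1 + \int[lebesgue]_(x in `[s1, y]) f x = F y.
  by rewrite -h ?y1 ?y2 // addrC subrK.
exact: E.
Qed.

(** The integral equations are differentiated at interior times, and conversely the
    pointwise equations are integrated. The relation p = dL/dv, only known at interior
    times in the second case, extends to a and b by continuity. *)
Lemma fractional_euler_lagrange :
  fractional_equations a b L gam alpha beta t w c <->
  (forall i s, a < s < b -> dom i (pos (c s)) -> euler_lagrange i s).
Proof.
split=> [H i s sab ids|H i].
- have [Hseg Hp] := H i.
  have [s1 [s2 [/ltW as1 ss /ltW s2b idx]]] := chart_segment sab ids.
  have /andP[s1s ss2] := ss.
  have s12 : s1 <= s2 by rewrite ltW // (lt_trans s1s).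
  have sab' := itvooW sab.
  have pE := Hp s sab' ids.
  have sub y : s1 <= y <= s2 -> [/\ s1 <= y, y <= b & forall x, s1 <= x <= y -> dom i (pos (c x))].
    move=> /andP[y1 y2]; split => //; first exact: le_trans s2b.
    by move=> x /andP[x1 x2]; apply: idx; rewrite x1 (le_trans x2).
  split => //.
  + apply/rowP => k.
    have d1 := is_derive_row k (qcoord_is_derive hc sab ids).
    have d2 : is_derive s 1 (fun s => qcoord i c s 0 k) (vcoord i c s 0 k).
      apply: (integral_equation_derive ss (@v_seg_cont _ _ _ as1 s2b idx k)).
      move=> y ys; have [y1 yb idy] := sub y ys.
      by have [] := Hseg s1 y as1 y1 yb idy k.
    by rewrite -(is_deriveE d1) (is_deriveE d2).
  + move=> k; apply: (noisy_of_reduced sab); first by rewrite pE.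
    apply: (integral_equation_derive ss
      (@reduced_force_seg_cont _ _ _ as1 s2b idx k)).
    move=> y ys; have [y1 yb idy] := sub y ys.
    have [_ E] := Hseg s1 y as1 y1 yb idy k.
    by apply/(momentum_equation as1 y1 yb idy k).
- have pE s : a <= s <= b -> dom i (pos (c s)) ->
      pcoord i c s = dLdv L i (qcoord i c s) (vcoord i c s).
    move=> sab ids; apply/rowP => k.
    apply: (@eq_of_interior _ a b hab _ (fun s => pcoord i c s 0 k)
       (fun s => dLdv L i (qcoord i c s) (vcoord i c s) 0 k)) => //.
    - exact: (row_cvg (f := pcoord i c) (k := k) (pcoord_cvg hc sab ids)).
    - exact: (dLdv_cvg sab ids (k := k)).
    - apply: filterS (pos_near_dom hc sab ids) => x ix xab.
      by have [_ -> _] := H i x xab ix.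
  split => // s1 s2 as1 s12 s2b idx k.
  have ind s : s1 < s < s2 -> a < s < b.
    by move=> /andP[h1 h2]; rewrite (le_lt_trans as1 h1) (lt_le_trans h2 s2b).
  split.
  + apply/esym; apply: (seg_FTC2 s12 (@v_seg_cont _ _ _ as1 s2b idx k)
       (@x_seg_cont _ _ _ as1 s2b idx k)) => s ss.
    have [<- _ _] := H i s (ind s ss) (idx s (itvooW ss)).
    exact: is_derive_row (qcoord_is_derive hc (ind s ss) (idx s (itvooW ss))).
  + apply/(momentum_equation as1 s12 s2b idx k).
    apply/esym; apply: (seg_FTC2 s12
      (@reduced_force_seg_cont _ _ _ as1 s2b idx k)
      (@reduced_momentum_seg_cont _ _ _ as1 s2b idx k)) => s ss.
    have [_ pEs d] := H i s (ind s ss) (idx s (itvooW ss)).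
    by apply: (reduced_of_noisy (ind s ss)); first by rewrite pEs.
Qed.

End on_a_curve.
End density.

(** * First variation along a family of curves *)

Section variation.
Context {R : realType} {n m : nat} {Q : manifold R n}.
Notation lebesgue := (@lebesgue_measure R).
Variables (a b : R) (hab : a < b) (qa qb : Q).
Variables (F : R -> R -> PQ Q) (eta : R) (eta0 : 0 < eta).

Definition fam_domain : set (R * R) := [set z : R * R | a <= z.1 <= b /\ `|z.2| < eta].
Definition fam_chart (i : chart Q) : set (R * R) :=
  fam_domain `&` [set z | dom i (pos (F z.2 z.1))].

Hypothesis hF : forall eps, `|eps| < eta -> path_space a b qa qb (F eps).
Hypothesis cpos : {within fam_domain, continuous (fun z => pos (F z.2 z.1))}.
Hypothesis hC : forall i,
  [/\ C1_in_eps (fam_chart i) (fun s eps => qcoord i (F eps) s),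
      C1_in_eps (fam_chart i) (fun s eps => derive_within a b (qcoord i (F eps)) s),
      C1_in_eps (fam_chart i) (fun s eps => vcoord i (F eps) s) &
      C1_in_eps (fam_chart i) (fun s eps => pcoord i (F eps) s)].
Implicit Types (i j : chart Q) (s e : R) (z : R * R).

Lemma strip_filter (A : set (R * R)) z : A `<=` strip a b ->
  within (strip a b) (nbhs z) A -> within A (nbhs z) = within (strip a b) (nbhs z).
Proof.
move=> As nA; rewrite eqEsubset; split => B nB.
  have n1 : nbhs z (fun y => strip a b y -> A y) by exact: nA.
  have n2 : nbhs z (fun y => A y -> B y) by exact: nB.
  by apply: filterS2 n1 n2 => y h1 h2 sy; apply: h2; exact: h1.
have n2 : nbhs z (fun y => strip a b y -> B y) by exact: nB.
by apply: filterS n2 => y h Ay; apply: h; exact: As.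
Qed.

Lemma near_fam_domain z : fam_domain z -> within (strip a b) (nbhs z) fam_domain.
Proof.
case: z => s e [_ /= eeta].
exists (setT, [set x | `|x| < eta]) => /=.
  by split; [exact: (@filterT _ (nbhs s) _)|exact: near_norm_lt].
by move=> [x y] /= [_ h] sx; split.
Qed.

Lemma pos_strip_cont z : fam_domain z -> strip_cont a b (fun s e => pos (F e s)) z.
Proof.
move=> Dz; have /within_contP/(_ z Dz) := cpos.
by rewrite (strip_filter _ (near_fam_domain Dz)) // => y [].
Qed.

Lemma near_fam_chart i z : fam_chart i z -> within (strip a b) (nbhs z) (fam_chart i).
Proof.
move=> [Dz iz].
have h1 : within (strip a b) (nbhs z) (fun y => dom i (pos (F y.2 y.1))).
  exact: (pos_strip_cont Dz (near_dom iz)).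
have h2 := near_fam_domain Dz.
by apply: filterS2 h1 h2 => y h3 h4; split.
Qed.

Lemma fam_chart_strip i : fam_chart i `<=` strip a b.
Proof. by move=> y [[]]. Qed.

(** The curves of the family are continuous in time, which together with the continuity of
    the parameter derivative gives joint continuity. *)
Lemma C1_in_eps_at i n' (g : R -> R -> 'rV[R]_n') z : fam_chart i z ->
  (forall z, fam_chart i z -> derivable (g z.1) z.2 1) /\
    {within fam_chart i, continuous (fun z => 'D_1 (g z.1) z.2)} ->
  (fun s => g s z.2) @ within `[a, b] (nbhs z.1) --> g z.1 z.2 ->
  C1at a b g (fun s e => 'D_1 (g s) e) z.
Proof.
move=> iz [hd cd] cs.
have cD : strip_cont a b (fun s e => 'D_1 (g s) e) z.
  have /within_contP/(_ z iz) := cd.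
  by rewrite (strip_filter (@fam_chart_strip i) (near_fam_chart iz)).
split => //; first by apply: derivableP; exact: hd.
apply: strip_cont_row => k; case: z iz cD cs => s0 e0 iz cD cs.
have s0ab : a <= s0 <= b by case: iz => -[].
apply: (joint_continuity (dU := fun s e => ('D_1 (g s) e) 0 k)) => //.
- apply: filterS (near_fam_chart iz) => y iy.
  by apply: is_derive_row; apply: derivableP; exact: hd.
- exact: (strip_cont_comp (f := fun v : 'rV[R]_n' => v 0 k)
    (coord0_continuous k _) cD).
- exact: (cvg_comp _ _ cs (coord0_continuous k _)).
Qed.

Local Notation D1 g := (fun s e => 'D_1 (g s) e).

Definition fam_q i s e := qcoord i (F e) s.
Definition fam_xdot i s e := xdot a b i (F e) s.
Definition fam_v i s e := vcoord i (F e) s.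
Definition fam_p i s e := pcoord i (F e) s.

Lemma fam_chart_data i z : fam_chart i z -> [/\ a <= z.1 <= b, `|z.2| < eta & dom i (pos (F z.2 z.1))].
Proof. by move=> [[]]. Qed.

Lemma C1at_fam_q i z : fam_chart i z -> C1at a b (fam_q i) (D1 (fam_q i)) z.
Proof.
move=> iz; have [h _ _ _] := hC i; have [zab ze di] := fam_chart_data iz.
exact: (C1_in_eps_at iz h (qcoord_cvg (hF ze) zab di)).
Qed.

Lemma C1at_fam_xdot i z : fam_chart i z -> C1at a b (fam_xdot i) (D1 (fam_xdot i)) z.
Proof.
move=> iz; have [_ h _ _] := hC i; have [zab ze di] := fam_chart_data iz.
exact: (C1_in_eps_at iz h (xdot_cvg (hF ze) zab di)).
Qed.

Lemma C1at_fam_v i z : fam_chart i z -> C1at a b (fam_v i) (D1 (fam_v i)) z.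
Proof.
move=> iz; have [_ _ h _] := hC i; have [zab ze di] := fam_chart_data iz.
exact: (C1_in_eps_at iz h (vcoord_cvg (hF ze) zab di)).
Qed.

Lemma C1at_fam_p i z : fam_chart i z -> C1at a b (fam_p i) (D1 (fam_p i)) z.
Proof.
move=> iz; have [_ _ _ h] := hC i; have [zab ze di] := fam_chart_data iz.
exact: (C1_in_eps_at iz h (pcoord_cvg (hF ze) zab di)).
Qed.

Variables (alpha beta t : R).
Hypothesis halpha : 0 < alpha <= 1.
Hypothesis ht : b < t \/ (alpha = 1 /\ beta = 1).
Variables (L : TQ Q -> R) (hL : C2_lipschitz_lagrangian L).
Variables (gam : 'I_m -> Q -> R) (hgam : forall r, C2_lipschitz (gam r)).
Variables (w : 'I_m -> R -> R) (hw : forall r, {within `[a, b], continuous (w r)}).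

Let fam_density s e := density a b alpha beta t L gam w (F e) s.
Let fam_ddensity i s e := ddensity_at alpha beta t L gam w i s
  (fam_q i s e) (fam_xdot i s e) (fam_v i s e) (fam_p i s e)
  ('D_1 (fam_q i s) e) ('D_1 (fam_xdot i s) e) ('D_1 (fam_v i s) e) ('D_1 (fam_p i s) e).

Lemma fam_density_near i z : fam_chart i z ->
  within (strip a b) (nbhs z) (fun y => C1at a b
     (fun s e => density_at alpha beta t L gam w i s (fam_q i s e) (fam_xdot i s e) (fam_v i s e) (fam_p i s e))
     (fam_ddensity i) y /\
   density_at alpha beta t L gam w i y.1 (fam_q i y.1 y.2) (fam_xdot i y.1 y.2) (fam_v i y.1 y.2) (fam_p i y.1 y.2)
   = fam_density y.1 y.2).
Proof.
move=> iz; apply: filterS (near_fam_chart iz) => y iy.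
have [yab ye dy] := fam_chart_data iy; split.
  exact: (C1at_density_at ht hL hgam hw yab (coord_image dy)
           (C1at_fam_q iy) (C1at_fam_xdot iy) (C1at_fam_v iy) (C1at_fam_p iy)).
exact/esym/(density_chart hab alpha beta t L hgam w (hF ye) yab dy).
Qed.

(** Charts only serve locally: around each point the density is given by [density_at] in
    some chart, and regularity is glued. *)
Lemma C1at_fam_density z : fam_domain z -> C1at a b fam_density (D1 fam_density) z.
Proof.
move=> Dz; have iz : fam_chart (chart_at (pos (F z.2 z.1))) z.
  by split => //; exact: dom_chart_at.
apply: C1at_glue (fam_density_near iz).
exact: fam_chart_strip iz.
Qed.

Lemma fam_density_derive i s e : fam_chart i (s, e) -> 'D_1 (fam_density s) e = fam_ddensity i s e.
Proof.
move=> iz; have [sab _ _] := fam_chart_data iz.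
have h := fam_density_near iz.
have [c _] := strip_nbhs_self sab h.
have [d _ _] : C1at a b fam_density (fam_ddensity i) (s, e).
  by apply: C1at_near c => //; apply: filterS h => y [].
exact: (is_deriveE d).
Qed.

Lemma action_derive :
  is_derive (0 : R) (1 : R) (fun e : R => action a b L gam alpha beta t w (F e) : R)
    ((Gamma alpha)^-1 * \int[lebesgue]_(s in `[a, b]) 'D_1 (fam_density s) 0).
Proof.
have d : is_derive (0:R) (1:R) (fun e : R => \int[lebesgue]_(s in `[a, b]) fam_density s e : R)
    (\int[lebesgue]_(s in `[a, b]) 'D_1 (fam_density s) 0).
  apply: (@seg_derive_integral R a b eta fam_density (fun s e => 'D_1 (fam_density s) e) eta0) => s e sab ee.
  exact: C1at_fam_density.
pose C := (Gamma beta)^-1 * boundary_noise a b qa qb beta t gam w.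
have d2 : is_derive (0:R) (1:R) (fun e : R => (Gamma alpha)^-1 *
      \int[lebesgue]_(s in `[a, b]) fam_density s e + C : R)
    ((Gamma alpha)^-1 * \int[lebesgue]_(s in `[a, b]) 'D_1 (fam_density s) 0).
  have := is_deriveD (is_deriveZ (Gamma alpha)^-1 d) (is_derive_cst C (0:R) 1).
  by rewrite addr0.
apply: near_eq_is_derive d2.
have n0 : `|0 : R| < eta by rewrite normr0.
apply: filterS (near_norm_lt n0) => e ee.
exact/esym/(action_density hab halpha ht hL hgam hw (hF ee)).
Qed.

Let c0 : R -> PQ Q := F 0.
Let X i := fam_q i.
Let Xd i := fam_xdot i.
Let dx i s := 'D_1 (X i s) 0.
Let dxd i s := 'D_1 (Xd i s) 0.
Let dv i s := 'D_1 (fam_v i s) 0.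
Let dp i s := 'D_1 (fam_p i s) 0.

Let zero_lt : `|0 : R| < eta. Proof. by rewrite normr0. Qed.
Let hc0 : path_space a b qa qb c0. Proof. exact: hF. Qed.

Let chart0 i s : a <= s <= b -> dom i (pos (c0 s)) -> fam_chart i (s, 0).
Proof. by move=> sab ids; split => //; split. Qed.

(** A product neighbourhood, as needed to integrate in time at fixed parameter. *)
Lemma variation_box i s : a < s < b -> dom i (pos (c0 s)) ->
  exists u v ep, [/\ a <= u, u < s < v, v <= b, 0 < ep &
    forall x e, u <= x <= v -> `|e| < ep -> fam_chart i (x, e)].
Proof.
move=> sab ids.
have sab' := itvooW sab.
have [[U1 U2] /= [n1 n2] UU] := near_fam_chart (chart0 sab' ids).
have [r1 /= r10 h1] := (nbhs_ballP _ _).1 (filterI n1 (near_oo sab)).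
have [r2 /= r20 h2] := (nbhs_ballP _ _).1 n2.
have hin x : s - r1 / 2 <= x <= s + r1 / 2 -> U1 x /\ a < x < b.
  by move=> /andP[x1 x2]; apply: h1; rewrite /ball /= ltr_norml; lra.
have i1 : s - r1 / 2 <= s - r1 / 2 <= s + r1 / 2 by lra.
have i2 : s - r1 / 2 <= s + r1 / 2 <= s + r1 / 2 by lra.
have [_ /andP[g1 _]] := hin _ i1; have [_ /andP[_ g2]] := hin _ i2.
exists (s - r1 / 2), (s + r1 / 2), r2; split => //; [exact: ltW|lra|exact: ltW|].
move=> x e /hin[U1x /andP[/ltW ax /ltW xb]] er; apply: (UU (x, e)) => //=.
  by split => //; apply: h2; rewrite /ball /= sub0r normrN.
by rewrite /strip /= ax xb.
Qed.

Lemma fam_q_derive i s e : fam_chart i (s, e) -> a < s < b ->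
  is_derive s 1 ((X i)^~ e) (Xd i s e).
Proof.
move=> iz sab; have [_ ze di] := fam_chart_data iz.
exact: (qcoord_is_derive (hF ze) sab di).
Qed.

(** The velocity of the variation is the variation of the velocity. *)
Lemma dx_derive i k s : a < s < b -> dom i (pos (c0 s)) ->
  is_derive s 1 (fun s => dx i s 0 k) (dxd i s 0 k).
Proof.
move=> sab ids.
have [u [v [ep [au suv vb ep0 box]]]] := variation_box sab ids.
have uv : u < v by case/andP: suv => h1 h2; exact: lt_trans h2.
apply: (@swap_derive _ u v ep (fun s e => X i s e 0 k) (fun s e => Xd i s e 0 k)
   (fun s e => ('D_1 (X i s) e) 0 k) (fun s e => ('D_1 (Xd i s) e) 0 k)) => //.
- move=> x e xuv ee; apply: C1at_row; apply: (C1at_sub au vb).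
  exact: (C1at_fam_q (box x e xuv ee)).
- move=> x e xuv ee; apply: C1at_row; apply: (C1at_sub au vb).
  exact: (C1at_fam_xdot (box x e xuv ee)).
- move=> x e /andP[ux xv] ee; apply: is_derive_row; apply: fam_q_derive.
    by apply: box => //; rewrite !ltW.
  by rewrite (le_lt_trans au ux) (lt_le_trans xv vb).
Qed.

Let GN i r s := grad (loc (gam r) i) (qcoord i c0 s).
Let H i r s (u : 'rV[R]_n) := hessian_row gam r i (qcoord i c0 s) u.

(** The variation of the time derivative of gamma_r(q) and the time derivative of its
    variation agree by [swap_derive]. Expanding both and removing the common term
    leaves the symmetry of the Hessian in the directions dq and q'. *)
Lemma hessian_symmetric i r s : a < s < b -> dom i (pos (c0 s)) ->
  pairing (dx i s) (H i r s (xdot a b i c0 s)) = pairing (xdot a b i c0 s) (H i r s (dx i s)).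
Proof.
move=> sab ids.
have [u [v [ep [au suv vb ep0 box]]]] := variation_box sab ids.
have uv : u < v by case/andP: suv => h1 h2; exact: lt_trans h2.
have C1q x e : u <= x <= v -> `|e| < ep -> C1at a b (X i) (D1 (X i)) (x, e).
  by move=> xuv ee; exact: (C1at_fam_q (box x e xuv ee)).
have C1d x e : u <= x <= v -> `|e| < ep -> C1at a b (Xd i) (D1 (Xd i)) (x, e).
  by move=> xuv ee; exact: (C1at_fam_xdot (box x e xuv ee)).
have im x e : u <= x <= v -> `|e| < ep -> (coord i @` dom i) (X i (x, e).1 (x, e).2).
  by move=> xuv ee; have [_ _ di] := fam_chart_data (box x e xuv ee); exact: coord_image.
have d1 : is_derive s 1 (fun s => pairing (dx i s) (GN i r s))
    (pairing (dxd i s) (GN i r s) + pairing (xdot a b i c0 s) (H i r s (dx i s))).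
  apply: (@swap_derive _ u v ep (fun s e => loc (gam r) i (X i s e))
    (fun s e => pairing (Xd i s e) (grad (loc (gam r) i) (X i s e)))
    (fun s e => pairing ('D_1 (X i s) e) (grad (loc (gam r) i) (X i s e)))
    (fun s e => pairing ('D_1 (Xd i s) e) (grad (loc (gam r) i) (X i s e)) +
       pairing (Xd i s e) (hessian_row gam r i (X i s e) ('D_1 (X i s) e)))) => //.
  - move=> x e xuv ee; apply: (C1at_sub au vb).
    exact: (C1at_loc_gam hgam (im x e xuv ee) (C1q x e xuv ee) r).
  - move=> x e xuv ee; apply: (C1at_sub au vb).
    exact: (C1at_pairing (C1d x e xuv ee) (C1at_grad_gam hgam (im x e xuv ee) (C1q x e xuv ee) r)).
  - move=> x e /andP[ux xv] ee.
    have xuv : u <= x <= v by rewrite !ltW.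
    have xab : a < x < b by rewrite (le_lt_trans au ux) (lt_le_trans xv vb).
    have iy := im x e xuv ee.
    rewrite -(diff_loc_gam hgam r _ iy).
    have dq := fam_q_derive (box x e xuv ee) xab.
    exact: (is_derive_chain (f := loc (gam r) i) (g := (X i)^~ e) (loc_gam_differentiable hgam r iy) dq).
have d2 : is_derive s 1 (fun s => pairing (dx i s) (GN i r s))
    (pairing (dxd i s) (GN i r s) + pairing (dx i s) (H i r s (xdot a b i c0 s))).
  have := is_derive_bigsum (fun k => is_deriveM (dx_derive k sab ids)
            (grad_noise_derive hgam hc0 k r sab ids)).
  move=> h; apply: is_derive_eq h _.
  rewrite /pairing -big_split; apply: eq_bigr => k _ /=.
  by rewrite /GRing.scale /= addrC; congr (_ + _); exact: mulrC.
have := is_deriveE d2; rewrite (is_deriveE d1).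
by move=> /addrI ->.
Qed.

Local Notation N := (noisy_momentum alpha beta t gam w c0).
Local Notation A := (force a b alpha beta t L gam w c0).

(** The terms are collected according to dq, dq', dv and dp; by the symmetry of the Hessian
    the second derivatives of gamma_r appear contracted with q' as in the time derivative
    of the noisy momentum. *)
Lemma first_variation i s : a < s < b -> dom i (pos (c0 s)) ->
  'D_1 (fam_density s) 0 =
    \sum_k (A i k s * dx i s 0 k + N i k s * dxd i s 0 k)
    + drift_weight alpha t s *
      (pairing (dLdv L i (qcoord i c0 s) (vcoord i c0 s) - pcoord i c0 s) (dv i s)
       + pairing (xdot a b i c0 s - vcoord i c0 s) (dp i s)).
Proof.
move=> sab ids.
have sab' := itvooW sab.
rewrite (fam_density_derive (chart0 sab' ids)).
rewrite /fam_ddensity /ddensity_at -/(dx i s) -/(dxd i s) -/(dv i s) -/(dp i s).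
have -> : fam_q i s 0 = qcoord i c0 s by [].
have -> : fam_xdot i s 0 = xdot a b i c0 s by [].
have -> : fam_v i s 0 = vcoord i c0 s by [].
have -> : fam_p i s 0 = pcoord i c0 s by [].
(* the noise terms, expanded in coordinates with the two sums exchanged *)
have S : \sum_r Gamma_ratio alpha beta * w r s * (dnoise_weight beta t s * pairing (dx i s) (GN i r s) +
      noise_weight beta t s * (pairing (dxd i s) (GN i r s) + pairing (xdot a b i c0 s) (H i r s (dx i s)))) =
   \sum_k ((\sum_r Gamma_ratio alpha beta * w r s * (dnoise_weight beta t s * grad_noise gam c0 r i k s +
       noise_weight beta t s * grad_noise_dot a b gam c0 r i k s)) * dx i s 0 k +
     (\sum_r Gamma_ratio alpha beta * w r s * (noise_weight beta t s * grad_noise gam c0 r i k s)) * dxd i s 0 k).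
  rewrite big_split /=; under [in RHS]eq_bigr do rewrite mulr_suml.
  rewrite [X in X + _]exchange_big /=.
  under [X in _ + X]eq_bigr do rewrite mulr_suml.
  rewrite [X in _ + X]exchange_big /= -big_split /=; apply: eq_bigr => r _.
  rewrite -[RHS]big_split -(hessian_symmetric r sab ids) /=.
  transitivity (\sum_k Gamma_ratio alpha beta * w r s * (dnoise_weight beta t s * (dx i s 0 k * GN i r s 0 k) +
      noise_weight beta t s * (dxd i s 0 k * GN i r s 0 k + dx i s 0 k * H i r s (xdot a b i c0 s) 0 k))).
    by rewrite /pairing -big_split /= !mulr_sumr -big_split /= mulr_sumr.
  apply: eq_bigr => k _.
  rewrite /GN /H -/(grad_noise gam c0 r i k s) -/(grad_noise_dot a b gam c0 r i k s).
  ring.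
(* the force and noisy momentum terms of the conclusion, minus the same noise terms *)
have T : \sum_k (A i k s * dx i s 0 k + N i k s * dxd i s 0 k) =
   drift_weight alpha t s * (pairing (dx i s) (dLdq L i (qcoord i c0 s) (vcoord i c0 s)) +
                    pairing (pcoord i c0 s) (dxd i s)) -
   \sum_k ((\sum_r Gamma_ratio alpha beta * w r s * (dnoise_weight beta t s * grad_noise gam c0 r i k s +
       noise_weight beta t s * grad_noise_dot a b gam c0 r i k s)) * dx i s 0 k +
     (\sum_r Gamma_ratio alpha beta * w r s * (noise_weight beta t s * grad_noise gam c0 r i k s)) * dxd i s 0 k).
  rewrite /pairing -big_split /= mulr_sumr -sumrB; apply: eq_bigr => k _.
  rewrite /force /noisy_momentum; ring.
rewrite S T (pairingC (_ - _) (dv i s)) (pairingC (_ - _) (dp i s)) !pairingB.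
rewrite (pairingC (dv i s) (pcoord i c0 s)).
move: (\sum_(k < n) _) (drift_weight alpha t s) => Z u.
move: (pairing _ _) => p1; move: (pairing _ _) => p2; move: (pairing _ _) => p3.
move: (pairing _ _) => p4; move: (pairing _ _) => p5; move: (pairing _ _) => p6.
ring.
Qed.

Lemma near_eps_dom i s : a <= s <= b -> dom i (pos (c0 s)) ->
  \forall e \near (0:R), dom i (pos (F e s)).
Proof.
move=> sab ids; have [[U1 U2] /= [n1 n2] UU] := near_fam_chart (chart0 sab ids).
apply: filterS n2 => e U2e.
by have [_] := UU (s, e) (conj (nbhs_singleton n1) U2e) sab.
Qed.

Lemma fam_q_is_derive i s : a <= s <= b -> dom i (pos (c0 s)) ->
  is_derive (0 : R) 1 (X i s) (dx i s).
Proof.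
by move=> sab ids; have [d _ _] := C1at_fam_q (chart0 sab ids).
Qed.

(** The variation dq is a tangent vector. *)
Lemma dx_transition i j s : a <= s <= b -> dom i (pos (c0 s)) -> dom j (pos (c0 s)) ->
  dx j s = 'd (transition i j) (qcoord i c0 s) (dx i s).
Proof.
move=> sab ids jds.
have d1 := fam_q_is_derive sab jds.
have d2 := is_derive_chain (f := transition i j) (g := X i s)
   (transition_differentiable ids jds) (fam_q_is_derive sab ids).
have d3 : is_derive (0 : R) 1 (X j s) ('d (transition i j) (qcoord i c0 s) (dx i s)).
  apply: near_eq_is_derive d2.
  by apply: filterS (near_eps_dom sab ids) => e ie; exact/esym/qcoord_transition.
by rewrite -(is_deriveE d1) (is_deriveE d3).
Qed.

(** The contraction of the noisy momentum with dq, in a form that mentions no chart but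
    the preferred one: the gradient of gamma_r contracted with dq is the variation of
    gamma_r along the family. *)
Definition boundary_term s : R :=
  drift_weight alpha t s * pairing (mom (c0 s)) (dx (chart_at (pos (c0 s))) s)
  - \sum_r Gamma_ratio alpha beta * w r s * (noise_weight beta t s * 'D_1 (fun e : R => gam r (pos (F e s)) : R) 0).

Lemma boundary_term_chart i s : a <= s <= b -> dom i (pos (c0 s)) ->
  boundary_term s = \sum_k N i k s * dx i s 0 k.
Proof.
move=> sab ids; have at_s := dom_chart_at (pos (c0 s)).
have E1 : pairing (mom (c0 s)) (dx (chart_at (pos (c0 s))) s) = pairing (pcoord i c0 s) (dx i s).
  apply: etrans (esym (pairing_cot_coord _ _ _ _)); congr (pairing _ _).
  exact: dx_transition sab ids at_s.
have E2 r : 'D_1 (fun e : R => gam r (pos (F e s)) : R) 0 =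
    pairing (dx i s) (grad (loc (gam r) i) (qcoord i c0 s)).
  have im := coord_image ids.
  have d2 := is_derive_chain (f := loc (gam r) i) (g := X i s)
     (loc_gam_differentiable hgam r im) (fam_q_is_derive sab ids).
  have d3 : is_derive (0 : R) 1 (fun e : R => gam r (pos (F e s)) : R)
      ('d (loc (gam r) i) (qcoord i c0 s) (dx i s)).
    apply: near_eq_is_derive d2.
    by apply: filterS (near_eps_dom sab ids) => e ie; exact: loc_coord.
  by rewrite (is_deriveE d3) (diff_loc_gam hgam r _ im).
rewrite /boundary_term E1 (eq_bigr (fun r => \sum_k Gamma_ratio alpha beta * w r s *
  (noise_weight beta t s * grad_noise gam c0 r i k s) * dx i s 0 k)); last first.
  move=> r _; rewrite E2 /pairing !mulr_sumr; apply: eq_bigr => k _.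
  by rewrite /grad_noise; ring.
rewrite exchange_big /pairing mulr_sumr -sumrB; apply: eq_bigr => k _ /=.
by rewrite /noisy_momentum mulrBl mulrA mulr_suml.
Qed.

Lemma boundary_term_end s (q : Q) : a <= s <= b ->
  (forall e, `|e| < eta -> pos (F e s) = q) -> boundary_term s = 0.
Proof.
move=> sab hq; have at_s := dom_chart_at (pos (c0 s)).
set i := chart_at _ in at_s.
have d : is_derive (0 : R) 1 (X i s) 0.
  have dc := is_derive_cst (coord i q) (0 : R) (1 : R).
  apply: near_eq_is_derive dc.
  by apply: filterS (near_norm_lt zero_lt) => e ee; rewrite /X /fam_q /qcoord hq.
rewrite (boundary_term_chart sab at_s) /dx (is_deriveE d).
by rewrite big1 // => k _; rewrite mxE mulr0.
Qed.

Lemma dx_cvg i k s : a <= s <= b -> dom i (pos (c0 s)) ->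
  (fun s => dx i s 0 k) @ within `[a, b] (nbhs s) --> dx i s 0 k.
Proof.
move=> sab ids.
have [_ _ c] := C1at_row k (C1at_fam_q (chart0 sab ids)).
exact: (strip_cont_slice c).
Qed.

Lemma boundary_term_cvg s : a <= s <= b ->
  boundary_term @ within `[a, b] (nbhs s) --> boundary_term s.
Proof.
move=> sab; have at_s := dom_chart_at (pos (c0 s)).
set i := chart_at _ in at_s.
apply: (@cvg_near_eq _ a b _ (fun s => \sum_k N i k s * dx i s 0 k)) => //.
  have n1 : \forall x \near s, `[a, b]%classic x -> dom i (pos (c0 x)).
    exact: (pos_near_dom hc0 sab at_s).
  apply: filterS n1 => x ix xab; apply/esym; apply: boundary_term_chart; last exact: ix.
  by move: xab; rewrite /= in_itv.
apply: cvg_bigsum => k; apply: cvgM; last exact: dx_cvg.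
exact: (noisy_momentum_cvg ht hgam hw hc0 sab at_s (k := k)).
Qed.

Hypothesis hEL : forall i s, a < s < b -> dom i (pos (c0 s)) ->
  euler_lagrange a b alpha beta t L gam w c0 i s.

Lemma boundary_term_derive s : a < s < b ->
  is_derive s 1 boundary_term ('D_1 (fam_density s) 0).
Proof.
move=> sab; have at_s := dom_chart_at (pos (c0 s)).
have sab' := itvooW sab.
set i := chart_at _ in at_s.
have [xE pE dN] := hEL sab at_s.
have E := first_variation sab at_s.
have D : 'D_1 (fam_density s) 0 = \sum_k (A i k s * dx i s 0 k + N i k s * dxd i s 0 k).
  apply: etrans E _; rewrite -/c0 xE pE !subrr.
  have p0 v : pairing (0 : 'rV[R]_n) v = 0.
    by rewrite /pairing big1 // => k _; rewrite mxE mul0r.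
  by rewrite !p0 addr0 mulr0 addr0.
rewrite D.
have := is_derive_bigsum (fun k => is_deriveM (dN k)
  (dx_derive k sab at_s)).
move=> h.
have h2 : is_derive s 1 (fun s => \sum_k N i k s * dx i s 0 k)
    (\sum_k (A i k s * dx i s 0 k + N i k s * dxd i s 0 k)).
  apply: is_derive_eq h _; apply: eq_bigr => k _.
  by rewrite /GRing.scale /= addrC; congr (_ + _); exact: mulrC.
apply: near_eq_is_derive h2.
have n1 := within_seg_interior sab (pos_near_dom hc0 sab' at_s).
apply: filterS2 n1 (near_oo sab) => x ix /andP[h1 h3].
by rewrite (@boundary_term_chart i x) // !ltW.
Qed.

(** Under the Euler-Lagrange system the variation of the density is the time derivative of
    the boundary term, which is 0 at a and b because the end points are fixed. *)
Lemma first_variation_vanishes :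
  \int[lebesgue]_(s in `[a, b]) 'D_1 (fam_density s) 0 = 0.
Proof.
have cD : {within `[a, b], continuous (fun s => 'D_1 (fam_density s) 0)}.
  apply/within_contP => s; rewrite /= in_itv /= => sab.
  have Dz : fam_domain (s, 0) by split.
  have [_ _ h] := C1at_fam_density Dz.
  exact: (strip_cont_slice h).
have cM : {within `[a, b], continuous boundary_term}.
  by apply/within_contP => s; rewrite /= in_itv /= => sab; exact: boundary_term_cvg.
have -> : \int[lebesgue]_(s in `[a, b]) 'D_1 (fam_density s) 0 = boundary_term b - boundary_term a.
  exact: (seg_FTC2 (ltW hab) cD cM boundary_term_derive).
rewrite (@boundary_term_end b qb) ?(@boundary_term_end a qa) ?subrr ?lexx ?ltW //.
  by move=> e /hF[].
by move=> e /hF[].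
Qed.

Lemma action_stationary :
  is_derive (0 : R) (1 : R) (fun e : R => action a b L gam alpha beta t w (F e) : R) 0.
Proof.
have := action_derive.
by rewrite first_variation_vanishes mulr0.
Qed.

End variation.

Section extensionality.
Context {R : realType} {n m : nat} {Q : manifold R n}.
Variables (a b : R) (hab : a < b) (qa qb : Q).
Variables (alpha beta t : R) (L : TQ Q -> R) (gam : 'I_m -> Q -> R) (w : 'I_m -> R -> R).

(** The member of parameter 0 of a variation agrees with the curve on [a, b] only. *)
Lemma euler_lagrange_ext (c c' : R -> PQ Q) i s :
  (forall x, a <= x <= b -> c x = c' x) -> path_space a b qa qb c -> a < s < b ->
  dom i (pos (c s)) ->
  euler_lagrange a b alpha beta t L gam w c i s -> euler_lagrange a b alpha beta t L gam w c' i s.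
Proof.
move=> cc hc sab ids [xE pE dN].
have sab' := itvooW sab.
have near_cc : \forall x \near s, c x = c' x.
  by apply: filterS (near_oo sab) => x /andP[h1 h2]; apply: cc; rewrite !ltW.
have cs := cc s sab'.
have qE : qcoord i c' s = qcoord i c s by rewrite /qcoord cs.
have vE : vcoord i c' s = vcoord i c s by rewrite /vcoord cs.
have pcE : pcoord i c' s = pcoord i c s by rewrite /pcoord cs.
have xdE : xdot a b i c' s = xdot a b i c s.
  have n1 : \forall x \near s, `[a, b]%classic x -> qcoord i c x = qcoord i c' x.
    by apply: filterS near_cc => x h _; rewrite /qcoord h.
  exact: (is_derive_within_val hab sab' (is_derive_within_near (esym qE) n1 (qcoord_is_derive_within hc sab' ids))).
split.
- exact: (etrans xdE (etrans xE (esym vE))).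
- by rewrite pcE qE vE; exact: pE.
move=> k.
have -> : force a b alpha beta t L gam w c' i k s = force a b alpha beta t L gam w c i k s.
  by rewrite /force /grad_noise /grad_noise_dot qE vE xdE.
apply: near_eq_is_derive (dN k).
apply: filterS near_cc => x h.
by rewrite /noisy_momentum /grad_noise /pcoord /qcoord h.
Qed.

End extensionality.

(** * Families supported in one chart *)

Section bundle_points.
Context {R : realType} {n : nat} {Q : manifold R n}.
Implicit Types (i j : chart Q) (x : Q) (y u v p : 'rV[R]_n).

(** The point with coordinates (y, u, p) in the chart i. Vectors and covectors are stored
    in the preferred chart of their base point, hence the two changes of coordinates. *)
Definition bundle_point i y u p : PQ Q :=
  MkPQ (param i y) ('d (transition i (chart_at (param i y))) y u)
    (\row_k pairing p ('d (transition (chart_at (param i y)) i)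
        (coord (chart_at (param i y)) (param i y)) (delta_mx 0 k))).

Lemma tan_coord_bundle_point i j y u p : (coord i @` dom i) y -> dom j (param i y) ->
  tan_coord j (param i y) (vel (bundle_point i y u p)) = 'd (transition i j) y u.
Proof.
move=> iy jy; have ix := dom_param iy; have at_x := dom_chart_at (param i y).
rewrite /tan_coord /=.
have := dtransition_comp u ix at_x jy.
by rewrite (paramK iy).
Qed.

Lemma cot_coord_bundle_point i j y u p v : (coord i @` dom i) y -> dom j (param i y) ->
  pairing (cot_coord j (param i y) (mom (bundle_point i y u p))) v =
  pairing p ('d (transition j i) (transition i j y) v).
Proof.
move=> iy jy; have ix := dom_param iy; have at_x := dom_chart_at (param i y).
apply: etrans (pairing_cot_coord _ _ _ _) _; rewrite /=.
apply: etrans (pairing_row _ _ _) _.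
by congr (pairing _ _); exact: dtransition_comp.
Qed.

Lemma bundle_pointK i (z : PQ Q) : dom i (pos z) ->
  bundle_point i (coord i (pos z)) (tan_coord i (pos z) (vel z)) (cot_coord i (pos z) (mom z)) = z.
Proof.
case: z => x v p ix; rewrite /pos /vel /mom in ix *.
have E : param i (coord i x) = x := coordK ix.
rewrite /bundle_point E; have at_x := dom_chart_at x.
have Ev := dtransition_tan_coord_at v ix.
apply: f_equal2; first exact: Ev.
apply: pairing_ext => u.
apply: etrans (pairing_row _ _ _) _.
apply: etrans (pairing_cot_coord _ _ _ _) _.
congr (pairing _ _); apply: etrans (dtransition_comp u at_x ix at_x) _.
exact: dtransition_id.
Qed.

End bundle_points.

Section chart_variation.
Context {R : realType} {n : nat} {Q : manifold R n}.
Variables (a b : R) (hab : a < b) (qa qb : Q) (c : R -> PQ Q).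
Hypothesis hc : path_space a b qa qb c.
Variables (i : chart Q) (s1 s2 : R).
Hypotheses (as1 : a <= s1) (s12 : s1 < s2) (s2b : s2 <= b).
Hypothesis ids : forall s, s1 <= s <= s2 -> dom i (pos (c s)).
Variables (h h' kv lp : R -> 'rV[R]_n).
Hypothesis dh : forall s, a <= s <= b -> is_derive s 1 h (h' s).
Hypotheses (ch' : continuous h') (ckv : continuous kv) (clp : continuous lp).
Hypothesis supp : forall s, ~~ (s1 < s < s2) -> [/\ h s = 0, h' s = 0, kv s = 0 & lp s = 0].
Implicit Types (j : chart Q) (s e : R) (z y : R * R) (k : 'I_n).

Let YX s e := qcoord i c s + e *: h s.
Let YXd s e := xdot a b i c s + e *: h' s.
Let YV s e := vcoord i c s + e *: kv s.
Let YP s e := pcoord i c s + e *: lp s.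

(** The coordinates in the chart i are moved linearly on [s1, s2]. The increments vanish off
    the open interval, so the two branches agree at s1 and s2 and the curve is not moved
    elsewhere. *)
Definition chart_variation e s : PQ Q :=
  if s1 <= s <= s2 then bundle_point i (YX s e) (YV s e) (YP s e) else c s.
Local Notation F := chart_variation.

Lemma chart_variation_out e s : ~~ (s1 < s < s2) -> F e s = c s.
Proof.
move=> ns; rewrite /chart_variation; case: ifP => // ss.
have [h0 _ k0 l0] := supp ns.
rewrite /YX /YV /YP h0 k0 l0 !scaler0 !addr0.
exact: (bundle_pointK (ids ss)).
Qed.

(** The coordinate formula also holds off [s1, s2], as long as the curve is in the chart: there
    is no need to distinguish s1 and s2 from other times. *)
Lemma chart_variation_in e s : dom i (pos (c s)) ->
  F e s = bundle_point i (YX s e) (YV s e) (YP s e).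
Proof.
move=> ds; rewrite /chart_variation; case: ifP => // /negP ss.
have ns : ~~ (s1 < s < s2) by apply/negP => /andP[p1 p2]; apply: ss; rewrite !ltW.
have [h0 _ k0 l0] := supp ns.
rewrite /YX /YV /YP h0 k0 l0 !scaler0 !addr0.
exact/esym/(bundle_pointK ds).
Qed.

Lemma h_cvg s : a <= s <= b -> h @ within `[a, b] (nbhs s) --> h s.
Proof.
move=> sab; apply: within_of_continuous.
apply: differentiable_continuous; apply/derivable1_diffP.
exact: (@ex_derive _ _ _ _ _ _ _ (dh sab)).
Qed.

Lemma C1at_shift (X u : R -> 'rV[R]_n) z :
  X @ within `[a, b] (nbhs z.1) --> X z.1 -> u @ within `[a, b] (nbhs z.1) --> u z.1 ->
  C1at a b (fun s e => X s + e *: u s) (fun s _ => u s) z.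
Proof.
move=> cX cu.
have ce : C1at a b (fun _ e : R => e) (fun _ _ => 1) z.
  split; first exact: is_derive_id.
    have cs : (fun y : R * R => y.2) @ nbhs z --> z.2 by case: (z) => ? ?; exact: cvg_snd.
    exact: (cvg_trans (cvg_app _ (cvg_within _)) cs).
  exact: strip_cont_cst.
have := C1at_D (C1at_time cX) (C1at_Z ce (C1at_time cu)).
congr (C1at _ _ _ _ _); apply/funext => s; apply/funext => e.
by rewrite scaler0 addr0 scale1r add0r.
Qed.

(** The domain of the chart is open and [s1, s2] is compact, so one bound on the parameter
    serves all times. *)
Lemma chart_variation_domain : exists2 eta : R, 0 < eta &
  forall s e, a <= s <= b -> dom i (pos (c s)) -> `|e| < eta -> (coord i @` dom i) (YX s e).
Proof.
have ncov := (near_covering_withinP _).2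
               ((compact_near_coveringP _).1 (@segment_compact R s1 s2)).
have nE : \forall e \near (0:R), `[s1, s2] `<=` (fun s => (coord i @` dom i) (YX s e)).
  apply: (ncov R (nbhs (0:R)) (fun e s => (coord i @` dom i) (YX s e)) (nbhs_filter (0:R))) => s /=.
  rewrite in_itv /= => ss.
  have sab : a <= s <= b.
    by case/andP: ss => p1 p2; rewrite (le_trans as1 p1) (le_trans p2 s2b).
  have [_ cY _] := C1at_shift (z := (s, 0)) (qcoord_cvg hc sab (ids ss)) (h_cvg sab).
  have im : (coord i @` dom i) (YX s 0).
    by rewrite /YX scale0r addr0; exact: coord_image (ids ss).
  have n1 : nbhs ((s, 0) : R * R) (fun y => strip a b y -> (coord i @` dom i) (YX y.1 y.2)).
    exact: (cY _ (near_image im)).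
  have [[U1 U2] /= [n2 n3] UU] := n1.
  exists (U1, U2) => //= -[x e] /= [U1x U2e]; rewrite in_itv /= => /andP[p1 p2].
  by apply: (UU (x, e)) => //; rewrite /strip /= (le_trans as1 p1) (le_trans p2 s2b).
have [eta /= eta0 heta] := (nbhs_ballP _ _).1 nE.
exists eta => // s e sab ds ee.
have [ss|/negP ss] := boolP (s1 <= s <= s2).
  by apply: (heta e); rewrite /= ?in_itv // /ball /= sub0r normrN.
have ns : ~~ (s1 < s < s2) by apply/negP => /andP[p1 p2]; apply: ss; rewrite !ltW.
have [h0 _ _ _] := supp ns.
by rewrite /YX h0 scaler0 addr0; exact: coord_image.
Qed.

Lemma chart_variation0 s : F 0 s = c s.
Proof.
rewrite /chart_variation; case: ifP => // ss.
rewrite /YX /YV /YP !scale0r !addr0.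
exact: (bundle_pointK (ids ss)).
Qed.

Variables (eta : R) (eta0 : 0 < eta).
Hypothesis heta : forall s e, a <= s <= b -> dom i (pos (c s)) -> `|e| < eta ->
  (coord i @` dom i) (YX s e).

Definition chart_zone : set (R * R) :=
  [set z | [/\ a <= z.1 <= b, `|z.2| < eta & dom i (pos (c z.1))]].

Lemma near_chart_zone z : chart_zone z -> within (strip a b) (nbhs z) chart_zone.
Proof.
case: z => s e [/= sab ee ds].
have h1 := within_seg_strip e (pos_near_dom hc sab ds).
have h2 : within (strip a b) (nbhs (s, e)) (fam_domain a b eta).
  by apply: near_fam_domain; split.
by apply: filterS2 h1 h2 => -[x y] /= d1 [/= d2 d3]; split.
Qed.

Lemma C1at_YX z : chart_zone z -> C1at a b YX (fun s _ => h s) z.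
Proof. by move=> [sab _ ds]; exact: (C1at_shift (qcoord_cvg hc sab ds) (h_cvg sab)). Qed.

Lemma C1at_YXd z : chart_zone z -> C1at a b YXd (fun s _ => h' s) z.
Proof.
move=> [sab _ ds].
have cu : h' @ within `[a, b] (nbhs z.1) --> h' z.1.
  by apply: within_of_continuous; exact: ch'.
exact: (C1at_shift (xdot_cvg hc sab ds) cu).
Qed.

Lemma C1at_YV z : chart_zone z -> C1at a b YV (fun s _ => kv s) z.
Proof.
move=> [sab _ ds].
have cu : kv @ within `[a, b] (nbhs z.1) --> kv z.1.
  by apply: within_of_continuous; exact: ckv.
exact: (C1at_shift (vcoord_cvg hc sab ds) cu).
Qed.

Lemma C1at_YP z : chart_zone z -> C1at a b YP (fun s _ => lp s) z.
Proof.
move=> [sab _ ds].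
have cu : lp @ within `[a, b] (nbhs z.1) --> lp z.1.
  by apply: within_of_continuous; exact: clp.
exact: (C1at_shift (pcoord_cvg hc sab ds) cu).
Qed.

Lemma off_segment s : ~ dom i (pos (c s)) -> \forall x \near s, ~~ (s1 < x < s2).
Proof.
move=> nd; have [ss1|s1s] := ltP s s1.
  apply: filterS (lt_nbhsl ss1) => x xs1; apply/negP => /andP[h1 _].
  by have := lt_trans xs1 h1; rewrite ltxx.
have [s2s|ss2] := ltP s2 s.
  apply: filterS (lt_nbhsr s2s) => x xs2; apply/negP => /andP[_ h2].
  by have := lt_trans xs2 h2; rewrite ltxx.
by exfalso; apply: nd; apply: ids; rewrite s1s ss2.
Qed.

Lemma chart_variation_pos e s : a <= s <= b -> dom i (pos (c s)) ->
  pos (F e s) = param i (YX s e).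
Proof. by move=> _ ds; rewrite chart_variation_in. Qed.

Lemma chart_variation_pos_strip_cont z : fam_domain a b eta z ->
  strip_cont a b (fun s e => pos (F e s)) z.
Proof.
case: z => s e [/= sab ee]; have [ds|nd] := pselect (dom i (pos (c s))).
- have hz : chart_zone (s, e) by split.
  have cp : strip_cont a b (fun s e => param i (YX s e)) (s, e).
    have [_ cY _] := C1at_YX hz.
    exact: (strip_cont_comp (f := param i) (param_continuous (heta sab ds ee)) cY).
  apply: (strip_cont_near _ _ cp).
    apply: filterS (near_chart_zone hz) => -[x y] /= [/= xab _ dx].
    by rewrite chart_variation_in.
  by rewrite /= chart_variation_in.
- have cp : strip_cont a b (fun s _ => pos (c s)) (s, e).
    by apply: strip_cont_time; exact: (pos_cvg hc sab).
  have n1 : \forall x \near s, ~~ (s1 < x < s2) by exact: off_segment.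
  have n2 : within `[a, b] (nbhs s) (fun x => ~~ (s1 < x < s2)).
    by apply: filterS n1 => x hx _.
  apply: (strip_cont_near _ _ cp).
    by apply: filterS (within_seg_strip e n2) => -[x y] /= hx; rewrite chart_variation_out.
  by rewrite /= chart_variation_out //; exact: (nbhs_singleton n1).
Qed.

(** The set of pairs (s, e) at which the family is given by the coordinate formula and lies
    in the chart j; it is open in the strip. *)
Definition overlap_zone j : set (R * R) :=
  chart_zone `&` [set z | dom j (param i (YX z.1 z.2))].

Lemma near_overlap_zone j z : overlap_zone j z -> within (strip a b) (nbhs z) (overlap_zone j).
Proof.
move=> [hz jz]; have [sab ee ds] := hz.
have [_ cY _] := C1at_YX hz.
have cp : strip_cont a b (fun s e => param i (YX s e)) z.
  exact: (strip_cont_comp (f := param i) (param_continuous (heta sab ds ee)) cY).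
have h1 : within (strip a b) (nbhs z) (fun y => dom j (param i (YX y.1 y.2))).
  exact: (cp _ (near_dom jz)).
by apply: filterS2 h1 (near_chart_zone hz) => y h1 h2; split.
Qed.

Lemma overlap_image j z : overlap_zone j z ->
  (coord i @` (dom i `&` dom j)) (YX z.1 z.2).
Proof.
move=> [[sab ee ds] jz]; have im := heta sab ds ee.
exists (param i (YX z.1 z.2)); last exact: paramK.
by split => //; exact: dom_param.
Qed.

Let mq j s e := transition i j (YX s e).
Let mlin j (Z : R -> R -> 'rV[R]_n) s e :=
  \sum_k Z s e 0 k *: 'D_(delta_mx 0 k) (transition i j) (YX s e).
Let mp j s e := \row_k pairing (YP s e) ('D_(delta_mx 0 k) (transition j i) (transition i j (YX s e))).

(** In another chart the coordinates of the family are images under the transition map, whose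
    smoothness provides the derivatives in e. The derivative is existential as only its
    continuity matters. *)
Lemma C1_mq j : exists dU, forall z, overlap_zone j z -> C1at a b (mq j) dU z.
Proof.
eexists => z hz; apply: (C1at_Ck (transition_smooth i j 1%N) (overlap_image hz)).
by case: hz => hz _; exact: (C1at_YX hz).
Qed.

Lemma C1_mlin j Z dZ : (forall z, chart_zone z -> C1at a b Z dZ z) ->
  exists dU, forall z, overlap_zone j z -> C1at a b (mlin j Z) dU z.
Proof.
move=> hZ; have [_ c2] := transition_smooth i j 2%N.
eexists => z hz; have [cz _] := hz.
apply: C1at_sum => k; apply: C1at_Z; first exact: (C1at_row k (hZ z cz)).
exact: (C1at_Ck (c2 (delta_mx 0 k)) (overlap_image hz) (C1at_YX cz)).
Qed.

Lemma overlap_image_sym j z : overlap_zone j z ->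
  (coord j @` (dom j `&` dom i)) (mq j z.1 z.2).
Proof.
move=> [[sab ee ds] jz]; have im := heta sab ds ee.
by exists (param i (YX z.1 z.2)) => //; split => //; exact: dom_param.
Qed.

Lemma C1_mp j : exists dU, forall z, overlap_zone j z -> C1at a b (mp j) dU z.
Proof.
have [_ c2] := transition_smooth j i 2%N; have [dq hq] := C1_mq j.
pose dU s e := \row_k (pairing (lp s) ('D_(delta_mx 0 k) (transition j i) (mq j s e)) +
  pairing (YP s e) (\sum_l dq s e 0 l *: 'D_(delta_mx 0 l) ('D_(delta_mx 0 k) (transition j i)) (mq j s e))).
exists dU => z hz; have [cz _] := hz.
apply: C1at_rows => k.
have := C1at_pairing (C1at_YP cz)
  (C1at_Ck (c2 (delta_mx 0 k)) (overlap_image_sym hz) (hq z hz)).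
by congr (C1at _ _ _ _ _); apply/funext => s; apply/funext => e; rewrite mxE.
Qed.

Lemma fam_q_zone j z : overlap_zone j z -> mq j z.1 z.2 = fam_q F j z.1 z.2.
Proof.
by move=> [[sab ee ds] jz]; rewrite /fam_q /qcoord (chart_variation_in _ ds).
Qed.

Lemma dtransition_YX j z u : overlap_zone j z ->
  'd (transition i j) (YX z.1 z.2) u = \sum_k u 0 k *: 'D_(delta_mx 0 k) (transition i j) (YX z.1 z.2).
Proof.
move=> hz; have [d _] := transition_smooth i j 1%N.
exact: (diff_coordinates u (row_coordinate_system n) (d _ (overlap_image hz))).
Qed.

Lemma fam_v_zone j z : overlap_zone j z -> mlin j YV z.1 z.2 = fam_v F j z.1 z.2.
Proof.
move=> hz; have [[sab ee ds] jz] := hz.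
rewrite /mlin -(dtransition_YX _ hz) /fam_v /vcoord (chart_variation_in _ ds).
exact/esym/(tan_coord_bundle_point _ _ (heta sab ds ee) jz).
Qed.

Lemma fam_p_zone j z : overlap_zone j z -> mp j z.1 z.2 = fam_p F j z.1 z.2.
Proof.
move=> hz; have [[sab ee ds] jz] := hz.
have [d _] := transition_smooth j i 1%N.
have dd := d _ (overlap_image_sym hz).
rewrite /fam_p /pcoord (chart_variation_in _ ds).
apply: pairing_ext => u.
apply: etrans _ (esym (cot_coord_bundle_point _ _ _ (heta sab ds ee) jz)).
have E : mp j z.1 z.2 = \row_k pairing (YP z.1 z.2)
    ('d (transition j i) (transition i j (YX z.1 z.2)) (delta_mx 0 k)).
  by apply/rowP => k; rewrite !mxE deriveE.
by rewrite E; exact: pairing_row.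
Qed.

Lemma fam_q_is_derive_within_zone j s e : overlap_zone j (s, e) ->
  is_derive_within a b (qcoord j (F e)) s (mlin j YXd s e).
Proof.
move=> hz; have [[/= sab ee ds] jz] := hz.
have [d _] := transition_smooth i j 1%N.
have d1 := is_derive_within_addZ hab (e := e) sab (qcoord_is_derive_within hc sab ds) (dh sab).
have d2 := is_derive_within_chain hab sab (d _ (overlap_image hz)) d1.
rewrite (dtransition_YX _ hz) in d2.
apply: is_derive_within_near d2; first exact: (fam_q_zone hz).
have := near_overlap_zone hz => -[[U1 U2] /= [n1 n2] UU].
have n3 : \forall x \near s, `[a, b]%classic x -> mq j x e = qcoord j (F e) x.
  apply: filterS n1 => x U1x; rewrite /= in_itv /= => xab.
  have xz : overlap_zone j (x, e) by apply: UU => //; split => //=; exact: (nbhs_singleton n2).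
  exact: (fam_q_zone xz).
exact: n3.
Qed.

Lemma fam_xdot_zone j z : overlap_zone j z -> mlin j YXd z.1 z.2 = fam_xdot a b F j z.1 z.2.
Proof.
case: z => s e hz; have [[/= sab ee ds] jz] := hz.
exact: (esym (is_derive_within_val hab sab (fam_q_is_derive_within_zone hz))).
Qed.

Lemma zone_glue j n' (U U' dU : R -> R -> 'rV[R]_n') :
  (forall z, overlap_zone j z -> C1at a b U dU z) ->
  (forall z, overlap_zone j z -> U z.1 z.2 = U' z.1 z.2) ->
  forall z, overlap_zone j z -> C1at a b U' (fun s e => 'D_1 (U' s) e) z.
Proof.
move=> h1 h2 z hz; apply: (@C1at_glue _ a b _ U U' dU).
  by case: hz => -[].
by apply: filterS (near_overlap_zone hz) => y hy; split; [exact: h1|exact: h2].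
Qed.

Lemma off_glue n' (g : R -> 'rV[R]_n') (U' : R -> R -> 'rV[R]_n') s e : a <= s <= b ->
  within `[a, b] (nbhs s) (fun x => g @ within `[a, b] (nbhs x) --> g x) ->
  within `[a, b] (nbhs s) (fun x => forall e, U' x e = g x) ->
  C1at a b U' (fun s e => 'D_1 (U' s) e) (s, e).
Proof.
move=> sab h1 h2; apply: (@C1at_glue _ a b _ (fun s _ => g s) U' (fun _ _ => 0)) => //.
have h3 := within_seg_strip e h1; have h4 := within_seg_strip e h2.
by apply: filterS2 h3 h4 => y p1 p2; split; [exact: C1at_time|rewrite p2].
Qed.

Definition chart_regular j s e :=
  [/\ C1at a b (fam_q F j) (fun s e => 'D_1 (fam_q F j s) e) (s, e),
      C1at a b (fam_xdot a b F j) (fun s e => 'D_1 (fam_xdot a b F j s) e) (s, e),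
      C1at a b (fam_v F j) (fun s e => 'D_1 (fam_v F j s) e) (s, e),
      C1at a b (fam_p F j) (fun s e => 'D_1 (fam_p F j s) e) (s, e) &
      is_derive_within a b (qcoord j (F e)) s (fam_xdot a b F j s e)].

(** On the overlap with the chart i the coordinates in j are obtained by transition maps. *)
Lemma chart_regular_zone j s e : overlap_zone j (s, e) -> chart_regular j s e.
Proof.
move=> hz; have [dq hq] := C1_mq j; have [dp hp] := C1_mp j.
have [dv hv] := C1_mlin j C1at_YV; have [dxd hxd] := C1_mlin j C1at_YXd.
split.
- exact: (zone_glue hq (@fam_q_zone j) hz).
- exact: (zone_glue hxd (@fam_xdot_zone j) hz).
- exact: (zone_glue hv (@fam_v_zone j) hz).
- exact: (zone_glue hp (@fam_p_zone j) hz).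
- by rewrite -(fam_xdot_zone hz); exact: fam_q_is_derive_within_zone.
Qed.

(** Where the original curve is out of the chart i, the time is at a positive distance from
    [s1, s2], and nearby the family does not depend on the parameter. *)
Lemma chart_regular_off j s e : a <= s <= b -> ~ dom i (pos (c s)) ->
  dom j (pos (c s)) -> chart_regular j s e.
Proof.
move=> sab nd ds.
have n1 : \forall x \near s, forall e, F e x = c x.
  by apply: filterS (off_segment nd) => x hx e'; exact: chart_variation_out.
have n2 := pos_near_dom hc sab ds.
have n2' : \forall x \near s, `[a, b]%classic x -> dom j (pos (c x)) by exact: n2.
have inab x : `[a, b]%classic x -> a <= x <= b by rewrite /= in_itv.
have lift (P : set R) : (\forall x \near s, P x) -> within `[a, b] (nbhs s) P.
  by apply: filterS => x px _.
have dw e' x : a <= x <= b -> (\forall y \near x, forall e, F e y = c y) ->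
    dom j (pos (c x)) -> is_derive_within a b (qcoord j (F e')) x (xdot a b j c x).
  move=> xab nE dx; apply: is_derive_within_near (qcoord_is_derive_within hc xab dx).
    by rewrite /qcoord (nbhs_singleton nE).
  have n3 : \forall y \near x, `[a, b]%classic y -> qcoord j c y = qcoord j (F e') y.
    by apply: filterS nE => y hy _; rewrite /qcoord hy.
  exact: n3.
have n4 : \forall x \near s, \forall y \near x, forall e, F e y = c y.
  exact: nbhs_interior.
have xdE : within `[a, b] (nbhs s) (fun x => forall e', fam_xdot a b F j x e' = xdot a b j c x).
  apply: filterS2 n4 n2' => x h1 h2 xI e'.
  exact: (is_derive_within_val hab (inab x xI) (dw e' x (inab x xI) h1 (h2 xI))).
split.
- apply: (@off_glue _ (qcoord j c) (fam_q F j)) => //.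
    by apply: filterS n2' => x hx xI; exact: (qcoord_cvg hc (inab x xI) (hx xI)).
  by apply: lift; apply: filterS n1 => x hx e'; rewrite /fam_q /qcoord hx.
- apply: (@off_glue _ (xdot a b j c) (fam_xdot a b F j)) => //.
  by apply: filterS n2' => x hx xI; exact: (xdot_cvg hc (inab x xI) (hx xI)).
- apply: (@off_glue _ (vcoord j c) (fam_v F j)) => //.
    by apply: filterS n2' => x hx xI; exact: (vcoord_cvg hc (inab x xI) (hx xI)).
  by apply: lift; apply: filterS n1 => x hx e'; rewrite /fam_v /vcoord hx.
- apply: (@off_glue _ (pcoord j c) (fam_p F j)) => //.
    by apply: filterS n2' => x hx xI; exact: (pcoord_cvg hc (inab x xI) (hx xI)).
  by apply: lift; apply: filterS n1 => x hx e'; rewrite /fam_p /pcoord hx.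
- have n4s := nbhs_singleton n4.
  have E : fam_xdot a b F j s e = xdot a b j c s by exact: (is_derive_within_val hab sab (dw e s sab n4s ds)).
  by rewrite E; exact: dw.
Qed.

Lemma chart_variation_regular j s e : fam_chart a b F eta j (s, e) -> chart_regular j s e.
Proof.
move=> [[/= sab ee] dj]; have [ds|nd] := pselect (dom i (pos (c s))).
  apply: chart_regular_zone; split; first by split.
  by rewrite /= -(chart_variation_pos e sab ds).
apply: chart_regular_off => //.
by rewrite -(chart_variation_out e) //; exact: (nbhs_singleton (off_segment nd)).
Qed.

Lemma chart_variation_path e : `|e| < eta -> path_space a b qa qb (F e).
Proof.
move=> ee; have [_ pa pb _] := hc.
have Dz s : a <= s <= b -> fam_domain a b eta (s, e) by move=> sab; split.
have restrict j (V : topologicalType) (f : R -> V) s :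
    f @ within `[a, b] (nbhs s) --> f s ->
    f @ within [set s | a <= s <= b /\ dom j (pos (F e s))] (nbhs s) --> f s.
  move=> cf; apply: cvg_trans cf; apply: cvg_app; apply: within_subset.
  by move=> x [xab _]; rewrite /= in_itv.
split.
- apply/within_contP => s; rewrite /= in_itv /= => sab.
  exact: (strip_cont_slice (chart_variation_pos_strip_cont (Dz s sab))).
- by rewrite chart_variation_out // (le_gtF as1).
- by rewrite chart_variation_out // (le_gtF s2b) andbF.
- move=> j D; have reg s : D s -> chart_regular j s e.
    by move=> [sab dj]; apply: chart_variation_regular; split => //; exact: Dz.
  split; [split|..].
  + by move=> s Ds; have [_ _ _ _ d] := reg s Ds; apply/cvg_ex; exists (fam_xdot a b F j s e).
  + apply/within_contP => s Ds; have [_ [_ cx _] _ _ _] := reg s Ds.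
    exact: (restrict j _ _ s (strip_cont_slice cx)).
  + apply/within_contP => s Ds; have [_ _ [_ cx _] _ _] := reg s Ds.
    exact: (restrict j _ _ s (strip_cont_slice cx)).
  + apply/within_contP => s Ds; have [_ _ _ [_ cx _] _] := reg s Ds.
    exact: (restrict j _ _ s (strip_cont_slice cx)).
Qed.

Lemma chart_variation_C1 j (g : R -> R -> 'rV[R]_n) :
  (forall s e, fam_chart a b F eta j (s, e) -> C1at a b g (fun s e => 'D_1 (g s) e) (s, e)) ->
  C1_in_eps (fam_chart a b F eta j) g.
Proof.
move=> hg; split.
  by move=> [s e] hz; have [d _ _] := hg s e hz; exact: (@ex_derive _ _ _ _ _ _ _ d).
apply/within_contP => -[s e] hz; have [_ _ cx] := hg s e hz.
apply: cvg_trans cx; apply: cvg_app; apply: within_subset.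
exact: fam_chart_strip.
Qed.

Lemma chart_variation_pos_within :
  {within fam_domain a b eta, continuous (fun z => pos (F z.2 z.1))}.
Proof.
apply/within_contP => z Dz.
rewrite (strip_filter _ (near_fam_domain Dz)); first exact: chart_variation_pos_strip_cont.
by move=> y [].
Qed.

Lemma chart_variation_charts j :
  [/\ C1_in_eps (fam_chart a b F eta j) (fun s eps => qcoord j (F eps) s),
      C1_in_eps (fam_chart a b F eta j) (fun s eps => derive_within a b (qcoord j (F eps)) s),
      C1_in_eps (fam_chart a b F eta j) (fun s eps => vcoord j (F eps) s) &
      C1_in_eps (fam_chart a b F eta j) (fun s eps => pcoord j (F eps) s)].
Proof.
split.
- apply: (@chart_variation_C1 j (fam_q F j)) => s e hz.
  by have [r1 _ _ _ _] := chart_variation_regular hz; exact: r1.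
- apply: (@chart_variation_C1 j (fam_xdot a b F j)) => s e hz.
  by have [_ r1 _ _ _] := chart_variation_regular hz; exact: r1.
- apply: (@chart_variation_C1 j (fam_v F j)) => s e hz.
  by have [_ _ r1 _ _] := chart_variation_regular hz; exact: r1.
- apply: (@chart_variation_C1 j (fam_p F j)) => s e hz.
  by have [_ _ _ r1 _] := chart_variation_regular hz; exact: r1.
Qed.

(** The increments h, h', kv, lp are arbitrary apart from continuity and support: this is the
    supply of test functions for the fundamental lemma of the calculus of variations. *)
Lemma chart_variation_of : variation_of a b qa qb c F.
Proof.
exists eta; first exact: eta0.
split.
- by move=> s _; exact: chart_variation0.
- exact: chart_variation_path.
- exact: chart_variation_pos_within.
- exact: chart_variation_charts.
Qed.

Section own_chart.
Variables (s e : R) (sab : a <= s <= b) (ee : `|e| < eta) (ds : dom i (pos (c s))).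

Let own_zone : overlap_zone i (s, e).
Proof. by split; [split|apply: dom_param; exact: heta]. Qed.

(** In the chart i itself the formulas of the other charts reduce to the defining ones. *)
Lemma dtransition_own u : 'd (transition i i) (YX s e) u = u.
Proof.
have im := heta sab ds ee; have ix := dom_param im.
by have := dtransition_id u ix; rewrite (paramK im).
Qed.

Lemma fam_q_own : fam_q F i s e = YX s e.
Proof.
have im := heta sab ds ee.
by have := fam_q_zone own_zone; rewrite /mq /transition /= (paramK im).
Qed.

Lemma fam_xdot_own : fam_xdot a b F i s e = YXd s e.
Proof.
have := fam_xdot_zone own_zone; rewrite /mlin /= => <-.
by have := dtransition_YX (YXd s e) own_zone; rewrite /= dtransition_own => <-.
Qed.

Lemma fam_v_own : fam_v F i s e = YV s e.
Proof.
have := fam_v_zone own_zone; rewrite /mlin /= => <-.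
by have := dtransition_YX (YV s e) own_zone; rewrite /= dtransition_own => <-.
Qed.

Lemma fam_p_own : fam_p F i s e = YP s e.
Proof.
have im := heta sab ds ee.
rewrite /fam_p /pcoord (chart_variation_in _ ds); apply: pairing_ext => u.
apply: etrans (cot_coord_bundle_point _ _ _ im (dom_param im)) _.
have tE : transition i i (YX s e) = YX s e by rewrite /transition /= (paramK im).
by rewrite tE dtransition_own.
Qed.

End own_chart.

Lemma own_derive (U' U : R -> R -> 'rV[R]_n) (u : R -> 'rV[R]_n) s :
  a <= s <= b -> dom i (pos (c s)) ->
  (forall e, `|e| < eta -> U' s e = U s e) -> C1at a b U (fun s _ => u s) (s, 0) ->
  'D_1 (U' s) 0 = u s.
Proof.
move=> sab ds UE [d _ _].
have d2 : is_derive (0 : R) (1 : R) (U' s) (u s).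
  apply: near_eq_is_derive d.
  by apply: filterS (near_norm_lt (e := 0) (eta := eta) _) => [e ee|];
    [rewrite UE|rewrite normr0].
exact: (is_deriveE d2).
Qed.

Let zone0 s : a <= s <= b -> dom i (pos (c s)) -> chart_zone (s, 0).
Proof. by move=> sab ds; split => //=; rewrite normr0. Qed.

Lemma own_dq s : a <= s <= b -> dom i (pos (c s)) -> 'D_1 (fam_q F i s) 0 = h s.
Proof.
move=> sab ds; apply: (own_derive sab ds _ (C1at_YX (zone0 sab ds))) => e ee.
exact: fam_q_own.
Qed.

Lemma own_dxd s : a <= s <= b -> dom i (pos (c s)) -> 'D_1 (fam_xdot a b F i s) 0 = h' s.
Proof.
move=> sab ds; apply: (own_derive sab ds _ (C1at_YXd (zone0 sab ds))) => e ee.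
exact: fam_xdot_own.
Qed.

Lemma own_dv s : a <= s <= b -> dom i (pos (c s)) -> 'D_1 (fam_v F i s) 0 = kv s.
Proof.
move=> sab ds; apply: (own_derive sab ds _ (C1at_YV (zone0 sab ds))) => e ee.
exact: fam_v_own.
Qed.

Lemma own_dp s : a <= s <= b -> dom i (pos (c s)) -> 'D_1 (fam_p F i s) 0 = lp s.
Proof.
move=> sab ds; apply: (own_derive sab ds _ (C1at_YP (zone0 sab ds))) => e ee.
exact: fam_p_own.
Qed.

End chart_variation.

(** * Test functions and the lemma of du Bois-Reymond *)

Section test_functions.
Context {R : realType}.
Notation mu := (@lebesgue_measure R).
Variables (s1 s2 : R) (s12 : s1 < s2).

Lemma zero_of_integral (g : R -> R) : {within `[s1, s2], continuous g} ->
  (forall s, s1 <= s <= s2 -> 0 <= g s) -> \int[mu]_(s in `[s1, s2]) g s = 0 ->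
  forall s, s1 < s < s2 -> g s = 0.
Proof.
move=> cg g0 Ig s ss.
have G0 y : s1 <= y <= s2 -> \int[mu]_(x in `[s1, y]) g x = 0.
  move=> ys; have /andP[y1 y2] := ys.
  have i1 : 0 <= \int[mu]_(x in `[s1, y]) g x.
    by apply: seg_integral_ge0 => x /andP[x1 x2]; apply: g0; rewrite x1 (le_trans x2).
  have i2 : 0 <= \int[mu]_(x in `[y, s2]) g x.
    by apply: seg_integral_ge0 => x /andP[x1 x2]; apply: g0; rewrite x2 (le_trans y1).
  have := seg_integral_split ys cg; rewrite Ig; lra.
have d1 := seg_FTC1 ss cg.
have d2 : is_derive s 1 (fun y => \int[mu]_(x in `[s1, y]) g x) 0.
  have dc := is_derive_cst (0 : R) s (1 : R).
  apply: near_eq_is_derive dc.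
  by apply: filterS (near_oo ss) => y /andP[y1 y2]; rewrite G0 // !ltW.
by rewrite -(is_deriveE d1) (is_deriveE d2).
Qed.

(** Composition with [clamp] extends a function from [s1, s2] to a continuous function on the
    line; multiplication by [bump] then gives it support in the segment. *)
Definition clamp s := Num.max s1 (Num.min s s2).
Definition bump s := Num.max 0 ((s - s1) * (s2 - s)).

Lemma clamp_in s : s1 <= clamp s <= s2.
Proof. by rewrite /clamp le_max lexx /= ge_max (ltW s12) ge_min lexx orbT. Qed.

Lemma clampE s : s1 <= s <= s2 -> clamp s = s.
Proof. by move=> /andP[h1 h2]; rewrite /clamp (min_idPl h2) (max_idPr h1). Qed.

Lemma clamp_continuous : continuous clamp.
Proof.
move=> s.
have c1 : {for s, continuous (cst s1 : R -> R)} by exact: cvg_cst.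
have c2 : {for s, continuous (cst s2 : R -> R)} by exact: cvg_cst.
have c3 : {for s, continuous (id : R -> R)} by exact: cvg_id.
exact: (continuous_max c1 (continuous_min c3 c2)).
Qed.

Lemma bump_continuous : continuous bump.
Proof.
move=> s.
have c1 : {for s, continuous (cst 0 : R -> R)} by exact: cvg_cst.
have c2 : {for s, continuous (fun s : R => (s - s1) * (s2 - s))}.
  by apply: cvgM; apply: cvgB; try exact: cvg_cst; exact: cvg_id.
exact: (continuous_max c1 c2).
Qed.

Lemma bump_out s : ~~ (s1 < s < s2) -> bump s = 0.
Proof.
have := s12; rewrite negb_and -!leNgt => s12' h; apply/max_idPl.
by case/orP: h => h; [apply: mulr_le0_ge0|apply: mulr_ge0_le0]; lra.
Qed.

Lemma bump_gt0 s : s1 < s < s2 -> 0 < bump s.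
Proof. by move=> /andP[h1 h2]; rewrite /bump lt_max mulr_gt0 ?orbT // subr_gt0. Qed.

Lemma bump_ge0 s : 0 <= bump s.
Proof. by rewrite /bump le_max lexx. Qed.

Lemma clamp_comp_continuous (V : topologicalType) (f : R -> V) :
  {within `[s1, s2], continuous f} -> continuous (f \o clamp).
Proof.
move=> /within_contP cf s.
have cs : clamp s \in `[s1, s2] by rewrite in_itv /= clamp_in.
have := cf (clamp s) cs; move=> cfs A nA.
have n1 : \forall x \near clamp s, `[s1, s2]%classic x -> A (f x) by exact: (cfs A nA).
have n2 : \forall x \near s, `[s1, s2]%classic (clamp x) -> A (f (clamp x)).
  exact: (clamp_continuous n1).
by apply: filterS n2 => x; apply; rewrite /= in_itv /= clamp_in.
Qed.

(** The primitive is taken from a - 1 in order to be differentiable at a; it vanishes after s2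
    because phi has integral 0. *)
Lemma primitive_with_support (phi : R -> R) (a b : R) : a < s1 -> s2 < b ->
  continuous phi -> (forall s, ~~ (s1 < s < s2) -> phi s = 0) ->
  \int[mu]_(s in `[s1, s2]) phi s = 0 ->
  exists2 h, forall s, a <= s <= b -> is_derive s 1 h (phi s) &
    forall s, ~~ (s1 < s < s2) -> h s = 0.
Proof.
move=> as1 s2b cphi supp Iphi.
exists (fun s => \int[mu]_(x in `[a - 1, s]) phi x).
  move=> s /andP[as_ sb].
  by apply: (seg_FTC1 (v := b + 1)); [lra|exact: cont_seg].
have low s : s <= s1 -> \int[mu]_(x in `[a - 1, s]) phi x = 0.
  move=> ss1; apply: seg_integral0 => x /andP[_ xs]; apply: supp.
  by rewrite negb_and -!leNgt (le_trans xs ss1).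
move=> s; rewrite negb_and -!leNgt => /orP[|s2s]; first exact: low.
have s12' := s12.
have e1 : a - 1 <= s1 <= s by lra.
have e2 : s1 <= s2 <= s by lra.
rewrite (seg_integral_split e1 (cont_seg cphi)) low // add0r.
rewrite (seg_integral_split e2 (cont_seg cphi)) Iphi add0r.
apply: seg_integral0 => x /andP[sx _]; apply: supp.
by rewrite negb_and -!leNgt sx orbT.
Qed.

(** Let C be N minus a primitive of A, and m the mean of C with weight [bump]. The primitive h
    of (C - m) bump vanishes off the segment. Testing with h and integrating by parts gives
    the integral of C h' = 0, hence that of (C - m)^2 bump = 0, so C = m. *)
Lemma du_bois_reymond (N A : R -> R) (a b : R) : a < s1 -> s2 < b ->
  {within `[s1, s2], continuous N} -> {within `[s1, s2], continuous A} ->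
  (forall h h' : R -> R, (forall s, a <= s <= b -> is_derive s 1 h (h' s)) ->
     continuous h' -> (forall s, ~~ (s1 < s < s2) -> h s = 0 /\ h' s = 0) ->
     \int[mu]_(s in `[s1, s2]) (A s * h s + N s * h' s) = 0) ->
  forall s, s1 < s < s2 -> is_derive s 1 N (A s).
Proof.
move=> as1 s2b cN cA test.
have s12' : s1 <= s2 := ltW s12.
pose PA s := \int[mu]_(x in `[s1, s]) A x.
have cPA : {within `[s1, s2], continuous PA}.
  apply: (parameterized_integral_continuous s12').
  exact: seg_integrable.
have dPA s : s1 < s < s2 -> is_derive s 1 PA (A s) by move=> ss; exact: (seg_FTC1 ss cA).
pose C s := N s - PA s.
have cC : {within `[s1, s2], continuous C}.
  have cC' : {within `[s1, s2], continuous (fun s => N s - PA s)}.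
    by move=> s; apply: cvgB; [exact: cN|exact: cPA].
  exact: cC'.
have cbump u v : {within `[u, v], continuous bump} by apply: cont_seg; exact: bump_continuous.
have cCb : {within `[s1, s2], continuous (fun s => C s * bump s)}.
  by move=> s; apply: cvgM; [exact: cC|exact: cbump].
pose Ib := \int[mu]_(s in `[s1, s2]) bump s.
have Ib0 : Ib != 0.
  apply/eqP => I0; pose y := (s1 + s2) / 2.
  have s12'' := s12; have ys : s1 < y < s2 by rewrite /y; lra.
  have := zero_of_integral (@cbump _ _) (fun s _ => bump_ge0 s) I0 ys.
  by apply/eqP; rewrite gt_eqF // bump_gt0.
pose m := (\int[mu]_(s in `[s1, s2]) (C s * bump s)) / Ib.
pose phi s := (C (clamp s) - m) * bump s.
have cphi : continuous phi.
  move=> s; apply: cvgM; last exact: bump_continuous.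
  by apply: cvgB; [exact: (clamp_comp_continuous cC)|exact: cvg_cst].
have supp_phi s : ~~ (s1 < s < s2) -> phi s = 0 by move=> ns; rewrite /phi bump_out ?mulr0.
have phiE s : s1 <= s <= s2 -> phi s = C s * bump s - m * bump s.
  by move=> ss; rewrite /phi clampE // mulrBl.
have mI := seg_measurable s1 s2.
have cmb : {within `[s1, s2], continuous (fun s => m * bump s)}.
  by move=> s; apply: cvgM; [exact: cvg_cst|exact: cbump].
have Iphi : \int[mu]_(s in `[s1, s2]) phi s = 0.
  have -> : \int[mu]_(s in `[s1, s2]) phi s = \int[mu]_(s in `[s1, s2]) (C s * bump s - m * bump s).
    by apply: eq_Rintegral => s; rewrite inE /= in_itv /= => /phiE.
  rewrite (RintegralB mI (seg_integrable cCb) (seg_integrable cmb)).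
  rewrite (RintegralZl m mI (seg_integrable (@cbump _ _))) -/Ib /m divfK // subrr.
  by [].
have [h dh supp_h] := primitive_with_support as1 s2b cphi supp_phi Iphi.
have T := test h phi dh cphi (fun s ns => conj (supp_h s ns) (supp_phi s ns)).
have ab s : s1 <= s <= s2 -> a <= s <= b by move=> /andP[h1 h2]; lra.
have ch : {within `[s1, s2], continuous h}.
  by apply: (is_derive_seg_continuous (f' := phi)) => s /ab; exact: dh.
have cphi' : {within `[s1, s2], continuous phi} by exact: cont_seg.
have cAh : {within `[s1, s2], continuous (fun s => A s * h s + N s * phi s)}.
  by move=> s; apply: cvgD; apply: cvgM; [exact: cA|exact: ch|exact: cN|exact: cphi'].
have cPh : {within `[s1, s2], continuous (fun s => A s * h s + PA s * phi s)}.
  by move=> s; apply: cvgD; apply: cvgM; [exact: cA|exact: ch|exact: cPA|exact: cphi'].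
have IP : \int[mu]_(s in `[s1, s2]) (A s * h s + PA s * phi s) = 0.
  have -> : \int[mu]_(s in `[s1, s2]) (A s * h s + PA s * phi s) =
     (PA \* h) s2 - (PA \* h) s1.
    apply: (seg_FTC2 s12' cPh).
      by move=> s; apply: cvgM; [exact: cPA|exact: ch].
    move=> s ss; have sab : a <= s <= b by apply: ab; case/andP: ss => h1 h2; rewrite !ltW.
    have := is_deriveM (dPA s ss) (dh s sab) => d.
    by apply: is_derive_eq d _; rewrite /GRing.scale /= addrC; congr (_ + _); exact: mulrC.
  have e1 : h s1 = 0 by apply: supp_h; rewrite ltxx.
  have e2 : h s2 = 0 by apply: supp_h; rewrite ltxx andbF.
  by rewrite /= e1 e2 !mulr0 subrr.
have cCphi : {within `[s1, s2], continuous (fun s => C s * phi s)}.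
  by move=> s; apply: cvgM; [exact: cC|exact: cphi'].
have ICphi : \int[mu]_(s in `[s1, s2]) (C s * phi s) = 0.
  have -> : \int[mu]_(s in `[s1, s2]) (C s * phi s) =
     \int[mu]_(s in `[s1, s2]) ((A s * h s + N s * phi s) - (A s * h s + PA s * phi s)).
    by apply: eq_Rintegral => s _; rewrite /C; ring.
  by rewrite (RintegralB mI (seg_integrable cAh) (seg_integrable cPh)) T IP subrr.
have cmphi : {within `[s1, s2], continuous (fun s => m * phi s)}.
  by move=> s; apply: cvgM; [exact: cvg_cst|exact: cphi'].
pose g s := (C s - m) ^+ 2 * bump s.
have cCm : {within `[s1, s2], continuous (fun s => C s - m)}.
  by move=> s; apply: cvgB; [exact: cC|exact: cvg_cst].
have cg : {within `[s1, s2], continuous g}.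
  have cg' : {within `[s1, s2], continuous (fun s => (C s - m) * (C s - m) * bump s)}.
    by move=> s; apply: cvgM; [apply: cvgM; exact: cCm|exact: cbump].
  exact: cg'.
have Ig : \int[mu]_(s in `[s1, s2]) g s = 0.
  have -> : \int[mu]_(s in `[s1, s2]) g s = \int[mu]_(s in `[s1, s2]) (C s * phi s - m * phi s).
    apply: eq_Rintegral => s; rewrite inE /= in_itv /= => ss.
    by rewrite /g (phiE s ss); ring.
  rewrite (RintegralB mI (seg_integrable cCphi) (seg_integrable cmphi)) ICphi.
  by rewrite (RintegralZl m mI (seg_integrable cphi')) Iphi mulr0 subrr.
have g0 s : s1 <= s <= s2 -> 0 <= g s by move=> _; rewrite mulr_ge0 ?bump_ge0 ?sqr_ge0.
have CE s : s1 < s < s2 -> N s = m + PA s.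
  move=> ss; have := zero_of_integral cg g0 Ig ss.
  move=> /eqP; rewrite mulf_eq0 (gt_eqF (bump_gt0 ss)) orbF sqrf_eq0 /C => /eqP h0; lra.
move=> s ss.
have d := is_deriveD (is_derive_cst m s (1:R)) (dPA s ss); rewrite add0r in d.
apply: near_eq_is_derive d.
by apply: filterS (near_oo ss) => x /CE ->.
Qed.

End test_functions.

(** * Critical points satisfy the Euler-Lagrange system *)

Section locality.
Context {R : realType} {n m : nat} {Q : manifold R n}.
Variables (a b : R) (hab : a < b) (qa qb : Q) (alpha beta t : R).
Variables (L : TQ Q -> R) (gam : 'I_m -> Q -> R) (w : 'I_m -> R -> R).

(** The velocity at s is a limit, so agreement at s alone would not suffice. *)
Lemma density_local (c c' : R -> PQ Q) s : path_space a b qa qb c -> a < s < b ->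
  (\forall x \near s, c x = c' x) ->
  density a b alpha beta t L gam w c' s = density a b alpha beta t L gam w c s.
Proof.
move=> hc sab near_cc.
have sab' := itvooW sab.
have cs : c s = c' s := nbhs_singleton near_cc.
have qE : qdot a b c' s = qdot a b c s.
  rewrite /qdot -cs; set i := chart_at _.
  have n1 : \forall x \near s, `[a, b]%classic x -> qcoord i c x = qcoord i c' x.
    by apply: filterS near_cc => x h _; rewrite /qcoord h.
  have e1 : qcoord i c s = qcoord i c' s by rewrite /qcoord cs.
  exact: (is_derive_within_val hab sab' (is_derive_within_near e1 n1 (qcoord_is_derive_within hc sab' (dom_chart_at _)))).
by rewrite /density /noise_dot qE -cs.
Qed.

End locality.

Section necessity.
Context {R : realType} {n m : nat} {Q : manifold R n}.
Notation lebesgue := (@lebesgue_measure R).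
Variables (a b : R) (hab : a < b) (qa qb : Q) (alpha beta t : R).
Hypothesis halpha : 0 < alpha <= 1.
Hypothesis ht : b < t \/ (alpha = 1 /\ beta = 1).
Variables (L : TQ Q -> R) (hL : C2_lipschitz_lagrangian L).
Variables (gam : 'I_m -> Q -> R) (hgam : forall r, C2_lipschitz (gam r)).
Variables (w : 'I_m -> R -> R) (hw : forall r, {within `[a, b], continuous (w r)}).
Variables (c : R -> PQ Q) (hc : path_space a b qa qb c).
Hypothesis hcrit : critical_point a b qa qb L gam alpha beta t w c.
Implicit Types (s e : R) (k : 'I_n).

Local Notation A := (force a b alpha beta t L gam w c).
Local Notation N := (noisy_momentum alpha beta t gam w c).

Section segment.
Variables (i : chart Q) (s1 s2 : R).
Hypotheses (as1 : a < s1) (s12 : s1 < s2) (s2b : s2 < b).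
Hypothesis ids : forall s, s1 <= s <= s2 -> dom i (pos (c s)).

Let inab s : s1 <= s <= s2 -> a < s < b.
Proof. by move=> /andP[h1 h2]; rewrite (lt_le_trans as1 h1) (le_lt_trans h2 s2b). Qed.

Let inabW s : s1 <= s <= s2 -> a <= s <= b.
Proof. by move=> /inab/andP[h1 h2]; rewrite !ltW. Qed.

Let gp s := dLdv L i (qcoord i c s) (vcoord i c s) - pcoord i c s.
Let gv s := xdot a b i c s - vcoord i c s.

(** The family does not move the curve off [s1, s2], so only this segment contributes to the derivative of
    the action; there dq, dq', dv, dp are h, h', kv, lp. *)
Lemma critical_weak (h h' kv lp : R -> 'rV[R]_n) :
  (forall s, a <= s <= b -> is_derive s 1 h (h' s)) ->
  continuous h' -> continuous kv -> continuous lp ->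
  (forall s, ~~ (s1 < s < s2) -> [/\ h s = 0, h' s = 0, kv s = 0 & lp s = 0]) ->
  \int[lebesgue]_(s in `[s1, s2])
    (\sum_k (A i k s * h s 0 k + N i k s * h' s 0 k) +
     drift_weight alpha t s * (pairing (gp s) (kv s) + pairing (gv s) (lp s))) = 0.
Proof.
move=> dh ch' ckv clp supp.
have as1' : a <= s1 := ltW as1.
have s2b' : s2 <= b := ltW s2b.
have s12' : s1 <= s2 := ltW s12.
have [eta eta0 heta] := chart_variation_domain hc as1' s2b' ids dh supp.
have V := chart_variation_of hab hc as1' s2b' ids dh ch' ckv clp supp eta0 heta.
have V0 := chart_variation0 ids h kv lp.
have Vout := chart_variation_out ids supp.
have Vq := own_dq hc dh supp eta0 heta.
have Vxd := own_dxd hab hc dh ch' supp eta0 heta.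
have Vv := own_dv hc ckv supp eta0 heta.
have Vp := own_dp hc clp supp eta0 heta.
move: V V0 Vout Vq Vxd Vv Vp.
(* only the properties listed above are used of the family *)
move: (chart_variation c i s1 s2 h kv lp) => F V V0 Vout Vq Vxd Vv Vp.
have [eta' eta0' [_ hF cpos hC]] := V.
have F0 : F 0 = c by apply/funext.
pose D s := 'D_1 (fun e => density a b alpha beta t L gam w (F e) s) 0.
have dA := action_derive hab eta0' hF cpos hC halpha ht hL hgam hw.
have dA0 := hcrit V.
have I0 : \int[lebesgue]_(s in `[a, b]) D s = 0.
  have E : (Gamma alpha)^-1 * \int[lebesgue]_(s in `[a, b]) D s = 0.
    by rewrite -(is_deriveE dA) (is_deriveE dA0).
  move/eqP: E; rewrite mulf_eq0 invr_eq0 (gt_eqF (Gamma_gt0 halpha)) /=.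
  by move=> /eqP.
have cD : {within `[a, b], continuous D}.
  apply/within_contP => s; rewrite /= in_itv /= => sab.
  have Dz : fam_domain a b eta' (s, 0) by split => //=; rewrite normr0.
  have [_ _ hh] := C1at_fam_density hab hF cpos hC ht hL hgam hw Dz.
  exact: (strip_cont_slice hh).
have Doff s : a < s < b -> (\forall x \near s, ~~ (s1 < x < s2)) -> D s = 0.
  move=> sab near_out.
  have E : (fun e => density a b alpha beta t L gam w (F e) s) =
           cst (density a b alpha beta t L gam w c s).
    apply/funext => e; apply: (density_local hab alpha beta t L gam w hc sab).
    by apply: filterS near_out => x /(Vout e x) ->.
  by rewrite /D E; exact: derive_cst.
(* the end points, at which the variation might not be constant nearby, are negligible *)
have Ioff u v : a <= u -> u <= v -> v <= b ->
    (forall s, u < s < v -> ~~ (s1 < s < s2)) -> \int[lebesgue]_(s in `[u, v]) D s = 0.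
  move=> au uv vb out.
  have -> : \int[lebesgue]_(s in `[u, v]) D s = cst 0 v - cst 0 u :> R.
    apply: (seg_FTC2 (F := cst 0) uv).
    - exact: (seg_sub_cont au vb cD).
    - by apply: cont_seg => s; exact: cvg_cst.
    move=> s suv.
    have sab : a < s < b.
      by case/andP: suv => h1 h2; rewrite (le_lt_trans au h1) (lt_le_trans h2 vb).
    rewrite (Doff s sab); first exact: is_derive_cst.
    by apply: filterS (near_oo suv) => x; exact: out.
  by rewrite /cst subrr.
have e1 : a <= s1 <= b by rewrite as1' (le_trans s12' s2b').
have e2 : s1 <= s2 <= b by rewrite s12' s2b'.
have cD2 : {within `[s1, b], continuous D} by exact: (seg_sub_cont as1' (lexx b) cD).
have O1 : \int[lebesgue]_(s in `[a, s1]) D s = 0.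
  apply: Ioff => //; first by case/andP: e1.
  by move=> s /andP[_ h1]; rewrite negb_and -!leNgt (ltW h1).
have O2 : \int[lebesgue]_(s in `[s2, b]) D s = 0.
  apply: Ioff => //; first by case/andP: e1 => h1 _; exact: le_trans h1 s12'.
  by move=> s /andP[h1 _]; rewrite negb_and -!leNgt (ltW h1) orbT.
have I1 : \int[lebesgue]_(s in `[s1, s2]) D s = 0.
  have S1 := seg_integral_split e1 cD.
  have S2 := seg_integral_split e2 cD2.
  by move: S1; rewrite I0 S2 O1 O2 addr0 add0r.
apply: etrans _ I1; apply: eq_Rintegral => s; rewrite inE /= in_itv /= => ss.
have id0 : dom i (pos (F 0 s)) by rewrite F0; exact: ids.
have FV := first_variation hab eta0' hF cpos hC ht hL hgam hw (inab ss) id0.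
rewrite (Vq s (inabW ss) (ids ss)) (Vxd s (inabW ss) (ids ss)) in FV.
rewrite (Vv s (inabW ss) (ids ss)) (Vp s (inabW ss) (ids ss)) F0 in FV.
exact: esym FV.
Qed.

Let mI := seg_measurable s1 s2.

Lemma critical_fibers (kv lp : R -> 'rV[R]_n) : continuous kv -> continuous lp ->
  (forall s, ~~ (s1 < s < s2) -> kv s = 0 /\ lp s = 0) ->
  \int[lebesgue]_(s in `[s1, s2])
    (drift_weight alpha t s * (pairing (gp s) (kv s) + pairing (gv s) (lp s))) = 0.
Proof.
move=> ckv clp supp.
have d0 s : a <= s <= b -> is_derive s 1 (cst 0 : R -> 'rV[R]_n) ((cst 0 : R -> 'rV[R]_n) s).
  by move=> _; exact: is_derive_cst.
have c0 : continuous (cst 0 : R -> 'rV[R]_n) by move=> s; exact: cvg_cst.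
have supp0 s : ~~ (s1 < s < s2) ->
    [/\ cst 0 s = 0 :> 'rV[R]_n, cst 0 s = 0 :> 'rV[R]_n, kv s = 0 & lp s = 0].
  by move=> /supp[k0 l0]; split.
apply: etrans _ (critical_weak d0 c0 ckv clp supp0).
apply: eq_Rintegral => s _; rewrite [X in _ = X + _]big1 ?add0r // => k _.
by rewrite /cst mxE !mulr0 addr0.
Qed.

(** If t is not beyond b then alpha = 1, and the power with exponent 0 is 1. *)
Lemma drift_weight_gt0 s : s <= b -> 0 < drift_weight alpha t s.
Proof.
move=> sb; rewrite /drift_weight; case: (alpha_exponent ht sb) => [st|->].
  by rewrite powR_gt0 // subr_gt0.
by rewrite powRr0.
Qed.

Definition localized (g : R -> 'rV[R]_n) s := bump s1 s2 s *: g (clamp s1 s2 s).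

Lemma localized_continuous (g : R -> 'rV[R]_n) :
  {within `[s1, s2], continuous g} -> continuous (localized g).
Proof.
move=> cg s; apply: cvgZ; first exact: bump_continuous.
exact: (clamp_comp_continuous s12 cg).
Qed.

Lemma localized_out (g : R -> 'rV[R]_n) s : ~~ (s1 < s < s2) -> localized g s = 0.
Proof. by move=> ns; rewrite /localized (bump_out s12 ns) scale0r. Qed.

(** The integrand is the square of the length of g times a weight that is positive inside
    the segment. *)
Lemma localized_test (g : R -> 'rV[R]_n) : {within `[s1, s2], continuous g} ->
  \int[lebesgue]_(s in `[s1, s2]) (drift_weight alpha t s * pairing (g s) (localized g s)) = 0 ->
  forall s, s1 < s < s2 -> g s = 0.
Proof.
move=> cg I0 s ss.
pose G s := drift_weight alpha t s * (bump s1 s2 s * pairing (g s) (g s)).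
have gg0 x : 0 <= pairing (g x) (g x).
  by apply: sumr_ge0 => k _; rewrite -expr2 sqr_ge0.
have G0 x : s1 <= x <= s2 -> 0 <= G x.
  move=> xs; have /andP[_ xb] := inabW xs.
  by rewrite mulr_ge0 ?(ltW (drift_weight_gt0 xb)) // mulr_ge0 ?bump_ge0.
have cG : {within `[s1, s2], continuous G}.
  apply/within_contP => x xs.
  have xb : x <= b by move: (xs); rewrite /= in_itv /= => /inabW /andP[].
  have cgx k : (fun s => g s 0 k) @ within `[s1, s2] (nbhs x) --> g x 0 k.
    have /within_contP/(_ x xs) := cg.
    exact: (fun c => cvg_comp _ _ c (coord0_continuous k _)).
  apply: cvgM; first exact: (within_of_continuous _ _ (drift_weight_continuous ht xb)).
  apply: cvgM; first exact: (within_of_continuous _ _ (@bump_continuous R s1 s2 x)).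
  by apply: cvg_bigsum => k; apply: cvgM; exact: cgx.
have IG : \int[lebesgue]_(s in `[s1, s2]) G s = 0.
  apply: etrans _ I0; apply: eq_Rintegral => x; rewrite inE /= in_itv /= => xs.
  by rewrite /G /localized (clampE xs) pairingZr.
have := zero_of_integral cG G0 IG ss.
have /andP[_ sb] := inabW (itvooW ss).
move=> /eqP; rewrite /G !mulf_eq0 (gt_eqF (drift_weight_gt0 sb)) (gt_eqF (bump_gt0 ss)) /=.
by move=> /eqP; exact: pairing_self_eq0.
Qed.

Let vec_seg_cont (g : R -> 'rV[R]_n) :
  (forall s k, s1 <= s <= s2 -> (fun s => g s 0 k) @ within `[a, b] (nbhs s) --> g s 0 k) ->
  {within `[s1, s2], continuous g}.
Proof.
move=> h; apply: (seg_cont_of (a := a) (b := b) (ltW as1) (ltW s2b)) => s ss.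
by apply: cvg_row => k; exact: h.
Qed.

Let gp_cont : {within `[s1, s2], continuous gp}.
Proof.
apply: vec_seg_cont => s k ss.
have E : (fun s => gp s 0 k) =
    (fun s => dLdv L i (qcoord i c s) (vcoord i c s) 0 k - pcoord i c s 0 k).
  by apply/funext => x; rewrite /gp !mxE.
have Es : gp s 0 k = dLdv L i (qcoord i c s) (vcoord i c s) 0 k - pcoord i c s 0 k.
  by rewrite /gp !mxE.
rewrite E Es; apply: cvgB; first exact: (dLdv_cvg hL hc (inabW ss) (ids ss) (k := k)).
exact: (row_cvg (f := pcoord i c) (k := k) (pcoord_cvg hc (inabW ss) (ids ss))).
Qed.

Let gv_cont : {within `[s1, s2], continuous gv}.
Proof.
apply: vec_seg_cont => s k ss.
have E : (fun s => gv s 0 k) = (fun s => xdot a b i c s 0 k - vcoord i c s 0 k).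
  by apply/funext => x; rewrite /gv !mxE.
have Es : gv s 0 k = xdot a b i c s 0 k - vcoord i c s 0 k by rewrite /gv !mxE.
rewrite E Es; apply: cvgB.
  exact: (row_cvg (f := xdot a b i c) (k := k) (xdot_cvg hc (inabW ss) (ids ss))).
exact: (row_cvg (f := vcoord i c) (k := k) (vcoord_cvg hc (inabW ss) (ids ss))).
Qed.

(** The test functions are dp = q' - v and dv = dL/dv - p, cut off, and then dq along each
    basis vector. *)
Lemma critical_euler_lagrange s : s1 < s < s2 ->
  euler_lagrange a b alpha beta t L gam w c i s.
Proof.
move=> ss.
have c0 : continuous (cst 0 : R -> 'rV[R]_n) by move=> x; exact: cvg_cst.
split.
- apply/eqP; rewrite -subr_eq0; apply/eqP.
  apply: (localized_test gv_cont _ ss).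
  have supp x : ~~ (s1 < x < s2) -> cst 0 x = 0 :> 'rV[R]_n /\ localized gv x = 0.
    by move=> nx; split => //; exact: localized_out.
  apply: etrans _ (critical_fibers c0 (localized_continuous gv_cont) supp).
  by apply: eq_Rintegral => x _; rewrite pairing0 add0r.
- apply/esym/eqP; rewrite -subr_eq0; apply/eqP.
  apply: (localized_test gp_cont _ ss).
  have supp x : ~~ (s1 < x < s2) -> localized gp x = 0 /\ cst 0 x = 0 :> 'rV[R]_n.
    by move=> nx; split => //; exact: localized_out.
  apply: etrans _ (critical_fibers (localized_continuous gp_cont) c0 supp).
  by apply: eq_Rintegral => x _; rewrite pairing0 addr0.
move=> k.
have cN := seg_cont_of (ltW as1) (ltW s2b)
  (fun x xs => noisy_momentum_cvg ht hgam hw hc (inabW xs) (ids xs) (k := k)).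
have cA := seg_cont_of (ltW as1) (ltW s2b)
  (fun x xs => force_cvg ht hL hgam hw hc (inabW xs) (ids xs) (k := k)).
apply: (du_bois_reymond s12 as1 s2b cN cA _ ss) => h h' dh ch' supp.
(* dq moves the k-th coordinate only, so one component of the sum survives *)
pose u : 'rV[R]_n := delta_mx 0 k.
have du x : a <= x <= b -> is_derive x 1 (fun x => h x *: u) (h' x *: u).
  move=> xab; have := is_derive_scale (dh x xab) (is_derive_cst u x (1 : R)).
  by rewrite scaler0 addr0.
have cu : continuous (fun x => h' x *: u) by move=> x; apply: cvgZr_tmp; exact: ch'.
have suppu x : ~~ (s1 < x < s2) ->
    [/\ h x *: u = 0, h' x *: u = 0, cst 0 x = 0 :> 'rV[R]_n & cst 0 x = 0 :> 'rV[R]_n].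
  by move=> /supp[-> ->]; split => //; exact: scale0r.
apply: etrans _ (critical_weak du cu c0 c0 suppu).
apply: eq_Rintegral => x _; rewrite !pairing0 addr0 mulr0 addr0.
rewrite (bigD1 k) //= [X in _ = _ + X]big1 ?addr0.
  by rewrite !mxE !eqxx !mulr1.
by move=> l lk; rewrite !mxE (negbTE lk) andbF !mulr0 addr0.
Qed.

End segment.

Lemma critical_satisfies_euler_lagrange i s : a < s < b -> dom i (pos (c s)) ->
  euler_lagrange a b alpha beta t L gam w c i s.
Proof.
move=> sab is_; have [s1 [s2 [as1 ss s2b idx]]] := chart_segment hc sab is_.
have s12 : s1 < s2 by case/andP: ss => h1 h2; exact: lt_trans h2.
exact: (critical_euler_lagrange as1 s12 s2b idx ss).
Qed.

Lemma critical_fractional : fractional_equations a b L gam alpha beta t w c.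
Proof.
apply/(fractional_euler_lagrange hab ht hL hgam hw hc).
exact: critical_satisfies_euler_lagrange.
Qed.

End necessity.

(** The Euler-Lagrange system is passed from c to the member of parameter 0 of the family,
    along which the derivative of the action is computed. *)
Lemma fractional_critical (R : realType) (n m : nat) (Q : manifold R n) (a b : R)
    (hab : a < b) (qa qb : Q) (alpha beta t : R) (halpha : 0 < alpha <= 1)
    (ht : b < t \/ (alpha = 1 /\ beta = 1))
    (L : TQ Q -> R) (hL : C2_lipschitz_lagrangian L)
    (gam : 'I_m -> Q -> R) (hgam : forall r, C2_lipschitz (gam r))
    (w : 'I_m -> R -> R) (hw : forall r, {within `[a, b], continuous (w r)})
    (c : R -> PQ Q) (hc : path_space a b qa qb c) :
  fractional_equations a b L gam alpha beta t w c ->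
  critical_point a b qa qb L gam alpha beta t w c.
Proof.
move=> /(fractional_euler_lagrange hab ht hL hgam hw hc) EL F [eta eta0 [F0 hF cpos hC]].
apply: (action_stationary hab eta0 hF cpos hC halpha ht hL hgam hw) => i s sab.
have sab' := itvooW sab.
rewrite (F0 s sab') => ids.
apply: (euler_lagrange_ext hab _ hc sab ids (EL i s sab ids)) => x xab.
by rewrite F0.
Qed.

Theorem theorem2 (R : realType) (n m : nat) (Q : manifold R n)
    (a b : R) (hab : a < b) (qa qb : Q)
    (alpha beta t : R)
    (halpha : 0 < alpha <= 1) (hbeta : 0 < beta <= 1)
    (ht : b < t \/ (alpha = 1 /\ beta = 1))
    (L : TQ Q -> R) (hL : C2_lipschitz_lagrangian L)
    (gam : 'I_m -> Q -> R) (hgam : forall r, C2_lipschitz (gam r))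
    (d : measure_display) (Omega : measurableType d) (P : probability Omega R)
    (W : 'I_m -> R -> {RV P >-> R})
    (hW : forall r, wiener_process a b (filtration_of a W) (W r))
    (hWind : independent_processes a b W) :
  {ae P, forall om : Omega,
    forall c : R -> PQ Q, path_space a b qa qb c ->
      (fractional_equations a b L gam alpha beta t (fun r s => W r s om) c <->
       critical_point a b qa qb L gam alpha beta t (fun r s => W r s om) c)}.
Proof.
have hcont r : {ae P, forall om, {within `[a, b], continuous (fun s => W r s om)}}.
  by have [] := hW r.
have hall : {ae P, forall om, forall r, {within `[a, b], continuous (fun s => W r s om)}}.
  exact: filter_forall hcont.
apply: filterS hall => om hw c hc; split.
  exact: (fractional_critical hab halpha ht hL hgam hw hc).
exact: (critical_fractional hab halpha ht hL hgam hw hc).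
Qed.
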